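(* Let $n\ge1$, $0<\alpha<n$ and $1<p<n/\alpha$. Let $\Psi$ be a function from $[0,\infty)$ onto itself, positive on $(0,\infty)$, which is equivalent to a strictly increasing function, such that $\Psi(0)=0$, for every $c>0$ one has $\Psi(cs)\approx\Psi(s)$ for all $s>0$ (with constants that may depend on $c$), and $$\int_0^s\left(\frac{\Psi(u)}{u}\right)^{1/p}\frac{du}{u}\prec\left(\frac{\Psi(s)}{s}\right)^{1/p}\quad\text{for every } s>0 .$$ Set $\Psi^\alpha(s)=\Psi(s^{n-\alpha p})$ if $0<s<1$ and $\Psi^\alpha(s)=\Psi(s^n)$ if $s\ge1$. Then $$Cap^\Psi(H^\alpha_p)=C^{\Psi^\alpha}.$$
   Context: Notation: $X\prec Y$ means $X\le cY$ with a finite constant $c>0$ independent of the variables in question; $X\approx Y$ means $X\prec Y$ and $Y\prec X$. Two functions $\Psi,\widetilde\Psi$ on $[0,\infty)$ are equivalent if $\Psi\approx\widetilde\Psi$. $\mathbf R^{n+1}_+=\mathbf R^n\times(0,\infty)$. For an open set $O\subset\mathbf R^n$ the tent over $O$ is $TO=\{(x,t)\in\mathbf R^{n+1}_+: x\in O,\ t<\mathrm{dist}(x,\partial O)\}$ (the distance is $+\infty$ if $\partial O=\emptyset$). Bessel potential space $H^\alpha_p$: $f\in H^\alpha_p$ iff $f=G_\alpha*g$ with $g\in L^p(\mathbf R^n)$, and $\|f\|_{H^\alpha_p}=\|g\|_{L^p}$, where $G_\alpha(x)=|x|^{(\alpha-n)/2}K_{\frac{n-\alpha}{2}}(|x|)$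 is the Bessel kernel (up to a positive normalizing constant, the inverse Fourier transform of $(1+|\xi|^2)^{-\alpha/2}$), $K_\nu$ being the modified Bessel function of the third kind. Bessel capacity of an open set $O\subset\mathbf R^n$: $cap(O;H^\alpha_p)=\inf\{\|f\|_{H^\alpha_p}^p: f\in\mathcal S,\ f\ge0,\ f(x)\ge1\text{ if }x\in O\}$, where $\mathcal S$ is the Schwartz class on $\mathbf R^n$ (infimum of the empty set is $+\infty$, and a condition of the form $\mu(TO)\prec\Psi(+\infty)$ is regarded as void). Classes of positive Borel measures $\mu$ on $\mathbf R^{n+1}_+$, for a positive function $\Theta$ on $(0,\infty)$: $\mu\in Cap^{\Theta}(H^\alpha_p)$ iff $\mu(TO)\prec\Theta(cap(O;H^\alpha_p))$ uniformly for all open sets $O\subset\mathbf R^n$; $\mu\in C^{\Theta}$ iff $\mu(TB_r)\prec\Theta(r)$ uniformly for all balls $B_r\subset\mathbf R^n$ of radius $r>0$. *)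

(* Defs.v *)
From HB Require Import structures.
From mathcomp Require Import all_boot all_order all_algebra.
From mathcomp Require Import all_classical all_reals all_analysis.

Set Implicit Arguments.
Unset Strict Implicit.
Unset Printing Implicit Defensive.

Import Order.TTheory GRing.Theory Num.Theory.
Import numFieldNormedType.Exports.

Local Open Scope classical_set_scope.
Local Open Scope ring_scope.

Definition borel (T : ptopologicalType) := g_sigma_algebraType (@open T).
HB.instance Definition _ (T : ptopologicalType) := Measurable.on (borel T).

Lemma measurable_rV_coord (R : realType) (n : nat) (i : 'I_n) :
  measurable_fun [set: borel 'rV[R]_n]
    (fun x : borel 'rV[R]_n => (x : 'rV[R]_n) 0 i).
Proof.
apply: (measurability _ (measurable_realfun.RGenOpens.measurableE R)).
move=> _ [_ [a [b ->]] <-]; rewrite setTI.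
apply: sub_sigma_algebra; apply: open_comp; last exact: interval_open.
by move=> x _; exact: coord_continuous.
Qed.

Lemma measurable_fun_rV d (X : measurableType d) (R : realType) (n : nat)
    (f : X -> borel 'rV[R]_n) :
  (forall i, measurable_fun [set: X] (fun x => (f x : 'rV[R]_n) 0 i)) ->
  measurable_fun [set: X] f.
Proof.
move=> mf; apply: (@measurability _ _ _ (borel 'rV[R]_n) _ _ open).
  by [].
move=> _ [U oU <-]; rewrite setTI.
pose box (qk : 'rV[rat]_n * nat) : set 'rV[R]_n :=
  [set x | forall i, `|x 0 i - ratr (qk.1 0 i)| < qk.2.+1%:R^-1].
pose F qk := if `[< box qk `<=` U >] then f @^-1` box qk else set0.
rewrite (_ : _ @^-1` _ = \bigcup_qk F qk); last first.
  apply/seteqP; split => [x /= Ufx|x [qk _]]; last first.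
    by rewrite /F; case: ifPn => // /asboolP boxU /boxU.
  have /nbhs_ballP[e /= e0 eU] : nbhs (f x) U by exact: open_nbhs_nbhs.
  have [k ke] : exists k : nat, k.+1%:R^-1 < e / 2.
    have e20 : 0 < e / 2 by rewrite divr_gt0.
    have [k _ /(_ k (leqnn k)) ?] := near_infty_natSinv_lt (PosNum e20).
    by exists k.
  have q_ i : exists q : rat,
      `|(f x : 'rV[R]_n) 0 i - ratr q| < k.+1%:R^-1.
    have k0 : (0 : R) < k.+1%:R^-1 by rewrite invr_gt0.
    have [q] := @rat_in_itvoo R ((f x : 'rV[R]_n) 0 i)
      ((f x : 'rV[R]_n) 0 i + k.+1%:R^-1) ltac:(by rewrite ltrDl).
    rewrite in_itv/= => /andP[xq qx]; exists q.
    by rewrite distrC gtr0_norm ?subr_gt0// ltrBlDl.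
  have [q qP] := choice q_.
  have qE i : (\row_j q j) 0 i = q i by rewrite mxE.
  exists (\row_j q j, k) => //.
  rewrite /F; case: ifPn => [_|/asboolP]; last first.
    case=> y /= yq; apply: eU; split => // i j; rewrite (ord1 i) /ball/=.
    rewrite (le_lt_trans (ler_distD (ratr (q j)) _ _))//.
    rewrite (splitr e) ltrD//; first exact: lt_trans (qP j) ke.
    by rewrite distrC; apply: lt_trans ke; rewrite -qE.
  by move=> i /=; rewrite qE.
apply: countable_bigcupT_measurable; first exact: countableP.
move=> qk; rewrite /F; case: ifPn => // _.
rewrite (_ : _ @^-1` _ = \big[setI/setT]_(i < n)
    ((fun x => (f x : 'rV[R]_n) 0 i) @^-1`
       [set r | `|r - ratr (qk.1 0 i)| < qk.2.+1%:R^-1])).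
  apply: bigsetI_measurable => i _; rewrite -[X in measurable X]setTI.
  apply: mf => //.
  rewrite (_ : [set r | _] = ball (ratr (qk.1 0 i) : R) qk.2.+1%:R^-1).
    by apply: measurable_realfun.open_measurable; exact: ball_open.
  by apply/seteqP; split => r /=; rewrite /ball/= distrC.
rewrite -bigcap_seq; apply/seteqP; split => [x bx i _|x bx i]; first exact: bx.
by apply: bx; rewrite /= mem_index_enum.
Qed.

Section lebesgue_step.
Context {R : realType} (n : nat).
Variable mu : {sigma_finite_measure set (borel 'rV[R]_n) -> \bar R}.

Definition rV_cons (z : R * borel 'rV[R]_n) : borel 'rV[R]_n.+1 :=
  row_mx (z.1)%:M (z.2 : 'rV[R]_n).

Definition rV_uncons (x : borel 'rV[R]_n.+1) : R * borel 'rV[R]_n :=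
  ((x : 'rV[R]_(1 + n)) 0 0, rsubmx (x : 'rV[R]_(1 + n))).

Lemma rV_consK : cancel rV_cons rV_uncons.
Proof.
move=> [a x]; rewrite /rV_uncons /rV_cons row_mxKr; congr pair.
have -> : (0 : 'I_n.+1) = @lshift 1 n 0 by exact/val_inj.
by rewrite row_mxEl mxE eqxx mulr1n.
Qed.

Lemma measurable_rV_cons : measurable_fun [set: R * borel 'rV[R]_n] rV_cons.
Proof.
apply: measurable_fun_rV => i; case: (@split_ordP 1 n i) => j ->.
  rewrite (_ : (fun _ => _) = fst); first exact: measurable_fst.
  apply/funext => z; apply: etrans (row_mxEl (z.1)%:M (z.2 : 'rV[R]_n) 0 j) _.
  by rewrite (ord1 j) mxE eqxx mulr1n.
rewrite (_ : (fun _ => _) =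
    (fun x : borel 'rV[R]_n => (x : 'rV[R]_n) 0 j) \o snd).
  exact: measurableT_comp (measurable_rV_coord j) measurable_snd.
by apply/funext => z; exact: (row_mxEr (z.1)%:M (z.2 : 'rV[R]_n) 0 j).
Qed.

Lemma measurable_rV_uncons : measurable_fun [set: borel 'rV[R]_n.+1] rV_uncons.
Proof.
apply/measurable_fun_pairP; split; first exact: measurable_rV_coord.
apply: measurable_fun_rV => i; rewrite /rV_uncons/=.
under eq_fun do rewrite mxE.
exact: measurable_rV_coord.
Qed.

Definition lebesgue_step := pushforward (lebesgue_measure \x mu)%E rV_cons.

Let mrV_cons := measurable_rV_cons.

Let lebesgue_step0 : lebesgue_step set0 = 0%E.
Proof. exact: measure0. Qed.

Let lebesgue_step_ge0 A : (0 <= lebesgue_step A)%E.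
Proof. exact: measure_ge0. Qed.

Let lebesgue_step_sigma_additive : semi_sigma_additive lebesgue_step.
Proof. exact: measure_semi_sigma_additive. Qed.

HB.instance Definition _ := isMeasure.Build _ _ _ lebesgue_step
  lebesgue_step0 lebesgue_step_ge0 lebesgue_step_sigma_additive.

Let lebesgue_step_sigma_finite : sigma_finite setT lebesgue_step.
Proof.
have /sigma_finiteP[F [TF ndF Foo]] := sigma_finiteT (@lebesgue_measure R).
have /sigma_finiteP[G [TG ndG Goo]] := sigma_finiteT mu.
exists (fun k => rV_uncons @^-1` (F k `*` G k)).
  rewrite -preimage_bigcup (_ : \bigcup_k _ = setT) ?preimage_setT//.
  rewrite -setXTT TF TG; apply/seteqP.
  split=> [z [k _ []]|z [[i _ Fi] [j _ Gj]]].
    by move=> Fk Gk; split; exists k.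
  exists (maxn i j) => //; split.
  - by move: Fi; apply/subsetPset/ndF; exact: leq_maxl.
  - by move: Gj; apply/subsetPset/ndG; exact: leq_maxr.
move=> k; have [mF Fy] := Foo k; have [mG Gy] := Goo k; split.
  rewrite -[X in measurable X]setTI.
  by apply: measurable_rV_uncons => //; exact: measurableX.
rewrite /lebesgue_step /pushforward -comp_preimage.
rewrite (_ : rV_uncons \o rV_cons = id); last exact/funext/rV_consK.
by rewrite preimage_id product_measure1E// lte_mul_pinfty// ge0_fin_numE.
Qed.

HB.instance Definition _ := Measure_isSigmaFinite.Build _ _ _ lebesgue_step
  lebesgue_step_sigma_finite.
End lebesgue_step.

Fixpoint lebesgue_rV (R : realType) (n : nat) :
    {sigma_finite_measure set (borel 'rV[R]_n) -> \bar R} :=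
  match n with
  | 0 => dirac ((0 : 'rV[R]_0) : borel 'rV[R]_0)
  | n'.+1 => lebesgue_step (lebesgue_rV R n')
  end.

Lemma lebesgue_rV_box (R : realType) (n : nat) (a b : 'rV[R]_n) :
  (forall i, a 0 i <= b 0 i) ->
  lebesgue_rV R n [set x : 'rV[R]_n | forall i, a 0 i <= x 0 i <= b 0 i] =
  (\prod_(i < n) (b 0 i - a 0 i))%:E.
Proof.
elim: n a b => [|n IH] a b ab.
  by rewrite big_ord0 /= diracE mem_set//= => -[].
pose a' : 'rV[R]_n := rsubmx (a : 'rV[R]_(1 + n)).
pose b' : 'rV[R]_n := rsubmx (b : 'rV[R]_(1 + n)).
pose B : set (borel 'rV[R]_n) :=
  [set x : 'rV[R]_n | forall i, a' 0 i <= x 0 i <= b' 0 i].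
have lr i : lift ord0 i = @rshift 1 n i by exact/val_inj.
have a'E i : a' 0 i = a 0 (lift ord0 i) by rewrite mxE lr.
have b'E i : b' 0 i = b 0 (lift ord0 i) by rewrite mxE lr.
rewrite /= /lebesgue_step /pushforward.
rewrite (_ : _ @^-1` _ = `[a 0 0, b 0 0]%classic `*` B); last first.
  have cons0 z : (rV_cons z : 'rV[R]_n.+1) 0 0 = z.1.
    by have /(congr1 fst) := rV_consK z.
  have consS (z : R * borel 'rV[R]_n) i :
      (rV_cons z : 'rV[R]_n.+1) 0 (lift ord0 i) = (z.2 : 'rV[R]_n) 0 i.
    have /(congr1 (fun q => (q.2 : 'rV[R]_n) 0 i)) := rV_consK z.
    by rewrite mxE lr.
  apply/seteqP; split=> [z /= zab|z /= [z1 z2] i].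
    split; first by rewrite in_itv/= -cons0.
    by move=> i; rewrite a'E b'E -consS.
  have [j ->|->] := unliftP ord0 i; last by rewrite cons0; rewrite in_itv in z1.
  by rewrite consS -a'E -b'E.
have mB : measurable B.
  rewrite (_ : B = \big[setI/setT]_(i < n)
      ((fun x : borel 'rV[R]_n => (x : 'rV[R]_n) 0 i) @^-1` `[a' 0 i, b' 0 i])).
    apply: bigsetI_measurable => i _; rewrite -[X in measurable X]setTI.
    exact: measurable_rV_coord.
  rewrite -bigcap_seq; apply/seteqP; split => [x bx i _|x bx i] /=.
    by rewrite in_itv/=; exact: bx.
  by have /= := bx i; rewrite mem_index_enum in_itv/=; exact.
rewrite product_measure1E// [X in (_ * X)%E]IH; last first.
  by move=> i; rewrite a'E b'E.
rewrite [X in (X * _)%E](lebesgue_measure_itv `[a 0 0, b 0 0])/=.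
rewrite lte_fin big_ord_recl EFinM.
under [in RHS]eq_bigr do rewrite -a'E -b'E.
congr (_ * _)%E; have [//|ba] := ltP (a 0 0) (b 0 0).
suff -> : a 0 0 = b 0 0 by rewrite subrr.
by apply/eqP; rewrite eq_le ab ba.
Qed.

Section comparison.
Context {R : realType} {I : Type}.
Implicit Types (D : set I) (X Y : I -> \bar R).

Definition lesssim_on D X Y :=
  exists2 c : R, 0 < c & forall i, D i -> (X i <= c%:E * Y i)%E.

Definition asymp_on D X Y := lesssim_on D X Y /\ lesssim_on D Y X.

End comparison.

(* The library norm on 'rV[R]_n is the sup norm; it induces the same topology
   but not the same balls and distances. *)
Definition enorm (R : realType) (n : nat) (x : 'rV[R]_n) : R :=
  Num.sqrt (\sum_(i < n) x 0 i ^+ 2).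

Definition eball (R : realType) (n : nat) (x : 'rV[R]_n) (r : R) :
  set 'rV[R]_n := [set y | enorm (y - x) < r].

Definition boundary (T : topologicalType) (A : set T) : set T :=
  closure A `\` A°.

(* The distance to the empty set is +oo. *)
Definition edist_to (R : realType) (n : nat) (x : 'rV[R]_n)
    (A : set 'rV[R]_n) : \bar R :=
  ereal_inf [set (enorm (x - y))%:E | y in A].

Definition half_space (R : realType) (n : nat) : Type :=
  set_type [set z : 'rV[R]_n * R | 0 < z.2].

HB.instance Definition _ (R : realType) (n : nat) :=
  Topological.copy (half_space R n)
    (set_type [set z : 'rV[R]_n * R | 0 < z.2]).

Lemma half_space_point_subproof (R : realType) (n : nat) :
  ((0, 1) : 'rV[R]_n * R) \in [set z : 'rV[R]_n * R | 0 < z.2].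
Proof. by rewrite inE /=. Qed.

HB.instance Definition _ (R : realType) (n : nat) :=
  isPointed.Build (half_space R n)
    (exist _ (0, 1) (half_space_point_subproof R n)).

Definition tent (R : realType) (n : nat) (O : set 'rV[R]_n) :
    set (half_space R n) :=
  [set z | O (set_val z).1 /\
    ((set_val z).2%:E < edist_to (set_val z).1 (boundary O))%E].

Section schwartz.
Context {R : realType} {n : nat}.
Implicit Types f : 'rV[R]_n -> R.

Definition partial (i : 'I_n) f : 'rV[R]_n -> R :=
  fun x => 'D_(delta_mx 0 i) f x.

(* The sequences s play the role of multi-indices: s lists the directions of
   the successive differentiations. *)
Definition partials (s : seq 'I_n) f : 'rV[R]_n -> R := foldr partial f s.

Definition schwartz f :=
  (forall s x, differentiable (partials s f) x) /\
  (forall (beta : 'I_n -> nat) s, exists M : R, forall x : 'rV[R]_n,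
     `|(\prod_(i < n) x 0 i ^+ beta i) * partials s f x| <= M).

End schwartz.

Section bessel.
Context {R : realType} {n : nat}.
Implicit Types (f g : 'rV[R]_n -> R) (O : set 'rV[R]_n).

Definition cosh (t : R) : R := (expR t + expR (- t)) / 2.

(* The modified Bessel function K_nu of the third kind at r > 0, by
   K_nu(r) = \int_0^oo exp(- r cosh t) cosh(nu t) dt. *)
Definition bessel_K (nu r : R) : R :=
  \int[lebesgue_measure]_(t in `[0, +oo[)
    (expR (- (r * cosh t)) * cosh (nu * t)).

(* Only the values at x != 0 matter: the kernel is singular at 0 and is
   used only under an integral sign. *)
Definition bessel_kernel (alpha : R) (x : 'rV[R]_n) : R :=
  enorm x `^ ((alpha - n%:R) / 2) * bessel_K ((n%:R - alpha) / 2) (enorm x).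

(* f = G_alpha * g almost everywhere. Since f is real-valued, the equation
   forces y |-> G_alpha(x - y) g(y) to be integrable for almost every x. *)
Definition bessel_potential (alpha : R) f g :=
  {ae lebesgue_rV R n, forall x : 'rV[R]_n,
    (\int[lebesgue_rV R n]_y
       (bessel_kernel alpha (x - (y : 'rV[R]_n)) * g y)%:E)%E = (f x)%:E}.

(* The density g is unique up to a null set when it exists, so that the
   infimum below is its L^p norm; it is +oo when f is not in the space. *)
Definition bessel_norm (alpha p : R) f : \bar R :=
  ereal_inf [set 'N[lebesgue_rV R n]_(p%:E)[EFin \o g]%E | g in
    [set g : borel 'rV[R]_n -> R |
      g \in Lfun (lebesgue_rV R n) p%:E /\ bessel_potential alpha f g]].

Definition bessel_cap (alpha p : R) O : \bar R :=
  ereal_inf [set (bessel_norm alpha p f `^ p)%E | f in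
    [set f | [/\ schwartz f, forall x, 0 <= f x & forall x, O x -> 1 <= f x]]].

End bessel.

Section carleson_classes.
Context {R : realType} (n : nat).
Implicit Types Theta : R -> R.

Definition borel_measure := {measure set (borel (half_space R n)) -> \bar R}.

(* er_map sends +oo to +oo, so that open sets of infinite capacity impose no
   condition. *)
Definition Cap_class (alpha p : R) Theta : set borel_measure :=
  [set mu | lesssim_on (@open 'rV[R]_n) (fun O => mu (tent O))
              (fun O => er_map Theta (bessel_cap alpha p O))].

Definition C_class Theta : set borel_measure :=
  [set mu | lesssim_on [set xr : 'rV[R]_n * R | 0 < xr.2]
              (fun xr => mu (tent (eball xr.1 xr.2)))
              (fun xr => (Theta xr.2)%:E)].

Definition Psi_alpha (alpha p : R) (Psi : R -> R) (s : R) : R :=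
  if s < 1 then Psi (s `^ (n%:R - alpha * p)) else Psi (s ^+ n).

End carleson_classes.

Arguments Cap_class {R} n alpha p Theta.
Arguments C_class {R} n Theta.

(* Main.v *)
Require Import Defs.
From mathcomp Require Import all_boot all_order all_algebra.
From mathcomp Require Import all_classical all_reals all_analysis.
From mathcomp Require Import measurable_realfun ring lra.
Import Order.TTheory GRing.Theory Num.Theory.
Import numFieldNormedType.Exports.
Local Open Scope classical_set_scope.
Local Open Scope ring_scope.
Set Implicit Arguments.
Unset Strict Implicit.
Unset Printing Implicit Defensive.

(** The condition on balls is the condition on open sets, restricted to balls
    and made explicit: a ball of radius r has capacity comparable to
    u(r) = m^(- alpha p) r^n with m = min r 1, and Psi_alpha r = Psi (u r).

    From open sets to balls only the upper bound on the capacity of a ball is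
    needed ([bessel_cap_ball]). The test function is the Bessel potential of a
    Gaussian of width r. The substitution e^t = e^s / |x| in the integral for
    K_nu shows that the Bessel kernel is a mixture of Gaussians
    ([bessel_kernelE]); hence so is the potential of a Gaussian
    ([bessel_kernel_gauss]), with explicit weights. As a function of x it is a
    Laplace transform evaluated at the squared distance to the centre. All
    moments of the inverse rates are finite, so it is a Schwartz function
    ([radial_class_schwartz], [laplace_decay]), and its size on the ball is
    bounded below by restricting the mixture to the relevant scale
    ([conv_mass_ge]).

    From balls to open sets the argument is by duality, with no use of a
    strong-type capacitary inequality. Let g >= 0 have a potential that is at
    least 1 almost everywhere on O, and let (x, t) be in the tent over O. Then
    the potential is at least 1 on a cube of side comparable to t around x
    ([tent_eball]). Averaging over this cube replaces the singular kernel by a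
    bounded one ([bessel_kernel_cube]), and splitting it dyadically gives
    1 <= C sum_j b_j \int g(y) [ |x - y| + t < R_j ] dy with
    b_j = min(R_j, 1)^alpha R_j^-n ([potential_ge1_scales]). The bracket says that
    (x, t) lies in the tent over the ball of centre y and radius R_j
    ([sub_tent_eball]), whose mass is assumed to be at most c Psi (u_j),
    u_j = u(R_j). Integrating against a finite piece of the measure, of total mass
    M, Tonelli and Hoelder ([one_scale_le]) give
    M <= C |g|_p M^(1 - 1/p) sum_j (min (Psi u_j) M / u_j)^(1/p).
    The u_j grow geometrically because alpha p < n. Put M = Psi s0. The terms with
    u_j <= s0 are bounded by the integral condition on Psi, the others by a
    geometric series, so the sum is at most a multiple of (M / s0)^(1/p)
    ([sum_min_Psi]). The mass M cancels, leaving s0 <= C |g|_p^p, whence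
    M <= C Psi (|g|_p^p) ([finite_piece]). The constant does not depend on the
    piece, so the pieces may exhaust the tent ([carleson_estimate]); the infimum
    over g gives the capacity. *)

(** * Integrals on the line *)

(** Holds for an arbitrary upper function: the integral of a nonnegative
    function is a supremum over the simple functions below it. The generality
    matters because the gauge function of the theorem may be non-measurable. *)
Lemma ge0_le_integral_lower d (T : measurableType d) (R : realType)
    (mu : {measure set T -> \bar R}) (D : set T) (f g : T -> \bar R) :
  (forall x, D x -> (0 <= f x)%E) -> (forall x, D x -> (f x <= g x)%E) ->
  (\int[mu]_(x in D) f x <= \int[mu]_(x in D) g x)%E.
Proof.
move=> f0 fg.
have g0 x : D x -> (0 <= g x)%E by move=> Dx; rewrite (le_trans (f0 x Dx)) ?fg.
rewrite !ge0_integralE//; apply: ereal_sup_le => _ [h /= hf <-]; exists h => //.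
move=> x /=; apply: (le_trans (hf x)); rewrite /patch; case: ifPn => // xD.
by apply: fg; rewrite inE in xD.
Qed.

Section line.
Context {R : realType}.
Local Notation mu := (@lebesgue_measure R).
Implicit Types (f : R -> \bar R) (a b c s : R).

Lemma integralT_shift f c : measurable_fun [set: R] f ->
  (forall x, (0 <= f x)%E) ->
  (\int[mu]_x f x = \int[mu]_x f (x + c)%R)%E.
Proof.
move=> mf f0; pose sh : R -> measurableTypeR R := fun x => x + c.
rewrite -[RHS]/(\int[mu]_(x in sh @^-1` setT) (f \o sh) x)%E.
have msh : measurable_fun setT sh by exact: measurable_funD.
rewrite -ge0_integral_pushforward//=.
apply: eq_measure_integral => A mA _ /=.
apply: lebesgue_measure_unique => //= _ [[a b] _ <-] /=.
rewrite /pushforward (_ : _ @^-1` _ = `]a - c, b - c]%classic); last first.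
  by apply/seteqP; split => x /=; rewrite !in_itv/= ltrBlDr lerBrDr.
rewrite !lebesgue_measure_itv/= !lte_fin ltrD2r -!EFinB.
by case: ifP => // _; congr (_%:E); ring.
Qed.

Lemma integralT_opp f : measurable_fun [set: R] f ->
  (forall x, (0 <= f x)%E) ->
  (\int[mu]_x f x = \int[mu]_x f (- x)%R)%E.
Proof.
move=> mf f0; pose op : R -> measurableTypeR R := -%R.
have mop : measurable_fun setT op by exact: oppr_measurable.
rewrite -[RHS]/(\int[mu]_(x in op @^-1` setT) (f \o op) x)%E.
rewrite -ge0_integral_pushforward//=.
by apply: eq_measure_integral => A mA _ /=; exact/esym/lebesgue_measureN.
Qed.

Lemma integral_expR_abs_lty c : 0 < c ->
  (\int[mu]_x (expR (- (c * `|x|)))%:E < +oo)%E.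
Proof.
move=> c0; rewrite ge0_symfun_integralT//; last 2 first.
- move=> x; apply: continuous_comp; last exact: continuous_expR.
  apply: (@continuousN _ R^o); apply: continuousM; first exact: cst_continuous.
  exact: norm_continuous.
- by move=> x /=; rewrite normrN.
apply: lte_mul_pinfty => //.
have : (\int[mu]_(x in [set x | (0 <= x)%R]) (expR (- (c * `|x|)))%:E <=
     c^-1%:E * \int[mu]_x (exponential_pdf c x)%:E)%E.
  rewrite -ge0_integralZl//; last 3 first.
  - by apply/measurable_EFinP; exact: measurable_exponential_pdf.
  - by move=> x _; rewrite lee_fin exponential_pdf_ge0 // ltW.
  - by rewrite lee_fin invr_ge0 ltW.
  rewrite [leLHS]integral_mkcond; apply: ge0_le_integral_lower => x _.
    by rewrite patchE; case: ifPn; rewrite // lee_fin expR_ge0.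
  rewrite patchE; case: ifPn => [|_]; last first.
    by rewrite -EFinM lee_fin mulr_ge0// ?invr_ge0 ?exponential_pdf_ge0// ltW.
  rewrite inE/= => x0; rewrite ger0_norm// exponential_pdfE// -EFinM lee_fin.
  by rewrite mulrA mulVf ?gt_eqF// mul1r mulNr.
move=> /le_lt_trans; apply.
by rewrite integral_exponential_pdf// mule1 ltry.
Qed.

(** For negative [s] the factor exp (c s) already decays; for positive [s] the
    double exponential absorbs any power of exp s. The mixtures below are
    controlled in this way at both ends of the line. *)
Lemma double_expR_decay c (N : nat) : 0 < c -> exists2 C, 0 < C &
  forall s, expR (- (expR s / 2) + c * s) * (1 + expR s) ^+ N
            <= C * expR (- (c * `|s|)).
Proof.
move=> c0; pose A := c *+ 2 + N%:R; have A0 : 0 < A.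
  by rewrite ltr_wpDr// mulrn_wgt0.
pose L := ln (A * 2).
have eL : expR L = A * 2 by rewrite lnK// posrE mulr_gt0.
exists (2 ^+ N * expR (Num.max 0 (A * (L - 1)))).
  by rewrite mulr_gt0 ?exprn_gt0 ?expR_gt0.
move=> s; have [s0|s0] := leP s 0.
  rewrite ler0_norm// mulrN opprK mulrC -mulrA.
  have e1 : expR s <= 1 by rewrite -expR0 ler_expR.
  have e0 := expR_ge0 s.
  apply: ler_pM; [by rewrite exprn_ge0// addr_ge0|exact: expR_ge0| |].
    by rewrite lerXn2r// ?nnegrE; lra.
  rewrite -expRD ler_expR lerD2r.
  apply: (@le_trans _ _ 0); last by rewrite le_max lexx.
  by rewrite oppr_le0 divr_ge0.
rewrite gtr0_norm//.
have e1 : 1 <= expR s by rewrite -expR0 ler_expR ltW.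
apply: (@le_trans _ _ (expR (- (expR s / 2) + c * s) * (2 * expR s) ^+ N)).
  rewrite ler_pM2l ?expR_gt0// lerXn2r// ?nnegrE; [|lra..].
  by have := expR_ge0 s; lra.
rewrite exprMn mulrCA -mulrA ler_pM2l ?exprn_gt0//.
rewrite -expRM_natl -!expRD ler_expR.
have h : expR s = A * 2 * expR (s - L).
  by rewrite -eL -expRD addrC subrK.
have := expR_ge1Dx (s - L); rewrite -(ler_pM2l A0) => h2.
rewrite -subr_ge0; apply: le_trans (_ : 0 <= Num.max 0 (A * (L - 1)) - A * (L - 1)) _.
  by rewrite subr_ge0 le_max lexx orbT.
rewrite h -mulr_natl /A in h2 *; rewrite -subr_ge0.
move: h2; set M := Num.max _ _; set E := expR (s - L); rewrite -mulr_natr.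
by move=> h2; nra.
Qed.

End line.

(** * Integrals on the space of row vectors *)

Lemma measurable_borel_continuous (R : realType) (T : ptopologicalType)
    (f : T -> R) :
  continuous f -> measurable_fun [set: borel T] (f : borel T -> R).
Proof.
move=> cf; apply: (measurability _ (measurable_realfun.RGenOpens.measurableE R)).
move=> _ [_ [a [b ->]] <-]; rewrite setTI.
apply: sub_sigma_algebra; apply: open_comp; last exact: interval_open.
by move=> x _; exact: cf.
Qed.

Section rV.
Context {R : realType}.
Local Notation leb := (@lebesgue_measure R).
Local Notation rV n := 'rV[R]_n.

Lemma measurable_rV_sub d (X : measurableType d) n (f g : X -> borel (rV n)) :
  measurable_fun [set: X] f -> measurable_fun [set: X] g ->
  measurable_fun [set: X] (fun x => (f x : rV n) - g x : borel (rV n)).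
Proof.
move=> mf mg; apply: measurable_fun_rV => i.
rewrite (_ : (fun _ => _) =
  (fun x => (f x : rV n) 0 i) \- (fun x => (g x : rV n) 0 i)); last first.
  by apply/funext => x /=; rewrite !mxE.
by apply: measurable_funB; apply: measurableT_comp (measurable_rV_coord i) _.
Qed.

(** Lebesgue measure on row vectors is an iterated product measure, so Tonelli
    turns the integral of a product of functions of one coordinate each into
    the product of their integrals. *)
Lemma integral_rV_prod n (h : 'I_n -> R -> R) (c : 'I_n -> R) :
  (forall i, measurable_fun [set: R] (h i)) -> (forall i t, 0 <= h i t) ->
  (forall i, \int[leb]_t (h i t)%:E = (c i)%:E)%E ->
  (\int[lebesgue_rV R n]_x (\prod_i h i ((x : rV n) 0 i))%:E
   = (\prod_i c i)%:E)%E.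
Proof.
elim: n h c => [|n IH] h c mh h0 hc.
  rewrite big_ord0 /= integral_dirac//=.
    by rewrite diracE mem_set// mul1e big_ord0.
  apply/measurable_EFinP.
  by rewrite (_ : (fun _ => _) = cst 1)//; apply/funext => x; rewrite big_ord0.
have mP m (k : 'I_m -> R -> R) : (forall i, measurable_fun [set: R] (k i)) ->
    measurable_fun [set: borel (rV m)]
      (fun x : borel (rV m) => \prod_i k i ((x : rV m) 0 i)).
  move=> mk; apply: measurable_prod => i _.
  exact: measurableT_comp (mk i) (measurable_rV_coord i).
have consE (z : R * borel (rV n)) :
    \prod_i h i ((rV_cons z : rV n.+1) 0 i) =
    h ord0 z.1 * \prod_i h (lift ord0 i) ((z.2 : rV n) 0 i).
  have zE := rV_consK z.
  rewrite big_ord_recl; congr (h ord0 _ * _).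
    by move/(congr1 fst): zE.
  apply: eq_bigr => i _; congr (h _ _).
  move/(congr1 (fun q => (q.2 : rV n) 0 i)): zE => /= <-.
  have lr : lift ord0 i = @rshift 1 n i by exact/val_inj.
  by rewrite lr [RHS]mxE.
rewrite [LHS](_ : _ = \int[pushforward (leb \x lebesgue_rV R n)
    (@rV_cons R n)]_x (\prod_i h i ((x : rV n.+1) 0 i))%:E)%E; last first.
  apply: eq_measure_integral => [|mc A _ _ //]; exact: measurable_rV_cons.
rewrite ge0_integral_pushforward//=; last 3 first.
- exact: measurable_rV_cons.
- by apply/measurable_EFinP; exact: mP.
- by move=> x _; rewrite lee_fin prodr_ge0.
rewrite fubini_tonelli1//=; last 2 first.
- apply/measurable_EFinP.
  exact: (measurableT_comp (mP _ h mh) (@measurable_rV_cons R n)).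
- by move=> z; rewrite lee_fin prodr_ge0.
under eq_integral => a _.
  rewrite /fubini_F /=.
  under eq_integral do rewrite consE /= EFinM.
  rewrite ge0_integralZl//=; last 3 first.
  - apply/measurable_EFinP.
    exact: (mP _ (fun i => h (lift ord0 i)) (fun i => mh _)).
  - by move=> x _; rewrite lee_fin prodr_ge0.
  - by rewrite lee_fin.
  rewrite (IH (fun i => h (lift ord0 i)) (fun i => c (lift ord0 i)))//.
  over.
rewrite ge0_integralZr//=; last 3 first.
- by apply/measurable_EFinP; exact: mh.
- by move=> x _; rewrite lee_fin.
- rewrite lee_fin prodr_ge0// => i _.
  by rewrite -lee_fin -hc integral_ge0// => x _; rewrite lee_fin.
by rewrite hc -EFinM [in RHS]big_ord_recl.
Qed.

Lemma lebesgue_rV1 n (x : rV n) : (0 < n)%N ->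
  lebesgue_rV R n ([set x] : set (borel (rV n))) = 0%E.
Proof.
case: n x => // n x _; rewrite [X in lebesgue_rV R _ X](_ : _ =
    [set y : rV n.+1 | forall i, x 0 i <= y 0 i <= x 0 i]).
  by rewrite lebesgue_rV_box// big_ord_recl subrr mul0r.
apply/seteqP; split => [_ -> i|y /= h]; first by rewrite !lexx.
apply/rowP => i; apply/eqP; rewrite eq_le.
by have /andP[-> ->] := h i.
Qed.

(** One-dimensional Gaussian convolution: complete the square. *)
Lemma integral_gauss_conv (a b x z : R) : 0 < a -> 0 <= b ->
  (\int[leb]_t (expR (- (a * (x - t) ^+ 2 + b * (t - z) ^+ 2)))%:E =
   (Num.sqrt (pi / (a + b)) * expR (- (a * b / (a + b) * (x - z) ^+ 2)))%:E)%E.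
Proof.
move=> a0 b0; have ab0 : 0 < a + b by rewrite ltr_pwDl.
pose s : R := (Num.sqrt ((a + b) *+ 2))^-1.
have s0 : s != 0 by rewrite invr_neq0// gt_eqF// sqrtr_gt0 mulrn_wgt0.
have s2 : s ^+ 2 = ((a + b) *+ 2)^-1.
  by rewrite exprVn sqr_sqrtr// mulrn_wge0// ltW.
pose m := (a * x + b * z) / (a + b).
have pE : normal_peak s * Num.sqrt (pi / (a + b)) = 1.
  rewrite /normal_peak s2 (_ : _ *+ 2 = pi / (a + b)); last first.
    by rewrite -mulr_natr; field; rewrite !gt_eqF.
  by rewrite mulVf// gt_eqF// sqrtr_gt0 divr_gt0// pi_gt0.
have fE t : expR (- (a * (x - t) ^+ 2 + b * (t - z) ^+ 2)) =
   Num.sqrt (pi / (a + b)) * expR (- (a * b / (a + b) * (x - z) ^+ 2))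
   * normal_pdf m s t.
  rewrite normal_pdfE//= /normal_fun [RHS]mulrACA (mulrC (Num.sqrt _)) pE mul1r -expRD.
  congr expR; rewrite s2 -mulr_natr /m; field; rewrite !gt_eqF//.
under eq_integral do rewrite fE EFinM.
rewrite ge0_integralZl//=; last 2 first.
- by apply/measurable_EFinP; exact: measurable_normal_pdf.
- by move=> t _; rewrite lee_fin normal_pdf_ge0.
by rewrite integral_normal_pdf mule1.
Qed.

Lemma enorm_ge0 n (x : rV n) : 0 <= enorm x.
Proof. exact: sqrtr_ge0. Qed.

Lemma sqr_enorm n (x : rV n) : enorm x ^+ 2 = \sum_i x 0 i ^+ 2.
Proof. by rewrite sqr_sqrtr// sumr_ge0// => i _; exact: sqr_ge0. Qed.

Lemma coord_le_enorm n (x : rV n) i : `|x 0 i| <= enorm x.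
Proof.
rewrite -(@ler_pXn2r _ 2)// ?nnegrE ?enorm_ge0// sqr_enorm real_normK ?num_real//.
by rewrite (bigD1 i)//= lerDl sumr_ge0// => j _; exact: sqr_ge0.
Qed.

(** Both the Gaussians and the squared distance split over the coordinates, so the
    one-dimensional formula applies coordinate by coordinate. *)
Lemma integral_gauss_conv_rV n (a b : R) (x z : rV n) : 0 < a -> 0 <= b ->
  (\int[lebesgue_rV R n]_y
     (expR (- (a * enorm (x - (y : rV n)) ^+ 2 + b * enorm ((y : rV n) - z) ^+ 2)))%:E =
   (Num.sqrt (pi / (a + b)) ^+ n * expR (- (a * b / (a + b) * enorm (x - z) ^+ 2)))%:E)%E.
Proof.
move=> a0 b0.
have expS (I : finType) (F : I -> R) :
    expR (- \sum_i F i) = \prod_i expR (- F i) by rewrite -sumrN expR_sum.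
under eq_integral => y _.
  rewrite !sqr_enorm !mulr_sumr -big_split/= expS.
  rewrite (_ : (\prod_i _) = \prod_i expR (- (a * (x 0 i - (y : rV n) 0 i) ^+ 2
    + b * ((y : rV n) 0 i - z 0 i) ^+ 2))); last first.
    by apply: eq_bigr => i _; rewrite !mxE.
  over.
rewrite (@integral_rV_prod n (fun i t => expR (- (a * (x 0 i - t) ^+ 2
    + b * (t - z 0 i) ^+ 2))) (fun i => Num.sqrt (pi / (a + b)) *
      expR (- (a * b / (a + b) * (x 0 i - z 0 i) ^+ 2)))).
- congr EFin; rewrite big_split/= prodr_const card_ord sqr_enorm mulr_sumr expS.
  by congr (_ * _); apply: eq_bigr => i _; rewrite !mxE.
- move=> i; apply: measurableT_comp => //; apply: measurableT_comp => //.
  apply: measurable_funD; apply: measurable_funM => //;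
    by apply: measurable_funX; apply: measurable_funB.
- by move=> i t; exact: expR_ge0.
- by move=> i; exact: integral_gauss_conv.
Qed.

End rV.

(** * The Bessel kernel as a mixture of Gaussians *)

Section kernel.
Context {R : realType}.
Local Notation leb := (@lebesgue_measure R).
Local Notation rV n := 'rV[R]_n.
Implicit Types (nu s b r rho c : R).

(** With [a = heat_rate s], the Bessel kernel is the mixture over [s] of the
    Gaussians exp (- a |x|^2) with weights [mix_weight]; [conv_weight] and
    [conv_rate] describe in the same way its convolution with the Gaussian
    exp (- b |x|^2). *)
Definition heat_rate s : R := expR (- s) / 2.

Definition mix_weight nu s : R := expR (- (expR s / 2) - nu * s) / 2.

Definition conv_weight nu n b s : R :=
  mix_weight nu s * Num.sqrt (pi / (heat_rate s + b)) ^+ n.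

Definition conv_rate b s : R := heat_rate s * b / (heat_rate s + b).

Lemma heat_rate_gt0 s : 0 < heat_rate s.
Proof. by rewrite divr_gt0 ?expR_gt0. Qed.

Lemma mix_weight_gt0 nu s : 0 < mix_weight nu s.
Proof. by rewrite divr_gt0 ?expR_gt0. Qed.

Lemma heat_rateD_gt0 b s : 0 <= b -> 0 < heat_rate s + b.
Proof. by move=> b0; rewrite ltr_pwDl ?heat_rate_gt0. Qed.

Lemma conv_weight_ge0 nu n b s : 0 <= conv_weight nu n b s.
Proof. by rewrite mulr_ge0 ?exprn_ge0 ?sqrtr_ge0// ltW ?mix_weight_gt0. Qed.

Lemma conv_rate_ge0 b s : 0 <= b -> 0 <= conv_rate b s.
Proof.
by move=> b0; rewrite divr_ge0 ?mulr_ge0// ltW ?heat_rateD_gt0 ?heat_rate_gt0.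
Qed.

Lemma conv_rate_le b s : 0 <= b -> conv_rate b s <= b.
Proof.
move=> b0; rewrite ler_pdivrMr ?heat_rateD_gt0// mulrC.
by rewrite ler_wpM2l// lerDl.
Qed.

Lemma measurable_heat_rate : measurable_fun [set: R] heat_rate.
Proof.
by apply: measurable_funM => //; apply: (measurableT_comp (@measurable_expR R)).
Qed.

Lemma measurable_mix_weight nu : measurable_fun [set: R] (mix_weight nu).
Proof.
apply: measurable_funM => //; apply: (measurableT_comp (@measurable_expR R)).
apply: measurable_funB; last exact: measurable_funM.
by apply: measurable_funN; apply: measurable_funM => //; exact: measurable_expR.
Qed.

Lemma measurable_fun_inv d (T : measurableType d) (f : T -> R) :
  (forall x, 0 <= f x) -> measurable_fun [set: T] f ->
  measurable_fun [set: T] (fun x => (f x)^-1).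
Proof.
move=> f0 mf; rewrite (_ : (fun _ => _) = (fun x => powR (f x) (-1))).
  exact: (measurableT_comp (measurable_powR (-1)) mf).
by apply/funext => x; rewrite powR_inv1.
Qed.

Lemma measurable_conv_rate b : 0 <= b -> measurable_fun [set: R] (conv_rate b).
Proof.
move=> b0; apply: measurable_funM.
  by apply: measurable_funM => //; exact: measurable_heat_rate.
apply: measurable_fun_inv; first by move=> s; rewrite ltW ?heat_rateD_gt0.
by apply: measurable_funD => //; exact: measurable_heat_rate.
Qed.

Lemma measurable_conv_weight nu n b : 0 <= b ->
  measurable_fun [set: R] (conv_weight nu n b).
Proof.
move=> b0; apply: measurable_funM; first exact: measurable_mix_weight.
apply: measurable_funX; apply: measurableT_comp.
  by apply: continuous_measurable_fun; exact: sqrt_continuous.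
apply: measurable_funM => //.
apply: measurable_fun_inv; first by move=> s; rewrite ltW ?heat_rateD_gt0.
by apply: measurable_funD => //; exact: measurable_heat_rate.
Qed.

Lemma continuous_enorm n : continuous (@enorm R n).
Proof.
move=> x; apply: continuous_comp; last exact: sqrt_continuous.
apply: (@cvg_big R); [exact: add_continuous|exact: nbhs_filter|move=> i _].
apply: (@continuous_comp _ _ _ _ (fun y : R => y ^+ 2)).
  exact: coord_continuous.
exact: exprn_continuous.
Qed.

Lemma measurable_enorm n :
  measurable_fun [set: borel (rV n)] (@enorm R n : borel (rV n) -> R).
Proof. by apply: measurable_borel_continuous; exact: continuous_enorm. Qed.

Lemma measurable_mixture nu :
  measurable_fun [set: R * R] (fun z : R * R =>
    mix_weight nu z.2 * expR (- (heat_rate z.2 * z.1 ^+ 2))).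
Proof.
apply: measurable_funM.
  exact: (measurableT_comp (measurable_mix_weight nu) measurable_snd).
apply: (measurableT_comp (@measurable_expR R)).
apply: measurable_funN; apply: measurable_funM.
  exact: (measurableT_comp measurable_heat_rate measurable_snd).
by apply: measurable_funX; exact: measurable_fst.
Qed.

Definition mixture nu rho : \bar R :=
  (\int[leb]_s (mix_weight nu s * expR (- (heat_rate s * rho ^+ 2)))%:E)%E.

Lemma mixture_ge0 nu rho : (0 <= mixture nu rho)%E.
Proof.
by apply: integral_ge0 => s _; rewrite lee_fin mulr_ge0 ?expR_ge0 ?ltW ?mix_weight_gt0.
Qed.

Lemma measurable_mixture_int nu : measurable_fun [set: R] (mixture nu).
Proof.
have := @measurable_fun_fubini_tonelli_F _ _ _ _ _ leb
  (fun z : R * R => (mix_weight nu z.2 * expR (- (heat_rate z.2 * z.1 ^+ 2)))%:E).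
apply.
  by apply/measurable_EFinP; exact: measurable_mixture.
by move=> z; rewrite lee_fin mulr_ge0 ?expR_ge0 ?ltW ?mix_weight_gt0.
Qed.

(** Near the origin: the substitution s -> 2 ln rho - s leaves the weight
    exp (nu s - e^s / 2), which is integrable because nu > 0. *)
Lemma mixture_le nu : 0 < nu -> exists2 C, 0 < C &
  forall rho, 0 < rho -> (mixture nu rho <= (C * rho `^ (- (2 * nu)))%:E)%E.
Proof.
move=> nu0; have [C C0 hC] := double_expR_decay 0 nu0.
have := integral_expR_abs_lty nu0; set I := (\int[_]_x _)%E => Ify.
have I0 : (0 <= I)%E by apply: integral_ge0 => x _; rewrite lee_fin expR_ge0.
exists (C * (fine I + 1)) => [|rho rho0].
  by rewrite mulr_gt0// ltr_wpDl// fine_ge0.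
rewrite /mixture integralT_opp; last 2 first.
- apply/measurable_EFinP.
  exact: (measurable_fun_pair2 rho (measurable_mixture nu)).
- by move=> s; rewrite lee_fin mulr_ge0 ?expR_ge0 ?ltW ?mix_weight_gt0.
rewrite (@integralT_shift _ _ (- (2 * ln rho))); last 2 first.
- apply/measurable_EFinP.
  apply: (measurableT_comp (measurable_fun_pair2 rho (measurable_mixture nu))).
  exact: oppr_measurable.
- by move=> s; rewrite lee_fin mulr_ge0 ?expR_ge0 ?ltW ?mix_weight_gt0.
have powE : rho `^ (- (2 * nu)) = expR (- (2 * nu * ln rho)).
  by rewrite /powR gt_eqF// mulNr.
apply: (@le_trans _ _ (\int[leb]_s ((C * rho `^ (- (2 * nu)))%:E * (expR (- (nu * `|s|)))%:E))%E).
  apply: ge0_le_integral_lower => s _; last rewrite -EFinM lee_fin.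
    by rewrite lee_fin mulr_ge0 ?expR_ge0 ?ltW ?mix_weight_gt0.
  have := hC s; rewrite expr0 mulr1 => hs.
  rewrite [leRHS]mulrAC.
  apply: le_trans (ler_wpM2r (powR_ge0 rho (- (2 * nu))) hs).
  rewrite /mix_weight /heat_rate mulrAC -expRD powE -expRD.
  rewrite ler_pdivrMr//.
  apply: (@le_trans _ _ (expR (- (expR s / 2) + nu * s + - (2 * nu * ln rho)))).
    rewrite ler_expR.
    have -> : expR (- - (s + - (2 * ln rho))) / 2 * rho ^+ 2 = expR s / 2.
      rewrite mulrAC; congr (_ / 2).
      rewrite opprK -[rho in rho ^+ 2]lnK ?posrE// expRD -expRM_natl -mulrA -expRD.
      by rewrite (_ : _ + _ = 0) ?expR0 ?mulr1//; ring.
    have := expR_ge0 (- (s + - (2 * ln rho))); lra.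
  by rewrite ler_peMr ?expR_ge0//; lra.
rewrite ge0_integralZl//=; last 2 first.
- apply/measurable_EFinP; apply: (measurableT_comp (@measurable_expR R)).
  apply: measurable_funN; apply: measurable_funM => //.
- by rewrite lee_fin mulr_ge0 ?powR_ge0// ltW.
rewrite -/I -[I]fineK ?ge0_fin_numE// -EFinM lee_fin mulrAC ler_wpM2r ?powR_ge0//.
by rewrite ler_pM2l// lerDl.
Qed.

End kernel.

Section kernel_estimates.
Context {R : realType}.
Local Notation leb := (@lebesgue_measure R).
Local Notation rV n := 'rV[R]_n.
Implicit Types (nu s b r rho c : R).

Lemma mixture_lty nu rho : 0 < nu -> 0 < rho -> (mixture nu rho < +oo)%E.
Proof.
move=> nu0 rho0; have [C _ h] := mixture_le nu0.
by apply: le_lt_trans (h _ rho0) _; rewrite ltry.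
Qed.

Lemma measurable_expR_abs c : measurable_fun [set: R] (fun s => expR (- (c * `|s|))).
Proof.
apply: (measurableT_comp (@measurable_expR R)).
by apply: measurable_funN; apply: measurable_funM.
Qed.

(** Domination by a multiple of exp (- c |s|) is the form in which all the
    weights below are integrated. *)
Lemma integral_le_expR_abs c : 0 < c -> exists2 I, 0 < I &
  forall (f : R -> R) K, 0 <= K ->
    (forall s, 0 <= f s <= K * expR (- (c * `|s|))) ->
    (\int[leb]_s (f s)%:E <= (K * I)%:E)%E.
Proof.
move=> c0; have := integral_expR_abs_lty c0; set J := (\int[_]_x _)%E => Jy.
have J0 : (0 <= J)%E by apply: integral_ge0 => x _; rewrite lee_fin expR_ge0.
exists (fine J + 1) => [|f K K0 fK]; first by rewrite ltr_wpDl// fine_ge0.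
apply: (@le_trans _ _ (\int[leb]_s (K%:E * (expR (- (c * `|s|)))%:E))%E).
  apply: ge0_le_integral_lower => s _; rewrite -?EFinM lee_fin;
    by have /andP[] := fK s.
rewrite ge0_integralZl//=; last by apply/measurable_EFinP; exact: measurable_expR_abs.
rewrite -/J -[J]fineK ?ge0_fin_numE// -EFinM lee_fin.
by rewrite ler_wpM2l// lerDl.
Qed.

(** Away from the origin: trade the Gaussian factor for a negative power of
    rho, which costs the factor exp (k s / 2) and keeps the weight integrable
    as long as 2 nu < k. *)
Lemma mixture_le_far nu (k : nat) : 0 < nu -> 0 < k%:R / 2 - nu ->
  exists2 C, 0 < C &
  forall rho, 0 < rho -> (mixture nu rho <= (C * rho ^- k)%:E)%E.
Proof.
move=> nu0 knu; have [C C0 hC] := double_expR_decay 0 knu.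
have k0 : 0 < k%:R / 2 :> R by rewrite (lt_trans nu0)// -subr_gt0.
have [D D0 hD] := double_expR_decay 0 k0.
have {}hD s : expR (- (expR s / 2) + k%:R / 2 * s) <= D.
  have := hD s; rewrite expr0 mulr1 => /le_trans; apply.
  apply: ler_piMr; first exact: ltW.
  by rewrite -expR0 ler_expR oppr_le0 mulr_ge0// ltW.
have [I I0 hI] := integral_le_expR_abs knu.
exists (D * C * I) => [|rho rho0]; first by rewrite !mulr_gt0.
rewrite mulrAC; apply: hI => [|s].
  by rewrite !mulr_ge0 ?invr_ge0 ?exprn_ge0// ltW.
have w0 := mix_weight_gt0 nu s; rewrite mulr_ge0 ?expR_ge0 ?(ltW w0)//=.
have hrho : expR (- (heat_rate s * rho ^+ 2)) <= D * expR (k%:R / 2 * s) * rho ^- k.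
  have := hD (2 * ln rho - s).
  have -> : - (expR (2 * ln rho - s) / 2) = - (heat_rate s * rho ^+ 2).
    by rewrite /heat_rate expRD expRM_natl lnK ?posrE//; ring.
  have -> : k%:R / 2 * (2 * ln rho - s) = k%:R * ln rho - k%:R / 2 * s by field.
  rewrite expRD [X in _ * X]expRD expRM_natl lnK ?posrE//.
  rewrite -ler_pdivlMr ?mulr_gt0 ?exprn_gt0 ?expR_gt0//; move/le_trans; apply.
  by rewrite invfM expRN invrK mulrA mulrAC.
apply: (le_trans (ler_wpM2l (ltW w0) hrho)).
have := hC s; rewrite expr0 mulr1 => {}hC.
have -> : mix_weight nu s * (D * expR (k%:R / 2 * s) * rho ^- k) =
   D * rho ^- k * (expR (- (expR s / 2) + (k%:R / 2 - nu) * s) / 2).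
  have -> : expR (- (expR s / 2) + (k%:R / 2 - nu) * s) =
      expR (- (expR s / 2) - nu * s) * expR (k%:R / 2 * s).
    by rewrite -expRD; congr expR; ring.
  by rewrite /mix_weight; ring.
have -> : D * C * rho ^- k * expR (- ((k%:R / 2 - nu) * `|s|)) =
   D * rho ^- k * (C * expR (- ((k%:R / 2 - nu) * `|s|))) by ring.
apply: ler_wpM2l; first by rewrite mulr_ge0 ?invr_ge0 ?exprn_ge0// ltW.
rewrite ltW// (lt_le_trans _ hC)// ltr_pdivrMr// ltr_pMr ?expR_gt0//; lra.
Qed.

Lemma enorm_gt0 n (x : rV n) : x != 0 -> 0 < enorm x.
Proof.
move=> x0; rewrite lt_def enorm_ge0 andbT; apply: contra x0 => /eqP e0.
have := sqr_enorm x; rewrite e0 expr0n/= => /esym/eqP.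
rewrite psumr_eq0 => [/allP h|i _]; last exact: sqr_ge0.
apply/eqP/rowP => i; rewrite mxE.
by have := h i (mem_index_enum _); rewrite sqrf_eq0 => /eqP.
Qed.

(** Unfolding the hyperbolic cosines makes the integral defining K_nu half of an
    integral over the whole line of exp (- r cosh t - nu t); the shift
    t = s - ln r turns r cosh t into e^s / 2 + r^2 e^-s / 2, which is the exponent
    of the mixture. *)
Lemma bessel_kernelE n (alpha : R) (x : rV n) : alpha < n%:R -> x != 0 ->
  (bessel_kernel alpha x)%:E = mixture ((n%:R - alpha) / 2) (enorm x).
Proof.
move=> an /enorm_gt0; set nu := _ / 2; have nu0 : 0 < nu by rewrite divr_gt0 ?subr_gt0.
rewrite /bessel_kernel -[(alpha - _) / 2]opprK -mulNr opprB -/nu.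
move: (enorm x) => r r0.
have My := mixture_lty nu0 r0; have M0 := mixture_ge0 nu r.
pose h (t : R) : R := expR (- (r * cosh t)) * cosh (nu * t).
pose e (t : R) : R := expR (- (r * cosh t)) * expR (- (nu * t)).
have cmul (a : R) : continuous ( *%R a).
  by move=> t; apply: cvgM; [exact: cvg_cst|exact: cvg_id].
have ccosh : continuous (@cosh R).
  move=> t; apply: cvgM; last exact: cvg_cst.
  apply: (@cvgD _ R^o); first exact: continuous_expR.
  by apply: (@continuous_comp _ _ _ -%R expR); [exact: opp_continuous|exact: continuous_expR].
have cE : continuous (fun t : R => expR (- (r * cosh t))).
  move=> t; apply: (@continuous_comp _ _ _ (fun t : R => - (r * cosh t)) expR).
    apply: (@cvgN _ R^o).
    by apply: (@continuous_comp _ _ _ (@cosh R) ( *%R r)); [exact: ccosh|exact: cmul].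
  exact: continuous_expR.
have ch : continuous h.
  move=> t; apply: cvgM; first exact: cE.
  by apply: (@continuous_comp _ _ _ ( *%R nu) cosh); [exact: cmul|exact: ccosh].
have me : measurable_fun [set: R] (EFin \o e).
  apply/measurable_EFinP/measurable_funM; first exact: continuous_measurable_fun.
  apply: (measurableT_comp (@measurable_expR R)).
  by apply: measurable_funN; exact: measurable_funM.
have e0 t : (0 <= (e t)%:E)%E by rewrite lee_fin mulr_ge0 ?expR_ge0.
have coshN (t : R) : cosh (- t) = cosh t by rewrite /cosh opprK addrC.
have he t : h t = 2^-1 * (e t + e (- t)).
  by rewrite /h /e coshN {2}/cosh mulrN opprK; ring.
have inte : (\int[leb]_t (e t)%:E = (2 * r `^ nu)%:E * mixture nu r)%E.
  rewrite (@integralT_shift _ (EFin \o e) (- ln r))//=.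
  rewrite /mixture -ge0_integralZl//=; last 3 first.
  - apply/measurable_EFinP.
    exact: (measurable_fun_pair2 r (measurable_mixture nu)).
  - by move=> s _; rewrite lee_fin mulr_ge0 ?expR_ge0// ltW ?mix_weight_gt0.
  - by rewrite lee_fin mulr_ge0// powR_ge0.
  apply: eq_integral => s _; rewrite -EFinM; congr EFin.
  rewrite /e /mix_weight /powR gt_eqF// /cosh.
  have -> : r * ((expR (s - ln r) + expR (- (s - ln r))) / 2) =
      expR s / 2 + heat_rate s * r ^+ 2.
    rewrite opprB !expRB lnK ?posrE// /heat_rate expRN.
    by field; rewrite !gt_eqF ?expR_gt0.
  rewrite [RHS](_ : _ = expR (nu * ln r) * (expR (- (expR s / 2) - nu * s) *
     expR (- (heat_rate s * r ^+ 2)))); last by field.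
  by rewrite -!expRD; congr expR; ring.
have inth : (\int[leb]_t (h t)%:E = (2 * r `^ nu)%:E * mixture nu r)%E.
  under eq_integral do rewrite he EFinM EFinD.
  rewrite ge0_integralZl//=; last 2 first.
  - apply: emeasurable_funD => //.
    exact: (measurableT_comp me (@oppr_measurable R setT)).
  - by move=> t _; rewrite adde_ge0.
  rewrite ge0_integralD//=; last first.
    exact: (measurableT_comp me (@oppr_measurable R setT)).
  rewrite -(@integralT_opp _ (EFin \o e))//= inte.
  move: My M0; case: (mixture nu r) => // m _ _.
  rewrite -[LHS]/(2^-1 * (2 * r `^ nu * m + 2 * r `^ nu * m))%:E -EFinM.
  by congr EFin; field.
have h0 t : 0 <= h t.
  by rewrite mulr_ge0 ?expR_ge0// /cosh divr_ge0// addr_ge0// expR_ge0.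
have := @ge0_symfun_integralT R h h0 ch.
rewrite inth -set_itvcy => hs.
have hK : (\int[leb]_(t in `[0%R, +oo[) (h t)%:E = (r `^ nu)%:E * mixture nu r)%E.
  have {hs} : ((2 * r `^ nu)%:E * mixture nu r
      = 2%:E * \int[leb]_(t in `[0%R, +oo[) (h t)%:E)%E.
    by apply: hs => t /=; rewrite /h coshN mulrN /cosh opprK [expR (- _) + _]addrC.
  move: My M0; case: (mixture nu r) => // m _ _.
  have : (0 <= \int[leb]_(t in `[0%R, +oo[) (h t)%:E)%E.
    by apply: integral_ge0 => t _; rewrite lee_fin.
  case: (\int[_]_(_ in _) _)%E => // [k _|_].
    by rewrite -!EFinM => -[/eqP]; rewrite -mulrA (inj_eq (mulfI _))// => /eqP->.
  by rewrite gt0_muley.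
rewrite /bessel_K /Rintegral hK.
move: My M0; case: (mixture nu r) => // m _ _ /=.
by rewrite powRN mulKf// gt_eqF// powR_gt0.
Qed.
End kernel_estimates.

Section convolution.
Context {R : realType}.
Local Notation leb := (@lebesgue_measure R).
Local Notation rV n := 'rV[R]_n.
Implicit Types (nu s b r rho c : R).

Lemma enorm0 n : enorm (0 : rV n) = 0.
Proof.
rewrite /enorm big1 ?sqrtr0// => i _; first by rewrite mxE expr0n.
Qed.

Lemma enorm_eq0 n (x : rV n) : (enorm x == 0) = (x == 0).
Proof.
apply/idP/idP => [|/eqP->]; last by rewrite enorm0.
by apply: contraLR => /enorm_gt0 /lt0r_neq0.
Qed.

Lemma bessel_kernel0 n (alpha : R) : alpha < n%:R ->
  bessel_kernel alpha (0 : rV n) = 0.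
Proof.
move=> an; rewrite /bessel_kernel enorm0 powR0 ?mul0r//.
by rewrite mulf_neq0// lt_eqF// subr_lt0.
Qed.

Lemma bessel_kernel_fine n (alpha : R) (x : rV n) : alpha < n%:R ->
  bessel_kernel alpha x = if enorm x == 0 then 0
    else fine (mixture ((n%:R - alpha) / 2) (enorm x)).
Proof.
move=> an; rewrite enorm_eq0; case: eqVneq => [->|x0]; first exact: bessel_kernel0.
by rewrite -bessel_kernelE.
Qed.

Lemma bessel_kernel_ge0 n (alpha : R) (x : rV n) : alpha < n%:R ->
  0 <= bessel_kernel alpha x.
Proof.
move=> an; rewrite bessel_kernel_fine//; case: ifP => // _.
exact/fine_ge0/mixture_ge0.
Qed.

Lemma measurable_bessel_kernel n (alpha : R) : alpha < n%:R ->
  measurable_fun [set: borel (rV n)] (bessel_kernel alpha : borel (rV n) -> R).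
Proof.
move=> an; rewrite (_ : bessel_kernel alpha =
  (fun r => if r == 0 then 0 else fine (mixture ((n%:R - alpha) / 2) r)) \o @enorm R n);
  last by apply/funext => x /=; rewrite bessel_kernel_fine.
apply: measurableT_comp; last exact: measurable_enorm.
apply: measurable_fun_ifT => //; first exact: measurable_fun_eqr.
exact: (measurableT_comp (fine_measurable measurableT) (measurable_mixture_int _)).
Qed.

Lemma measurable_enorm_sub d (T : measurableType d) n (f g : T -> borel (rV n)) :
  measurable_fun [set: T] f -> measurable_fun [set: T] g ->
  measurable_fun [set: T] (fun t => enorm ((f t : rV n) - g t)).
Proof.
move=> mf mg.
exact: (measurableT_comp (@measurable_enorm R n) (measurable_rV_sub mf mg)).
Qed.

Lemma measurable_rV_set1 n (x : rV n) : measurable ([set x] : set (borel (rV n))).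
Proof.
have mf : measurable_fun [set: borel (rV n)] (fun y => enorm ((y : rV n) - x)).
  by apply: (@measurable_enorm_sub _ _ _ id (cst x)).
rewrite (_ : [set x] = setT `&` (fun y : rV n => enorm (y - x)) @^-1` [set 0]).
  exact: mf.
apply/seteqP; split => [_ ->|y [_ /eqP]] /=; first by rewrite subrr enorm0.
by rewrite enorm_eq0 subr_eq0 => /eqP.
Qed.

(** Convolution with a Gaussian, under the mixture: each Gaussian of the
    mixture stays Gaussian, with the harmonic sum of the rates. *)
Lemma bessel_kernel_gauss n (alpha b : R) (x z : rV n) :
  (0 < n)%N -> alpha < n%:R -> 0 <= b ->
  (\int[lebesgue_rV R n]_y
     (bessel_kernel alpha (x - (y : rV n)) * expR (- (b * enorm ((y : rV n) - z) ^+ 2)))%:E =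
   \int[leb]_s (conv_weight ((n%:R - alpha) / 2) n b s *
     expR (- (conv_rate b s * enorm (x - z) ^+ 2)))%:E)%E.
Proof.
move=> n0 an b0; set nu := _ / 2.
pose F (q : borel (rV n) * R) : \bar R :=
  (mix_weight nu q.2 * expR (- (heat_rate q.2 * enorm (x - (q.1 : rV n)) ^+ 2 +
     b * enorm ((q.1 : rV n) - z) ^+ 2)))%:E.
have F0 q : (0 <= F q)%E.
  by rewrite lee_fin mulr_ge0 ?expR_ge0// ltW// mix_weight_gt0.
have mdx : measurable_fun [set: borel (rV n)] (fun y => enorm (x - (y : rV n))).
  by apply: (@measurable_enorm_sub _ _ _ (cst x) id).
have mdz : measurable_fun [set: borel (rV n)] (fun y => enorm ((y : rV n) - z)).
  by apply: (@measurable_enorm_sub _ _ _ id (cst z)).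
have mF : measurable_fun setT F.
  apply/measurable_EFinP/measurable_funM.
    exact: (measurableT_comp (measurable_mix_weight nu) measurable_snd).
  apply: (measurableT_comp (@measurable_expR R)); apply: measurable_funN.
  apply: measurable_funD; apply: measurable_funM => //.
  - exact: (measurableT_comp measurable_heat_rate measurable_snd).
  - by apply: measurable_funX; exact: (measurableT_comp mdx measurable_fst).
  - by apply: measurable_funX; exact: (measurableT_comp mdz measurable_fst).
have mixE (y : rV n) : x != y ->
  (bessel_kernel alpha (x - y) * expR (- (b * enorm (y - z) ^+ 2)))%:E =
  (\int[leb]_s F (y, s))%E.
  move=> xy; rewrite EFinM bessel_kernelE ?subr_eq0// muleC /mixture.
  rewrite -ge0_integralZl//=; last 2 first.
  - apply/measurable_EFinP.
    exact: (measurable_fun_pair2 (enorm (x - y)) (measurable_mixture nu)).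
  - by move=> s _; rewrite lee_fin mulr_ge0 ?expR_ge0// ltW// mix_weight_gt0.
  by apply: eq_integral => s _; rewrite -EFinM mulrCA -expRD /F/= opprD [in RHS]addrC.
transitivity (\int[lebesgue_rV R n]_y \int[leb]_s F (y, s))%E.
  apply: ge0_ae_eq_integral => //=.
  - apply/measurable_EFinP/measurable_funM.
      apply: (measurableT_comp (measurable_bessel_kernel an)).
      by apply: (@measurable_rV_sub _ _ _ _ (cst x) id).
    apply: (measurableT_comp (@measurable_expR R)); apply: measurable_funN.
    by apply: measurable_funM => //; exact: measurable_funX.
  - exact: measurable_fun_fubini_tonelli_F.
  - by move=> y _; rewrite lee_fin mulr_ge0 ?expR_ge0 ?bessel_kernel_ge0.
  - by move=> y _; exact: integral_ge0.
  - exists [set x : borel (rV n)]; split.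
    + exact: measurable_rV_set1.
    + exact: lebesgue_rV1.
    + by move=> y /=; apply: contra_notP => /eqP; rewrite eq_sym => /mixE.
rewrite fubini_tonelli//; apply: eq_integral => s _.
under eq_integral do rewrite /F/= EFinM.
rewrite ge0_integralZl//=; last 2 first.
- apply/measurable_EFinP; apply: (measurableT_comp (@measurable_expR R)).
  apply: measurable_funN; apply: measurable_funD; apply: measurable_funM => //.
  + by apply: measurable_funX.
  + by apply: measurable_funX.
- by rewrite lee_fin ltW// mix_weight_gt0.
by rewrite integral_gauss_conv_rV ?heat_rate_gt0// -EFinM mulrA.
Qed.
End convolution.

Section masses.
Context {R : realType}.
Local Notation leb := (@lebesgue_measure R).
Implicit Types (nu s b r rho c : R).

Lemma gauss_mass_le b s : 0 <= b ->
  Num.sqrt (pi / (heat_rate s + b)) <= Num.sqrt (2 * pi) * expR (s / 2).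
Proof.
move=> b0; have -> : expR (s / 2) = Num.sqrt (expR s).
  by rewrite [in RHS](splitr s) expRD -expr2 sqrtr_sqr ger0_norm ?expR_ge0.
rewrite -sqrtrM ?mulr_ge0 ?pi_ge0// ler_wsqrtr//.
rewrite ler_pdivrMr ?heat_rateD_gt0// (@le_trans _ _ (2 * pi * expR s * heat_rate s))//.
  rewrite /heat_rate expRN (_ : _ * _ = pi)//.
  by field; rewrite gt_eqF ?expR_gt0.
by rewrite ler_wpM2l ?lerDl// !mulr_ge0 ?expR_ge0 ?pi_ge0.
Qed.

Lemma gauss_mass_le_scale r s : 0 < r ->
  Num.sqrt (pi / (heat_rate s + r ^- 2)) <= Num.sqrt (2 * pi) * r.
Proof.
move=> r0; have pi0 := pi_ge0 R.
have -> : Num.sqrt (2 * pi) * r = Num.sqrt (2 * pi * r ^+ 2).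
  by rewrite [RHS]sqrtrM ?mulr_ge0// sqrtr_sqr ger0_norm ?ltW.
rewrite ler_wsqrtr//.
have r2 : 0 <= r ^- 2 by rewrite invr_ge0 exprn_ge0// ltW.
rewrite ler_pdivrMr ?heat_rateD_gt0// mulrDr.
rewrite -[X in _ + X]mulrA divff ?expf_neq0 ?gt_eqF//.
have : 0 <= 2 * pi * r ^+ 2 * heat_rate s.
  by rewrite !mulr_ge0 ?exprn_ge0 ?(ltW r0) ?(ltW (heat_rate_gt0 s)).
lra.
Qed.

Lemma expR_half_exprn (n : nat) s : expR (s / 2) ^+ n = expR (n%:R / 2 * s).
Proof. by rewrite -expRM_natl; congr expR; field. Qed.

(** The bound uniform in the width is the one relevant for wide Gaussians, whose
    convolution with the integrable Bessel kernel stays bounded. *)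
Lemma conv_mass_le1 (n : nat) nu : 0 < nu -> 0 < n%:R / 2 - nu ->
  exists2 C, 0 < C & forall b, 0 <= b ->
    (\int[leb]_s (conv_weight nu n b s)%:E <= C%:E)%E.
Proof.
move=> nu0 nnu; have [C C0 hC] := double_expR_decay 0 nnu.
have [I I0 hI] := integral_le_expR_abs nnu.
have q0 : 0 < Num.sqrt (2 * pi) :> R by rewrite sqrtr_gt0 mulr_gt0 ?pi_gt0.
exists (C * Num.sqrt (2 * pi) ^+ n * I) => [|b b0].
  by rewrite !mulr_gt0 ?exprn_gt0.
apply: hI => [|s]; first by rewrite mulr_ge0 ?exprn_ge0// ltW.
rewrite conv_weight_ge0//=.
apply: (@le_trans _ _ (mix_weight nu s * (Num.sqrt (2 * pi) * expR (s / 2)) ^+ n)).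
  rewrite ler_wpM2l ?(ltW (mix_weight_gt0 nu s))//.
  by rewrite lerXn2r ?nnegrE ?sqrtr_ge0 ?mulr_ge0 ?expR_ge0 ?gauss_mass_le.
rewrite exprMn expR_half_exprn [leRHS]mulrAC mulrCA [leRHS]mulrC.
apply: ler_wpM2l; first by rewrite exprn_ge0// ltW.
apply: le_trans (hC s); rewrite expr0 mulr1 /mix_weight mulrAC -expRD.
rewrite ler_pdivrMr// (_ : - _ - _ + _ = - (expR s / 2) + (n%:R / 2 - nu) * s); last by ring.
by rewrite ler_peMr ?expR_ge0//; lra.
Qed.

(** Scaling: with s shifted by 2 ln r, the rate r^-2 is normalised to 1. *)
Lemma conv_mass_le_scale (n : nat) nu : 0 < nu -> 0 < n%:R / 2 - nu ->
  exists2 C, 0 < C & forall r, 0 < r ->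
    (\int[leb]_s (conv_weight nu n (r ^- 2) s)%:E <= (C * r `^ (n%:R - 2 * nu))%:E)%E.
Proof.
move=> nu0 nnu; pose c := Num.min nu (n%:R / 2 - nu).
have c0 : 0 < c by rewrite lt_min nu0.
have [I I0 hI] := integral_le_expR_abs c0.
have q0 : 0 < Num.sqrt (2 * pi) :> R by rewrite sqrtr_gt0 mulr_gt0 ?pi_gt0.
exists (Num.sqrt (2 * pi) ^+ n * I) => [|r r0]; first by rewrite mulr_gt0 ?exprn_gt0.
have r2 : 0 <= r ^- 2 by rewrite invr_ge0 exprn_ge0// ltW.
rewrite (@integralT_shift _ _ (2 * ln r)); last 2 first.
- by apply/measurable_EFinP; exact: measurable_conv_weight.
- by move=> s; rewrite lee_fin conv_weight_ge0.
rewrite mulrAC; apply: hI => [|s]; first by rewrite mulr_ge0 ?powR_ge0 ?exprn_ge0// ltW.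
rewrite conv_weight_ge0//=.
have wle : mix_weight nu (s + 2 * ln r) <= expR (- nu * s - 2 * nu * ln r).
  rewrite /mix_weight ler_pdivrMr// (@le_trans _ _ (expR (- nu * s - 2 * nu * ln r)))//.
    rewrite ler_expR; have := expR_ge0 (s + 2 * ln r).
    by rewrite mulrDr; lra.
  by rewrite ler_peMr ?expR_ge0//; lra.
have -> : r `^ (n%:R - 2 * nu) = expR (- (2 * nu * ln r)) * r ^+ n.
  rewrite /powR gt_eqF// -[in r ^+ n](lnK (x := r)) ?posrE// -expRM_natl -expRD.
  by congr expR; ring.
pose g := Num.min (expR (s / 2)) 1.
have g0 : 0 <= g by rewrite le_min expR_ge0 ler01.
have gle : Num.sqrt (pi / (heat_rate (s + 2 * ln r) + r ^- 2)) <= Num.sqrt (2 * pi) * (r * g).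
  rewrite /g minr_pMr ?(ltW r0)// mulr1 minr_pMr ?(ltW q0)// le_min.
  rewrite gauss_mass_le_scale// andbT (le_trans (gauss_mass_le _ r2))//.
  rewrite ler_wpM2l ?(ltW q0)// -[in leRHS](lnK (x := r)) ?posrE// -expRD ler_expR.
  by lra.
apply: (@le_trans _ _ (expR (- nu * s - 2 * nu * ln r) * (Num.sqrt (2 * pi) * (r * g)) ^+ n)).
  apply: ler_pM => //; first exact: ltW (mix_weight_gt0 _ _).
  by rewrite lerXn2r ?nnegrE ?sqrtr_ge0 ?mulr_ge0// ltW.
rewrite !exprMn expRD mulNr.
have -> : expR (- (nu * s)) * expR (- (2 * nu * ln r)) * (Num.sqrt (2 * pi) ^+ n * (r ^+ n * g ^+ n)) = Num.sqrt (2 * pi) ^+ n * (expR (- (2 * nu * ln r)) * r ^+ n) *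
   (expR (- (nu * s)) * g ^+ n) by ring.
apply: ler_wpM2l; first by rewrite !mulr_ge0 ?exprn_ge0 ?expR_ge0 ?(ltW q0) ?(ltW r0).
have [s0|s0] := leP 0 s.
  rewrite ger0_norm// (@le_trans _ _ (expR (- (nu * s))))//.
    by rewrite ler_piMr ?expR_ge0// exprn_ile1// ge_min lexx orbT.
  by rewrite ler_expR lerN2 ler_wpM2r// ge_min lexx.
rewrite ltr0_norm// mulrN opprK.
apply: (@le_trans _ _ (expR (- (nu * s)) * expR (s / 2) ^+ n)).
  rewrite ler_wpM2l ?expR_ge0// lerXn2r ?nnegrE ?expR_ge0//.
  by rewrite ge_min lexx.
rewrite expR_half_exprn -expRD ler_expR -mulNr -mulrDl addrC.
by rewrite ler_wnM2r ?(ltW s0)// ge_min lexx orbT.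
Qed.

(** The rate is at most r^-2, so the exponential is harmless for rho <= r; the
    weights of the unit interval of [s] starting at 2 ln (min r 1) suffice. *)
Lemma conv_mass_ge (n : nat) nu : 0 < nu ->
  exists2 c, 0 < c & forall r rho, 0 < r -> 0 <= rho <= r ->
    ((c * Num.min r 1 `^ (n%:R - 2 * nu))%:E <=
     \int[leb]_s (conv_weight nu n (r ^- 2) s *
        expR (- (conv_rate (r ^- 2) s * rho ^+ 2)))%:E)%E.
Proof.
move=> nu0; pose c0 : R := expR (- (expR 1 / 2) - nu) / 2 * Num.sqrt (pi / 2) ^+ n * expR (- 1).
exists c0 => [|r rho r0 /andP[rho0 rhor]].
  by rewrite !mulr_gt0 ?exprn_gt0 ?sqrtr_gt0 ?divr_gt0 ?expR_gt0 ?pi_gt0.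
pose m := Num.min r 1; have m0 : 0 < m by rewrite lt_min r0 ltr01.
have mr : m <= r by rewrite ge_min lexx.
have m1 : m <= 1 by rewrite ge_min lexx orbT.
have r2 : 0 <= r ^- 2 by rewrite invr_ge0 exprn_ge0// ltW.
pose K := c0 * m `^ (n%:R - 2 * nu).
pose I : set R := `[2 * ln m, 2 * ln m + 1]%classic.
have mI : measurable I by exact: measurable_itv.
have K0 : 0 <= K.
  by rewrite !mulr_ge0 ?powR_ge0 ?exprn_ge0 ?sqrtr_ge0 ?expR_ge0// invr_ge0.
apply: (@le_trans _ _ (\int[leb]_s (K%:E * (\1_I s)%:E))%E).
  rewrite ge0_integralZl//; last exact/measurable_EFinP/measurable_indic.
  rewrite integral_indic// setIT.
  rewrite [X in (_ * X)%E](lebesgue_measure_itv `[2 * ln m, 2 * ln m + 1])/= lte_fin.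
  by rewrite ltrDl ltr01 -EFinB addrAC subrr add0r mule1.
apply: ge0_le_integral_lower => s _; rewrite -EFinM lee_fin; first by rewrite mulr_ge0.
rewrite indicE; case: (boolP (s \in I)) => [|_]; last first.
  by rewrite mulr0 mulr_ge0 ?expR_ge0 ?conv_weight_ge0.
rewrite inE /I/= in_itv/= mulr1 => /andP[s1 s2].
have em : expR (2 * ln m) = m ^+ 2 by rewrite expRM_natl lnK.
have es : m ^+ 2 <= expR s by rewrite -em ler_expR.
have w1 : expR (- (expR 1 / 2) - nu) / 2 * expR (- (2 * nu * ln m)) <= mix_weight nu s.
  rewrite /mix_weight mulrAC ler_wpM2r// -expRD ler_expR.
  have : expR s <= expR 1.
    rewrite ler_expR (le_trans s2)//; have := ln_le0 m1; lra.
  have : nu * s <= nu * (2 * ln m + 1) by rewrite ler_pM2l.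
  lra.
have g1 : Num.sqrt (pi / 2) * m <= Num.sqrt (pi / (heat_rate s + r ^- 2)).
  rewrite -[X in _ * X]ger0_norm ?(ltW m0)// -sqrtr_sqr -sqrtrM ?divr_ge0 ?pi_ge0//.
  rewrite ler_wsqrtr// ler_pdivlMr ?heat_rateD_gt0// -!mulrA ler_piMr ?pi_ge0//.
  rewrite mulrC ler_pdivrMr// mul1r mulrDr.
  have h1 : m ^+ 2 * heat_rate s <= 1.
    rewrite /heat_rate expRN.
    rewrite mulrA ler_pdivrMr// ler_pdivrMr ?expR_gt0//; have := expR_ge0 s; lra.
  have h2 : m ^+ 2 * r ^- 2 <= 1.
    rewrite ler_pdivrMr ?exprn_gt0// mul1r lerXn2r// nnegrE ltW//.
  lra.
have l1 : expR (- 1) <= expR (- (conv_rate (r ^- 2) s * rho ^+ 2)).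
  rewrite ler_expR lerN2 (@le_trans _ _ (r ^- 2 * r ^+ 2))//.
    rewrite ler_pM ?conv_rate_ge0 ?conv_rate_le ?exprn_ge0//.
    by rewrite lerXn2r// nnegrE ltW.
  by rewrite mulVf// expf_neq0 ?gt_eqF.
have -> : K = expR (- (expR 1 / 2) - nu) / 2 * expR (- (2 * nu * ln m)) *
    (Num.sqrt (pi / 2) * m) ^+ n * expR (- 1).
  rewrite /K /c0 exprMn /powR gt_eqF//.
  have -> : m ^+ n = expR (n%:R * ln m) by rewrite expRM_natl lnK.
  have -> : expR ((n%:R - 2 * nu) * ln m) = expR (- (2 * nu * ln m)) * expR (n%:R * ln m).
    by rewrite -expRD; congr expR; ring.
  ring.
have w0 : 0 <= expR (- (expR 1 / 2) - nu) / 2 * expR (- (2 * nu * ln m)).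
  by rewrite mulr_ge0 ?divr_ge0 ?expR_ge0.
have q0 : 0 <= Num.sqrt (pi / 2) * m by rewrite mulr_ge0 ?sqrtr_ge0 ?ltW.
apply: ler_pM l1; [by rewrite mulr_ge0 ?exprn_ge0|exact: expR_ge0|].
apply: ler_pM w1 _; rewrite ?exprn_ge0//.
by rewrite lerXn2r ?nnegrE ?sqrtr_ge0.
Qed.

End masses.

(** * Averages of the kernel over cubes *)

Section cubes.
Context {R : realType}.
Local Notation leb := (@lebesgue_measure R).
Local Notation rV n := 'rV[R]_n.
Implicit Types (nu s b r rho c t : R).

Definition cube n (x : rV n) r : set (rV n) :=
  [set y | forall i, x 0 i - r <= y 0 i <= x 0 i + r].

(** The size, up to constants, of the Bessel kernel averaged at scale [r]. *)
Definition kernel_scale n (alpha : R) r : R := Num.min r 1 `^ alpha / r ^+ n.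

Lemma enormN n (x : rV n) : enorm (- x) = enorm x.
Proof. by rewrite /enorm; congr Num.sqrt; apply: eq_bigr => i _; rewrite mxE sqrrN. Qed.

Lemma enorm_sub_sym n (x y : rV n) : enorm (x - y) = enorm (y - x).
Proof. by rewrite -enormN opprB. Qed.

Lemma bessel_kernel_sym n (alpha : R) (x y : rV n) :
  bessel_kernel alpha (x - y) = bessel_kernel alpha (y - x).
Proof. by rewrite /bessel_kernel enorm_sub_sym. Qed.

(* Cauchy-Schwarz by expanding a sum of squares. *)
Lemma enorm_triangle n (x y : rV n) : enorm (x + y) <= enorm x + enorm y.
Proof.
have CS : \sum_i x 0 i * y 0 i <= enorm x * enorm y.
  have [x0|x0] := eqVneq x 0.
    by rewrite x0 enorm0 mul0r big1// => i _; rewrite mxE mul0r.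
  have [y0|y0] := eqVneq y 0.
    by rewrite y0 enorm0 mulr0 big1// => i _; rewrite mxE mulr0.
  have px := enorm_gt0 x0; have py := enorm_gt0 y0.
  have : 0 <= \sum_i (enorm y * x 0 i - enorm x * y 0 i) ^+ 2.
    by apply: sumr_ge0 => i _; exact: sqr_ge0.
  rewrite (_ : \sum_i _ = 2 * (enorm x * enorm y) *
      (enorm x * enorm y - \sum_i x 0 i * y 0 i)).
    by rewrite pmulr_rge0 ?subr_ge0// !mulr_gt0.
  rewrite mulrBr.
  rewrite (_ : 2 * (enorm x * enorm y) * (enorm x * enorm y) =
    enorm y ^+ 2 * (enorm x ^+ 2) + enorm x ^+ 2 * (enorm y ^+ 2)); last by ring.
  rewrite {1}(sqr_enorm x) {2}(sqr_enorm y) !mulr_sumr -big_split -sumrB/=.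
  by apply: eq_bigr => i _; ring.
rewrite -(@ler_pXn2r _ 2)// ?nnegrE ?addr_ge0 ?enorm_ge0//.
rewrite sqrrD !sqr_enorm.
rewrite (_ : \sum_i (x + y) 0 i ^+ 2 = \sum_i x 0 i ^+ 2 +
  (\sum_i x 0 i * y 0 i) *+ 2 + \sum_i y 0 i ^+ 2).
  by rewrite lerD2r lerD2l lerMn2r CS orbT.
rewrite -sumrMnl -!big_split/=; apply: eq_bigr => i _.
by rewrite mxE sqrrD.
Qed.

Lemma enorm_dist_triangle n (x y z : rV n) :
  enorm (x - z) <= enorm (x - y) + enorm (y - z).
Proof. by rewrite -[x - z](subrKA y) enorm_triangle. Qed.

Lemma cube_enorm n (x y : rV n) r : 0 <= r -> cube x r y ->
  enorm (y - x) <= n%:R * r.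
Proof.
move=> r0 xy; rewrite -(@ler_pXn2r _ 2)// ?nnegrE ?enorm_ge0 ?mulr_ge0//.
rewrite sqr_enorm (@le_trans _ _ (\sum_(i < n) r ^+ 2))//.
  apply: ler_sum => i _; rewrite !mxE -real_normK ?num_real//.
  rewrite lerXn2r ?nnegrE// ler_norml.
  by have /andP[] := xy i; lra.
rewrite sumr_const card_ord -[leLHS]mulr_natl exprMn ler_wpM2r ?sqr_ge0//.
by rewrite -natrX ler_nat; case: (n) => // k; rewrite -[leqLHS]expn1 leq_pexp2l.
Qed.

Lemma measurable_cube n (x : rV n) r : measurable (cube x r : set (borel (rV n))).
Proof.
rewrite (_ : cube x r = \big[setI/setT]_(i < n)
    ((fun y : borel (rV n) => (y : rV n) 0 i) @^-1` `[x 0 i - r, x 0 i + r])).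
  apply: bigsetI_measurable => i _; rewrite -[X in measurable X]setTI.
  exact: measurable_rV_coord.
rewrite -bigcap_seq; apply/seteqP; split => [y bx i _|y bx i] /=.
  by rewrite in_itv/=; exact: bx.
by have /= := bx i; rewrite mem_index_enum in_itv/=; exact.
Qed.

Lemma lebesgue_cube n (x : rV n) r : 0 <= r ->
  lebesgue_rV R n (cube x r : set (borel (rV n))) = ((2 * r) ^+ n)%:E.
Proof.
move=> r0; pose a : rV n := \row_i (x 0 i - r); pose b : rV n := \row_i (x 0 i + r).
have := @lebesgue_rV_box R n a b.
rewrite (_ : [set y : rV n | _] = cube x r); last first.
  by apply/seteqP; split => y /= h i; have := h i; rewrite !mxE.
move=> -> => [|i]; last by rewrite !mxE; lra.
congr EFin; rewrite (eq_bigr (fun _ => 2 * r)) => [|i _]; last by rewrite !mxE; ring.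
by rewrite prodr_const card_ord.
Qed.

Lemma kernel_scale_ge0 n alpha r : 0 <= r -> 0 <= kernel_scale n alpha r.
Proof. by move=> r0; rewrite mulr_ge0 ?powR_ge0// invr_ge0 exprn_ge0. Qed.

(** Decreasing in [r] when alpha <= n, and never faster than r^-n. *)
Lemma kernel_scale_le n alpha r s c : 0 <= alpha -> 1 <= c -> 0 < r ->
  r <= c * s -> alpha <= n%:R -> 0 < s ->
  kernel_scale n alpha s <= c ^+ n * kernel_scale n alpha r.
Proof.
move=> a0 c1 r0 rs an s0.
have c0 : 0 < c by rewrite (lt_le_trans ltr01).
have cs0 : 0 < c * s by rewrite mulr_gt0.
apply: (@le_trans _ _ (c ^+ n * kernel_scale n alpha (c * s))).
  have -> : c ^+ n * kernel_scale n alpha (c * s) = Num.min (c * s) 1 `^ alpha / s ^+ n.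
    by rewrite /kernel_scale exprMn; field; rewrite !expf_neq0 ?gt_eqF.
  rewrite ler_wpM2r ?invr_ge0 ?exprn_ge0 ?(ltW s0)//.
  rewrite ge0_ler_powR ?nnegrE ?le_min ?(ltW s0) ?(ltW cs0)//= ?ler01//.
  by rewrite !ge_min lexx orbT andbT ler_peMl ?(ltW s0).
rewrite ler_pM2l ?exprn_gt0//.
have decr u v : 0 < u -> u <= v -> v <= 1 -> kernel_scale n alpha v <= kernel_scale n alpha u.
  move=> u0 uv v1; have v0 := lt_le_trans u0 uv.
  rewrite /kernel_scale !(min_l _)// ?(le_trans uv)//.
  have E w : 0 < w -> w `^ alpha / w ^+ n = w `^ (alpha - n%:R).
    move=> w0; rewrite -powR_mulrn ?(ltW w0)// powRB//.
    by rewrite (gt_eqF w0) implybT.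
  rewrite !E// -[alpha - n%:R]opprB !powRN lef_pV2 ?posrE ?powR_gt0//.
  by rewrite ge0_ler_powR ?nnegrE ?subr_ge0// ltW.
have decr1 u v : 1 <= u -> u <= v -> kernel_scale n alpha v <= kernel_scale n alpha u.
  move=> u1 uv; have v1 := le_trans u1 uv.
  rewrite /kernel_scale !(min_r _)// powR1 !div1r lef_pV2 ?posrE ?exprn_gt0//;
    rewrite ?(lt_le_trans ltr01)//.
  by rewrite lerXn2r// nnegrE (le_trans ler01).
have [cs1|cs1] := leP (c * s) 1; first exact: decr.
have [r1|r1] := leP r 1; last by apply: decr1 => //; exact: ltW.
apply: (@le_trans _ _ (kernel_scale n alpha 1)); first by apply: decr1 => //; exact: ltW.
exact: decr.
Qed.

End cubes.

Section averages.
Context {R : realType}.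
Local Notation leb := (@lebesgue_measure R).
Local Notation rV n := 'rV[R]_n.
Local Notation lebn n := (lebesgue_rV R n).
Implicit Types (nu s b r rho c t : R).
Variables (n : nat) (alpha : R).
Hypotheses (n0 : (0 < n)%N) (a0 : 0 < alpha) (an : alpha < n%:R).

Let nu := (n%:R - alpha) / 2.

Let nu0 : 0 < nu. Proof. by rewrite divr_gt0 ?subr_gt0. Qed.

Let n2nu : 0 < n%:R / 2 - nu.
Proof. by rewrite -mulrBl opprB addrCA subrr addr0 divr_gt0. Qed.

Let n2nuE : n%:R - 2 * nu = alpha. Proof. by rewrite /nu; field. Qed.

(** Two regimes: the singularity |x|^(alpha - n) at the origin, and at infinity a
    decay of which only |x|^-n is used. *)
Lemma bessel_kernel_le : exists2 C, 0 < C &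
  forall x : rV n, bessel_kernel alpha x <= C * kernel_scale n alpha (enorm x).
Proof.
have [C C0 hC] := mixture_le nu0; have [D D0 hD] := mixture_le_far nu0 n2nu.
exists (C + D) => [|x]; first by rewrite addr_gt0.
have [->|x0] := eqVneq x 0.
  by rewrite bessel_kernel0// mulr_ge0 ?kernel_scale_ge0 ?enorm0// addr_ge0 ?ltW.
have r0 := enorm_gt0 x0; rewrite -lee_fin bessel_kernelE// -/nu.
have k0 := kernel_scale_ge0 n alpha (ltW r0).
have [r1|r1] := leP (enorm x) 1.
  apply: (le_trans (hC _ r0)); rewrite lee_fin [leRHS]mulrDl ler_wpDr ?(mulr_ge0 (ltW D0) k0)//.
  rewrite ler_wpM2l ?(ltW C0)// /kernel_scale (min_l r1) -powR_mulrn ?(ltW r0)//.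
  rewrite -powRB ?(gt_eqF r0) ?implybT// (_ : - (2 * nu) = alpha - n%:R)//.
  by rewrite -n2nuE; ring.
apply: (le_trans (hD _ r0)); rewrite lee_fin [leRHS]mulrDl ler_wpDl ?(mulr_ge0 (ltW C0) k0)//.
by rewrite ler_wpM2l ?(ltW D0)// /kernel_scale (min_r (ltW r1)) powR1 mul1r.
Qed.

(** By [bessel_kernel_gauss] this is the value at the centre of the potential of a
    Gaussian of width [r]. *)
Lemma conv_mass_le : exists2 C, 0 < C & forall r, 0 < r ->
  (\int[leb]_s (conv_weight nu n (r ^- 2) s)%:E <= (C * Num.min r 1 `^ alpha)%:E)%E.
Proof.
have [C C0 hC] := conv_mass_le1 nu0 n2nu; have [D D0 hD] := conv_mass_le_scale nu0 n2nu.
exists (C + D) => [|r r0]; first by rewrite addr_gt0.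
have r2 : 0 <= r ^- 2 by rewrite invr_ge0 exprn_ge0// ltW.
have [r1|r1] := leP r 1.
  apply: le_trans (hD _ r0) _; rewrite n2nuE lee_fin ler_wpM2r ?powR_ge0//.
  by rewrite lerDr ltW.
by apply: le_trans (hC _ r2) _; rewrite powR1 mulr1 lee_fin lerDl ltW.
Qed.

Lemma measurable_bessel_kernel_sub (y : rV n) :
  measurable_fun [set: borel (rV n)] (fun x => bessel_kernel alpha ((x : rV n) - y)).
Proof.
apply: (measurableT_comp (measurable_bessel_kernel an)).
by apply: (@measurable_rV_sub _ _ _ _ id (cst y)).
Qed.

(** If [y] is close to the cube, dominate its indicator by a Gaussian at the
    scale of the cube; otherwise the kernel is essentially constant on it. *)
Lemma bessel_kernel_cube : exists2 C, 0 < C & forall (x y : rV n) t, 0 < t ->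
  (\int[lebn n]_(z in (cube x (t / (2 * n%:R)) : set (borel (rV n))))
      (bessel_kernel alpha ((z : rV n) - y))%:E <=
   (C * t ^+ n * kernel_scale n alpha (Num.max (enorm (x - y)) t))%:E)%E.
Proof.
have [C C0 hC] := conv_mass_le; have [D D0 hD] := bessel_kernel_le.
exists (expR 1 * C * 2 `^ alpha + 2 ^+ n * D) => [|x y t t0].
  by rewrite addr_gt0 ?mulr_gt0 ?exprn_gt0 ?powR_gt0 ?expR_gt0.
have nR : 0 < n%:R :> R by rewrite ltr0n.
pose Q : set (borel (rV n)) := cube x (t / (2 * n%:R)).
have t20 : 0 <= t / (2 * n%:R) by rewrite divr_ge0 ?mulr_ge0 ?(ltW t0).
have QP z : Q z -> enorm ((z : rV n) - x) <= t / 2.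
  move=> /(cube_enorm t20)/le_trans; apply.
  by rewrite (_ : n%:R * _ = t / 2)//; field; rewrite gt_eqF.
have mQ : measurable Q by exact: measurable_cube.
have T0 : 0 < Num.max (enorm (x - y)) t by rewrite lt_max t0 orbT.
have k0 := kernel_scale_ge0 n alpha (ltW T0).
have tn0 : 0 <= t ^+ n by rewrite exprn_ge0 ?(ltW t0).
have [xyt|xyt] := leP (enorm (x - y)) t.
  have b0 : 0 <= (2 * t) ^- 2 by rewrite invr_ge0 exprn_ge0// mulr_ge0// ltW.
  apply: (@le_trans _ _ (\int[lebn n]_z ((expR 1)%:E * (bessel_kernel alpha (y - (z : rV n)) *
     expR (- ((2 * t) ^- 2 * enorm ((z : rV n) - y) ^+ 2)))%:E))%E).
    rewrite integral_mkcond; apply: ge0_le_integral_lower => z _.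
      by rewrite patchE; case: ifPn => // _; rewrite lee_fin bessel_kernel_ge0.
    rewrite patchE -EFinM; case: ifPn => [|_]; rewrite lee_fin; last first.
      by rewrite mulr_ge0 ?expR_ge0// mulr_ge0 ?expR_ge0 ?bessel_kernel_ge0.
    rewrite inE => /QP zx; rewrite bessel_kernel_sym mulrCA ler_peMr ?bessel_kernel_ge0//.
    rewrite -expRD -[leLHS]expR0 ler_expR subr_ge0.
    rewrite mulrC ler_pdivrMr ?exprn_gt0 ?mulr_gt0// mul1r.
    rewrite lerXn2r ?nnegrE ?enorm_ge0 ?mulr_ge0 ?(ltW t0)//.
    by have := enorm_dist_triangle z x y; lra.
  rewrite ge0_integralZl//=; last 2 first.
  - apply/measurable_EFinP/measurable_funM.
      apply: (measurableT_comp (measurable_bessel_kernel an)).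
      by apply: (@measurable_rV_sub _ _ _ _ (cst y) id).
    apply: (measurableT_comp (@measurable_expR R)); apply: measurable_funN.
    apply: measurable_funM => //; apply: measurable_funX.
    by apply: (@measurable_enorm_sub _ _ _ _ id (cst y)).
  - by move=> z _; rewrite lee_fin mulr_ge0 ?expR_ge0 ?bessel_kernel_ge0.
  rewrite bessel_kernel_gauss// subrr enorm0 -/nu.
  under eq_integral do rewrite expr0n/= mulr0 oppr0 expR0 mulr1.
  have t20' : 0 < 2 * t by rewrite mulr_gt0.
  apply: (@le_trans _ _ ((expR 1)%:E * (C * Num.min (2 * t) 1 `^ alpha)%:E)%E).
    by rewrite lee_wpmul2l ?lee_fin ?expR_ge0// hC.
  rewrite -EFinM lee_fin /kernel_scale.
  set m := Num.min t 1; have m0 : 0 <= m by rewrite le_min (ltW t0) ler01.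
  rewrite (_ : _ * t ^+ n * _ = (expR 1 * C * 2 `^ alpha + 2 ^+ n * D) * m `^ alpha);
    last by rewrite /m; field; rewrite expf_neq0 ?gt_eqF.
  apply: (@le_trans _ _ (expR 1 * C * 2 `^ alpha * m `^ alpha)).
    rewrite mulrA -[leRHS]mulrA ler_wpM2l ?mulr_ge0 ?expR_ge0 ?(ltW C0)//.
    have hm : Num.min (2 * t) 1 <= 2 * m.
      by rewrite /m minr_pMr// mulr1 le_min !ge_min lexx ler1n orbT.
    rewrite -powRM// ge0_ler_powR ?nnegrE ?(ltW a0) ?mulr_ge0//.
    by rewrite le_min (ltW t20') ler01.
  by rewrite ler_wpM2r ?powR_ge0// lerDl mulr_ge0 ?exprn_ge0 ?ltW.
have xy0 : 0 < enorm (x - y) by rewrite (lt_trans t0).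
apply: (@le_trans _ _ (\int[lebn n]_(z in Q) (D * 2 ^+ n * kernel_scale n alpha (enorm (x - y)))%:E)%E).
  apply: ge0_le_integral_lower => z Qz; rewrite lee_fin ?bessel_kernel_ge0//.
  apply: le_trans (hD _) _; rewrite -mulrA ler_wpM2l ?(ltW D0)//.
  have h := enorm_dist_triangle x z y; rewrite (enorm_sub_sym x z) in h.
  have := QP z Qz => h2.
  by apply: kernel_scale_le => //; try exact: ltW; rewrite ?ler1n//; lra.
rewrite integral_cst// [X in (_ * X)%E](lebesgue_cube x t20) -EFinM lee_fin.
have -> : 2 * (t / (2 * n%:R)) = t / n%:R by field; rewrite gt_eqF.
apply: (@le_trans _ _ (D * 2 ^+ n * kernel_scale n alpha (enorm (x - y)) * t ^+ n)).
  apply: ler_wpM2l.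
    by rewrite (mulr_ge0 _ (kernel_scale_ge0 _ _ (ltW xy0)))// mulr_ge0 ?exprn_ge0 ?ltW.
  rewrite lerXn2r ?nnegrE ?divr_ge0 ?(ltW t0)// ler_pdivrMr//.
  by rewrite ler_peMr ?(ltW t0)// ler1n.
rewrite mulrAC; apply: ler_wpM2r; first exact/kernel_scale_ge0/ltW.
rewrite ler_wpM2r// mulrC lerDr.
by rewrite !mulr_ge0 ?expR_ge0 ?powR_ge0// ltW.
Qed.

End averages.

(** * Dyadic decomposition of the potential *)

Section scales.
Context {R : realType}.
Local Notation leb := (@lebesgue_measure R).
Local Notation rV n := 'rV[R]_n.
Local Notation lebn n := (lebesgue_rV R n).

(** With T = max |x - y| t, the lower bound puts (x, t) into the cone of radius
    4 e 2^j over [y], and the upper bound keeps the sizes of the kernel at T and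
    at that radius comparable. *)
Lemma dyadic_scale (e T : R) : 0 < e -> e <= T ->
  exists j : nat, 2 * T < 4 * e * 2 ^+ j <= 4 * T.
Proof.
move=> e0 eT.
have ex : exists j : nat, 2 * T < 4 * e * 2 ^+ j.
  have [N TN] : exists N : nat, T / e < N%:R.
    by exists (Num.bound (T / e)); rewrite archi_boundP// divr_ge0// ?ltW// (lt_le_trans e0).
  exists N; rewrite ltr_pdivrMr// in TN.
  have N2 : N%:R <= 2 ^+ N :> R by rewrite -natrX ler_nat ltnW// ltn_expl.
  have : N%:R * e <= 2 ^+ N * e by rewrite ler_wpM2r// ltW.
  have : 0 < 2 ^+ N * e by rewrite mulr_gt0// exprn_gt0.
  by rewrite -mulrA (mulrC e); lra.
case: (ex_minnP ex) => -[|j] hj minj; [exists 0%N|exists j.+1];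
  rewrite ?hj//=; first by rewrite expr0 mulr1; lra.
have : ~~ (2 * T < 4 * e * 2 ^+ j) by apply/negP => /minj; rewrite ltnn.
by rewrite -leNgt exprS; lra.
Qed.

Definition scale (e : R) (j : nat) : R := 4 * e * 2 ^+ j.

Lemma scale_gt0 e j : 0 < e -> 0 < scale e j.
Proof. by move=> e0; rewrite !mulr_gt0// exprn_gt0. Qed.

Variables (n : nat) (alpha : R).
Hypotheses (n0 : (0 < n)%N) (a0 : 0 < alpha) (an : alpha < n%:R).

Lemma measurable_lt_natr d (T : measurableType d) (f h : T -> R) :
  measurable_fun [set: T] f -> measurable_fun [set: T] h ->
  measurable_fun [set: T] (fun x => (f x < h x)%R%:R : R).
Proof.
move=> mf mh; rewrite (_ : (fun _ => _) = fun x => if f x < h x then 1 else 0).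
  by apply: measurable_fun_ifT => //; exact: measurable_fun_ltr.
by apply/funext => x; case: ifP.
Qed.

(** If the potential of [g] is at least 1 on a cube of side comparable to [t],
    then [g] has a definite mass, weighted by the size of the kernel, on the
    balls of the dyadic radii that exceed the distance plus [t]. *)
Lemma potential_ge1_scales : exists2 C, 0 < C &
  forall (g : rV n -> R) e (x : rV n) t, 0 < e -> e <= t ->
  measurable_fun [set: borel (rV n)] (g : borel (rV n) -> R) ->
  (forall y, 0 <= g y) ->
  {ae lebn n, forall z : borel (rV n), cube x (t / (2 * n%:R)) z ->
     (1 <= \int[lebn n]_y (bessel_kernel alpha ((z : rV n) - y) * g y)%:E)%E} ->
  (1 <= \sum_(j <oo) \int[lebn n]_y
     (C * kernel_scale n alpha (scale e j) *
       (g y * (enorm (x - (y : rV n)) + t < scale e j)%R%:R))%:E)%E.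
Proof.
have [C C0 hC] := bessel_kernel_cube n0 a0 an.
have nR : 0 < n%:R :> R by rewrite ltr0n.
exists (n%:R ^+ n * C * 4 ^+ n) => [|g e x t e0 et mg g0 aeg].
  by rewrite !mulr_gt0 ?exprn_gt0.
have t0 : 0 < t := lt_le_trans e0 et.
have tn0 : 0 < t ^+ n by rewrite exprn_gt0.
pose Q : set (borel (rV n)) := cube x (t / (2 * n%:R)).
have t20 : 0 <= t / (2 * n%:R) by rewrite divr_ge0 ?mulr_ge0 ?(ltW t0).
have mQ : measurable Q by exact: measurable_cube.
pose c j (y : rV n) := n%:R ^+ n * C * 4 ^+ n * kernel_scale n alpha (scale e j) *
       (g y * (enorm (x - y) + t < scale e j)%R%:R).
have ks0 j : 0 <= kernel_scale n alpha (scale e j) by exact/kernel_scale_ge0/ltW/scale_gt0.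
have c0 j y : 0 <= c j y.
  apply: mulr_ge0; last by apply: mulr_ge0; rewrite ?g0.
  by apply: mulr_ge0 => //; rewrite !mulr_ge0 ?exprn_ge0 ?ltW.
have mc j : measurable_fun [set: borel (rV n)] (c j : borel (rV n) -> R).
  apply: measurable_funM => //; apply: measurable_funM => //.
  apply: measurable_lt_natr => //; apply: measurable_funD => //.
  by apply: (@measurable_enorm_sub _ _ _ _ (cst x) id).
rewrite -[X in (_ <= X)%E](integral_nneseries (lebn n) measurableT (f := fun j y => (c j y)%:E))//; last 2 first.
- by move=> j; apply/measurable_EFinP.
- by move=> j y _; rewrite lee_fin.
pose F (q : borel (rV n) * borel (rV n)) : \bar R :=
  ((q.1 \in Q)%:R * (bessel_kernel alpha ((q.1 : rV n) - q.2) * g q.2))%:E.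
have F0 q : (0 <= F q)%E by rewrite lee_fin mulr_ge0// mulr_ge0 ?bessel_kernel_ge0.
have mF : measurable_fun setT F.
  apply/measurable_EFinP/measurable_funM; last apply: measurable_funM.
  - rewrite -[X in measurable_fun _ X]/(\1_Q \o fst).
    exact: (measurableT_comp (measurable_indic mQ) measurable_fst).
  - apply: (measurableT_comp (measurable_bessel_kernel an)).
    by apply: measurable_rV_sub.
  - exact: (measurableT_comp mg measurable_snd).
have QE : (\int[lebn n]_z \int[lebn n]_y F (z, y) =
    \int[lebn n]_(z in Q) \int[lebn n]_y (bessel_kernel alpha ((z : rV n) - y) * g y)%:E)%E.
  rewrite [RHS]integral_mkcond; apply: eq_integral => z _; rewrite patchE /F/=.
  case: ifPn => zQ; first by apply: eq_integral => y _; rewrite mul1r.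
  by rewrite integral0_eq// => y _; rewrite mul0r.
have h1 : (((t / n%:R) ^+ n)%:E <= \int[lebn n]_z \int[lebn n]_y F (z, y))%E.
  rewrite QE; apply: (@le_trans _ _ (\int[lebn n]_(z in Q) 1)%E).
    rewrite integral_cst// mul1e [X in (_ <= X)%E](lebesgue_cube x t20) lee_fin.
    by rewrite (_ : 2 * _ = t / n%:R)//; field; rewrite gt_eqF.
  apply: ae_ge0_le_integral => //.
  - by move=> z _; apply: integral_ge0 => y _; rewrite lee_fin mulr_ge0 ?bessel_kernel_ge0.
  - apply: measurable_funTS.
    have := @measurable_fun_fubini_tonelli_F _ _ _ _ _ (lebn n)
      (fun q : borel (rV n) * borel (rV n) =>
        (bessel_kernel alpha ((q.1 : rV n) - q.2) * g q.2)%:E).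
    apply => [|q]; last by rewrite lee_fin mulr_ge0 ?bessel_kernel_ge0.
    apply/measurable_EFinP; apply: measurable_funM.
      apply: (measurableT_comp (measurable_bessel_kernel an)).
      by apply: measurable_rV_sub.
    exact: (measurableT_comp mg measurable_snd).
rewrite fubini_tonelli// in h1.
rewrite -(@lee_pmul2l _ ((t / n%:R) ^+ n)%:E)//; last first.
  by rewrite lte_fin exprn_gt0// divr_gt0.
rewrite mule1; apply: (le_trans h1).
rewrite -ge0_integralZl//; last 3 first.
- apply: ge0_emeasurable_sum => [j y _ _|j _]; first by rewrite lee_fin.
  exact/measurable_EFinP.
- by move=> y _; apply: nneseries_ge0 => j _ _; rewrite lee_fin.
- by rewrite lee_fin exprn_ge0// divr_ge0 ?ltW.
apply: ge0_le_integral_lower => y _; first exact: integral_ge0.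
apply: (@le_trans _ _ ((g y)%:E * (C * t ^+ n * kernel_scale n alpha (Num.max (enorm (x - y)) t))%:E)%E).
  apply: le_trans (lee_wpmul2l _ (hC x y t t0)); rewrite ?lee_fin//.
  rewrite -ge0_integralZl//=; last 3 first.
  - apply: measurable_funTS; apply/measurable_EFinP.
    exact: (measurable_bessel_kernel_sub an).
  - by move=> z _; rewrite lee_fin bessel_kernel_ge0.
  - by rewrite lee_fin.
  rewrite [leRHS]integral_mkcond le_eqVlt; apply/orP; left; apply/eqP.
  apply: eq_integral => z _; rewrite patchE /F/=.
  by case: ifPn => zQ; rewrite ?mul0r// mul1r -EFinM mulrC.
have T0 : 0 < Num.max (enorm (x - y)) t by rewrite lt_max t0 orbT.
have eT : e <= Num.max (enorm (x - y)) t by rewrite le_max et orbT.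
have [j /andP[j1 j2]] := dyadic_scale e0 eT.
apply: (@le_trans _ _ (((t / n%:R) ^+ n)%:E * (c j y)%:E)%E); last first.
  rewrite lee_wpmul2l ?lee_fin ?exprn_ge0 ?divr_ge0 ?(ltW t0)//.
  rewrite (nneseriesD1 (n := j))//; last by move=> k _; rewrite lee_fin.
  by rewrite leeDl// nneseries_ge0// => k _ _; rewrite lee_fin.
rewrite -!EFinM lee_fin /c.
have -> : (enorm (x - y) + t < scale e j) = true.
  apply/idP; apply: le_lt_trans j1; rewrite mulr_natl mulr2n lerD//.
    by rewrite le_max lexx.
  by rewrite le_max lexx orbT.
have kle : kernel_scale n alpha (Num.max (enorm (x - y)) t) <=
    4 ^+ n * kernel_scale n alpha (scale e j).
  by apply: kernel_scale_le; rewrite ?(ltW a0) ?(ltW an) ?ler1n ?scale_gt0.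
rewrite mulr1 (_ : (t / n%:R) ^+ n * _ = g y * (C * t ^+ n * (4 ^+ n * kernel_scale n alpha (scale e j)))).
  by rewrite ler_wpM2l// ler_wpM2l// mulr_ge0// ltW.
by rewrite expr_div_n; field; rewrite expf_neq0 ?gt_eqF.
Qed.

End scales.

(** * Summation over geometric scales *)

Section dini.
Context {R : realType}.
Local Notation leb := (@lebesgue_measure R).
Implicit Types (s u x y c : R).

(** Each term [d j < D] is at most (min D d_j - min D d_(j+1)) / (1 - th), and
    these differences telescope. *)
Lemma sum_geometric_below (d : nat -> R) (th D : R) N : 0 <= D ->
  0 < th < 1 -> (forall j, 0 <= d j) -> (forall j, d j.+1 <= th * d j) ->
  \sum_(j < N) (if d j < D then d j else 0) <= D / (1 - th).
Proof.
move=> D0 /andP[th0 th1] d0 dS; have t1 : 0 < 1 - th by rewrite subr_gt0.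
suff : \sum_(j < N) (if d j < D then d j else 0) <= (D - Num.min D (d N)) / (1 - th).
  move=> /le_trans; apply; rewrite ler_wpM2r ?invr_ge0 ?(ltW t1)//.
  by rewrite gerBl le_min D0 d0.
elim: N => [|N IH].
  by rewrite big_ord0 divr_ge0 ?(ltW t1)// subr_ge0 ge_min lexx.
rewrite big_ord_recr/=; apply: le_trans (lerD IH (lexx _)) _.
have dS1 : d N.+1 <= d N by rewrite (le_trans (dS N))// ler_piMl ?d0// ltW.
rewrite -(@ler_pM2r _ (1 - th))// mulrDl !divfK ?gt_eqF//.
have dSN := dS N; have dN0 := d0 N.
case: ltP => dN; last first.
  by rewrite mul0r addr0 lerD2l lerN2 ge_min lexx.
rewrite (min_r (ltW (le_lt_trans dS1 dN))).
by move: dSN; lra.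
Qed.

Variables (Psi Phi : R -> R) (K q : R).
Hypotheses (q0 : 0 < q) (K0 : 0 < K)
  (Phi_nd : {homo Phi : x y / x <= y}) (Phi_ge0 : forall x, 0 <= Phi x)
  (Psi_le : forall s, 0 <= s -> Psi s <= K * Phi s)
  (Phi_le : forall s, 0 <= s -> Phi s <= K * Psi s)
  (Psi_gt0 : forall s, 0 < s -> 0 < Psi s).
Hypothesis Psi_dbl : forall c, 0 < c -> exists2 L, 0 < L &
  forall s, 0 < s -> Psi (c * s) <= L * Psi s.
Hypothesis Psi_dini : exists2 c, 0 < c & forall s, 0 < s ->
  (\int[leb]_(u in `]0%R, s[) ((Psi u / u) `^ q / u)%:E
    <= (c * (Psi s / s) `^ q)%:E)%E.

Lemma Psi_quasi_nd x y : 0 <= x -> x <= y -> Psi x <= K ^+ 2 * Psi y.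
Proof.
move=> x0 xy; rewrite (le_trans (Psi_le x0))// expr2 -mulrA ler_pM2l//.
by rewrite (le_trans (Phi_nd xy))// Phi_le// (le_trans x0).
Qed.

Lemma Psi_growth c : 0 < c -> exists2 L, 0 < L &
  forall x y, 0 <= x -> 0 < y -> x <= c * y -> Psi x <= L * Psi y.
Proof.
move=> c0; have [L L0 hL] := Psi_dbl c0; exists (K ^+ 2 * L).
  by rewrite mulr_gt0 ?exprn_gt0.
move=> x y x0 y0 xy; rewrite (le_trans (Psi_quasi_nd x0 xy))//.
by rewrite -[leRHS]mulrA ler_pM2l ?exprn_gt0 ?hL.
Qed.

Let phi u := (Phi u / u) `^ q.

Let phi_ge0 u : 0 <= phi u. Proof. exact: powR_ge0. Qed.

(** The Dini integral of the monotone function [Phi], which is measurable, whereas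
    [Psi] is only comparable to it. *)
Let J s : \bar R := (\int[leb]_(u in `]0%R, s[) (phi u / u)%:E)%E.

Let pos_part0 (A : set R) : A `<=` `]0, +oo[%classic ->
  forall u, A u -> (0 <= (phi u / u)%:E)%E.
Proof.
move=> hA u /hA/=; rewrite in_itv/= andbT => u0.
by rewrite lee_fin divr_ge0 ?phi_ge0 ?ltW.
Qed.

Let mphi (A : set R) : measurable A -> A `<=` `]0, +oo[%classic ->
  measurable_fun A (fun u => (phi u / u)%:E).
Proof.
move=> mA Apos; apply/measurable_EFinP.
apply: (@eq_measurable_fun _ _ _ _ _ (fun u => (Phi u * (Num.max 0 u)^-1) `^ q * (Num.max 0 u)^-1)).
  move=> u; rewrite inE => /Apos/=; rewrite in_itv/= andbT => u0.
  by rewrite (max_r (ltW u0)).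
have mi : measurable_fun [set: R] (fun u : R => (Num.max 0 u)^-1).
  apply: measurable_fun_inv; first by move=> u; rewrite le_max lexx.
  exact: measurable_maxr.
apply: measurable_funTS; apply: measurable_funM => //.
apply: (measurableT_comp (measurable_powR q)); apply: measurable_funM => //.
exact: nondecreasing_measurable.
Qed.

Let pos0 s : `]0, s[%classic `<=` (`]0, +oo[%classic : set R).
Proof. by move=> u /=; rewrite !in_itv/= andbT => /andP[]. Qed.

Let J_nd s t : s <= t -> (J s <= J t)%E.
Proof.
move=> st; apply: ge0_subset_integral => //.
- by apply: mphi.
- exact/pos_part0.
- by apply: subset_itvl; rewrite bnd_simp.
Qed.

(** On [u, k u[ the integrand is comparable to its value at [u] divided by [u],
    because [Phi] is monotone. *)
Let J_step k u : 1 < k -> 0 < u ->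
  (J u + ((k - 1) / k * (k `^ q)^-1 * phi u)%:E <= J (k * u)%R)%E.
Proof.
move=> k1 u0; have k0 : 0 < k by rewrite (lt_trans ltr01).
have uk : u < k * u by rewrite ltr_pMl.
rewrite {2}/J (@itv_bndbnd_setU _ _ _ (BLeft u)); last 2 first.
- by rewrite bnd_simp.
- by rewrite bnd_simp ltW.
have sub2 : `[u, k * u[%classic `<=` (`]0, +oo[%classic : set R).
  by move=> v /=; rewrite !in_itv/= andbT => /andP[uv _]; exact: lt_le_trans uv.
have sub : `]0, u[ `|` `[u, k * u[ `<=` (`]0, +oo[%classic : set R).
  by move=> v [/pos0//|/sub2].
rewrite ge0_integral_setU//=; last 3 first.
- by apply: mphi => //; exact: measurableU.
- exact: pos_part0.
- rewrite disj_set2E; apply/eqP; rewrite -subset0 => v [/=].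
  by rewrite !in_itv/= => /andP[_ h] /andP[h2 _]; move: h; rewrite ltNge h2.
apply: leeD => //.
apply: (@le_trans _ _ (\int[leb]_(v in `[u, (k * u)%R[) ((k `^ q)^-1 * phi u / (k * u))%:E)%E).
  rewrite integral_cst// [X in (_ * X)%E](lebesgue_measure_itv `[u, k * u[)/= lte_fin uk.
  rewrite -EFinB -EFinM lee_fin le_eqVlt; apply/orP; left; apply/eqP.
  by field; rewrite !gt_eqF// powR_gt0.
apply: ge0_le_integral_lower => v /=; rewrite in_itv/= lee_fin => /andP[uv vk].
  by rewrite divr_ge0 ?mulr_ge0 ?invr_ge0 ?powR_ge0// ltW// mulr_gt0.
have v0 := lt_le_trans u0 uv.
apply: ler_pM.
- by rewrite mulr_ge0 ?invr_ge0 ?powR_ge0.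
- by rewrite invr_ge0 ltW// mulr_gt0.
- rewrite /phi -powRN.
  have -> : k `^ (- q) = (k^-1) `^ q.
    by rewrite -powR_inv1 ?ltW// -powRrM mulN1r.
  rewrite -powRM ?invr_ge0 ?divr_ge0 ?(ltW k0) ?(ltW u0)//.
  rewrite ge0_ler_powR ?nnegrE ?mulr_ge0 ?divr_ge0 ?invr_ge0 ?(ltW k0) ?(ltW u0) ?(ltW q0) ?(ltW v0)//.
  rewrite mulrCA -invfM ler_pM ?invr_ge0 ?mulr_ge0 ?(ltW u0) ?(ltW k0) ?Phi_nd//.
  by rewrite lef_pV2 ?posrE ?mulr_gt0// ltW.
- by rewrite lef_pV2 ?posrE ?mulr_gt0// ltW.
Qed.

Let J_le : exists2 C, 0 < C & forall s, 0 < s -> (J s <= (C * (Psi s / s) `^ q)%:E)%E.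
Proof.
have [c c0 hc] := Psi_dini; have Kq : 0 < K `^ q by rewrite powR_gt0.
exists (K `^ q * c) => [|s s0]; first by rewrite mulr_gt0.
have KqE : ((K `^ q)%:E * ((K `^ q)^-1)%:E = 1)%E.
  by rewrite -EFinM divff// gt_eqF.
rewrite -[J s]mul1e -KqE -muleA -mulrA EFinM lee_wpmul2l ?lee_fin ?(ltW Kq)//.
apply: le_trans (hc _ s0); rewrite /J -ge0_integralZl//; last 3 first.
- exact: mphi.
- exact: pos_part0.
- by rewrite lee_fin invr_ge0 ltW.
apply: ge0_le_integral_lower => u su; have := pos0 su;
  rewrite /= in_itv/= andbT => u0; rewrite -EFinM lee_fin.
  by rewrite !mulr_ge0 ?invr_ge0 ?powR_ge0 ?(ltW u0).
rewrite mulrA ler_wpM2r ?invr_ge0 ?(ltW u0)// mulrC ler_pdivrMr//.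
rewrite -powRM ?divr_ge0 ?(ltW u0) ?(ltW K0) ?(ltW (Psi_gt0 u0))//.
rewrite ge0_ler_powR ?nnegrE ?mulr_ge0 ?divr_ge0 ?invr_ge0 ?(ltW u0) ?(ltW K0) ?(ltW q0) ?(ltW (Psi_gt0 u0))//.
by rewrite mulrAC ler_wpM2r ?invr_ge0 ?(ltW u0)// mulrC Phi_le ?(ltW u0).
Qed.

(** A sequence growing geometrically meets each interval [u, k u[ once, so the
    sum over its terms below [s] is at most the Dini integral up to [k s]. *)
Let sum_below (k : R) : 1 < k -> exists2 C, 0 < C & forall (u : nat -> R) s N,
  (forall j, 0 < u j) -> (forall j, k * u j <= u j.+1) -> 0 < s ->
  \sum_(j < N) (if u j <= s then (Psi (u j) / u j) `^ q else 0)
    <= C * (Psi s / s) `^ q.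
Proof.
move=> k1; have k0 : 0 < k by rewrite (lt_trans ltr01).
have [C C0 hC] := J_le; have [L L0 hL] := Psi_dbl k0.
pose a := (k - 1) / k * (k `^ q)^-1.
have a0 : 0 < a by rewrite mulr_gt0 ?divr_gt0 ?invr_gt0 ?powR_gt0 ?subr_gt0.
exists (K `^ q * (a^-1 * (C * L `^ q))) => [|u s N u0 uS s0].
  by rewrite !mulr_gt0 ?invr_gt0 ?powR_gt0.
have sumJ : ((a * \sum_(j < N) (if u j <= s then phi (u j) else 0))%:E <= J (Num.min (u N) (k * s))%R)%E.
  elim: N => [|N IH].
    by rewrite big_ord0 mulr0; apply: integral_ge0 => v /pos0; exact: pos_part0.
  rewrite big_ord_recr/= mulrDr EFinD; apply: le_trans (leeD IH (lexx _)) _.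
  case: (leP (u N) s) => us; last first.
    rewrite mulr0 adde0; apply: J_nd; rewrite le_min !ge_min lexx orbT andbT.
    by rewrite (le_trans _ (uS N)) ?ler_peMl ?(ltW (u0 N)) ?(ltW k1).
  have uks : u N <= k * s by rewrite (le_trans us)// ler_peMl ?(ltW s0) ?(ltW k1).
  rewrite (min_l uks); apply: le_trans (J_step k1 (u0 N)) _.
  by apply: J_nd; rewrite le_min uS/= ler_pM2l.
have {}sumJ : \sum_(j < N) (if u j <= s then phi (u j) else 0) <= a^-1 * (C * L `^ q) * (Psi s / s) `^ q.
  rewrite -mulrA ler_pdivlMl// -lee_fin; apply: le_trans sumJ _.
  have ks0 : 0 < k * s by rewrite mulr_gt0.
  apply: (@le_trans _ _ (J (k * s))); first by apply: J_nd; rewrite ge_min lexx orbT.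
  apply: le_trans (hC _ ks0) _; rewrite lee_fin -mulrA ler_wpM2l ?(ltW C0)//.
  rewrite -powRM ?(ltW L0) ?divr_ge0 ?(ltW s0) ?(ltW (Psi_gt0 s0))//.
  rewrite ge0_ler_powR ?nnegrE ?mulr_ge0 ?divr_ge0 ?invr_ge0 ?(ltW ks0) ?(ltW s0) ?(ltW L0) ?(ltW q0) ?(ltW (Psi_gt0 _))//.
  rewrite mulrA ler_pM ?invr_ge0 ?(ltW ks0) ?(ltW (Psi_gt0 ks0)) ?hL//.
  by rewrite lef_pV2 ?posrE// ler_peMl ?(ltW s0) ?(ltW k1).
rewrite -mulrA; apply: le_trans (ler_wpM2l (powR_ge0 K q) sumJ).
rewrite mulr_sumr; apply: ler_sum => j _; case: ifP => _; last by rewrite mulr0.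
have uj := ltW (u0 j); have Pj := Psi_gt0 (u0 j).
rewrite -powRM ?divr_ge0 ?(ltW K0)//.
rewrite ge0_ler_powR ?nnegrE ?mulr_ge0 ?divr_ge0 ?invr_ge0 ?(ltW K0) ?(ltW q0) ?(ltW Pj)//.
by rewrite mulrA ler_wpM2r ?invr_ge0// Psi_le.
Qed.

(** Below [s] the terms are controlled by the Dini condition, above [s] by the
    decay of the geometric sequence. *)
Lemma sum_min_Psi (k : R) : 1 < k -> exists2 C, 0 < C & forall (u : nat -> R) s N,
  (forall j, 0 < u j) -> (forall j, k * u j <= u j.+1) -> 0 < s ->
  \sum_(j < N) (Num.min (Psi (u j)) (Psi s) / u j) `^ q <= C * (Psi s / s) `^ q.
Proof.
move=> k1; have k0 : 0 < k by rewrite (lt_trans ltr01).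
have [C C0 hC] := sum_below k1.
have kq0 : 0 < k `^ (- q) by rewrite powR_gt0.
have kq1 : k `^ (- q) < 1.
  by rewrite /powR gt_eqF// -[ltRHS]expR0 ltr_expR mulNr oppr_lt0 mulr_gt0// ln_gt0.
exists (C + (1 - k `^ (- q))^-1) => [|u s N u0 uS s0].
  by rewrite addr_gt0// invr_gt0 subr_gt0.
have Ps := Psi_gt0 s0.
have invq (x : R) : 0 < x -> (x^-1) `^ q = x `^ (- q).
  by move=> x0; rewrite -powR_inv1 ?ltW// -powRrM mulN1r.
have tail : \sum_(j < N) (if u j `^ (- q) < s `^ (- q) then u j `^ (- q) else 0)
   <= s `^ (- q) / (1 - k `^ (- q)).
  apply: (@sum_geometric_below (fun j => u j `^ (- q))) => [|||j]; rewrite ?powR_ge0 ?kq0//.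
    by move=> j; exact: powR_ge0.
  rewrite -powRM ?(ltW k0) ?(ltW (u0 j))// !powRN lef_pV2 ?posrE ?powR_gt0 ?mulr_gt0//.
  by rewrite ge0_ler_powR ?nnegrE ?(ltW q0) ?(ltW (u0 _)) ?mulr_ge0 ?(ltW k0) ?(ltW (u0 _)) ?uS.
rewrite mulrDl.
have -> : (1 - k `^ (- q))^-1 * (Psi s / s) `^ q = Psi s `^ q * (s `^ (- q) / (1 - k `^ (- q))).
  by rewrite powRM ?invr_ge0 ?(ltW s0) ?(ltW Ps)// invq// mulrC mulrA.
apply: le_trans (lerD (hC u s N u0 uS s0) (ler_wpM2l (powR_ge0 _ q) tail)).
rewrite mulr_sumr -big_split/=; apply: ler_sum => j _.
have uj := u0 j; have Pj := Psi_gt0 uj.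
have m0 : 0 <= Num.min (Psi (u j)) (Psi s) by rewrite le_min !ltW.
case: (leP (u j) s) => us.
  apply: ler_wpDr; first by rewrite mulr_ge0 ?powR_ge0//; case: ifP; rewrite ?powR_ge0.
  rewrite ge0_ler_powR ?nnegrE ?divr_ge0 ?(ltW q0) ?(ltW uj) ?(ltW Pj)//.
  by rewrite ler_wpM2r ?invr_ge0 ?(ltW uj)// ge_min lexx.
rewrite add0r ifT; last first.
  by rewrite !powRN ltf_pV2 ?posrE ?powR_gt0// gt0_ltr_powR ?nnegrE ?ltW.
rewrite -invq// -powRM ?invr_ge0 ?(ltW Ps) ?(ltW uj)//.
rewrite ge0_ler_powR ?nnegrE ?divr_ge0 ?(ltW q0) ?(ltW uj) ?(ltW Ps)//.
by rewrite ler_wpM2r ?invr_ge0 ?(ltW uj)// ge_min lexx orbT.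
Qed.

End dini.

(** * Laplace transforms of the squared distance are Schwartz functions *)

Section laplace.
Context {R : realType} d (Y : measurableType d) (mu : {measure set Y -> \bar R}).
Variables (W lam : Y -> R) (b : R).
Hypotheses (mW : measurable_fun [set: Y] W) (mlam : measurable_fun [set: Y] lam)
  (W0 : forall y, 0 <= W y) (lam0 : forall y, 0 < lam y) (lamb : forall y, lam y <= b).
Hypothesis moments : forall N : nat, (\int[mu]_y (W y * lam y ^- N)%:E < +oo)%E.

Let b0 (y : Y) : 0 <= b. Proof. by rewrite (le_trans (ltW (lam0 y))). Qed.

Definition laplace_term (k : nat) (r : R) (y : Y) : R :=
  W y * (- lam y) ^+ k * expR (- (lam y * r)).

(** The k-th derivative of the Laplace transform of [W] at the rates [lam]. *)
Definition laplace (k : nat) (r : R) : R := \int[mu]_y laplace_term k r y.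

Lemma measurable_laplace_term k r : measurable_fun [set: Y] (laplace_term k r).
Proof.
apply: measurable_funM.
  by apply: measurable_funM => //; apply: measurable_funX; exact: measurable_funN.
apply: (measurableT_comp (@measurable_expR R)); apply: measurable_funN.
exact: measurable_funM.
Qed.

Lemma integrable_moment N : mu.-integrable [set: Y] (EFin \o (fun y => W y * lam y ^- N)).
Proof.
apply/integrableP; split.
  apply/measurable_EFinP; apply: measurable_funM => //.
  apply: measurable_fun_inv; first by move=> y; rewrite exprn_ge0// ltW.
  exact: measurable_funX.
under eq_integral => y _.
  rewrite gee0_abs; first over.
  by rewrite lee_fin mulr_ge0 ?W0 ?invr_ge0 ?exprn_ge0 ?(ltW (lam0 y)).
exact: moments.
Qed.

Lemma laplace_term_le k r c y : `|r| <= c ->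
  `|laplace_term k r y| <= b ^+ k * expR (b * c) * W y.
Proof.
move=> rc; rewrite /laplace_term !normrM normrX normrN.
rewrite (ger0_norm (W0 y)) (gtr0_norm (lam0 y)) (ger0_norm (expR_ge0 _)).
rewrite -mulrA mulrC ler_wpM2r// ler_pM ?exprn_ge0 ?expR_ge0 ?(ltW (lam0 y))//.
  by rewrite lerXn2r ?nnegrE ?(b0 y) ?(ltW (lam0 y)) ?lamb.
have c0 : 0 <= c by rewrite (le_trans _ rc).
rewrite ler_expR (@le_trans _ _ (lam y * c))//; last by rewrite ler_wpM2r.
rewrite -mulrN ler_wpM2l ?(ltW (lam0 y))// (le_trans _ rc)// -normrN.
exact: ler_norm.
Qed.

Lemma integrableW c : mu.-integrable [set: Y] (EFin \o (fun y => c * W y)).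
Proof.
rewrite (_ : EFin \o _ = (fun y => c%:E * (W y * lam y ^- 0)%:E)%E).
  by apply: integrableZl => //; exact: integrable_moment.
by apply/funext => y /=; rewrite expr0 invr1 mulr1.
Qed.

Lemma integrable_laplace_term k r :
  mu.-integrable [set: Y] (EFin \o laplace_term k r).
Proof.
apply: (le_integrable measurableT _ _ (integrableW (b ^+ k * expR (b * `|r|)))).
  by apply/measurable_EFinP; exact: measurable_laplace_term.
move=> y _ /=; rewrite lee_fin (le_trans (laplace_term_le k y (lexx _)))//.
exact: ler_norm.
Qed.

Lemma is_derive_laplace_term (k : nat) (r : R) (y : Y) :
  is_derive r 1 ((laplace_term k)^~ y) (laplace_term k.+1 r y).
Proof.
rewrite /laplace_term.
have h : is_derive r 1 (fun r => - (lam y * r)) (- lam y).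
  have := @is_deriveN R R R ( *%R (lam y)) r 1 (lam y).
  apply; have := is_deriveZ (lam y) (is_derive_id r (1 : R)).
  by rewrite scaler1.
have := is_derive1_comp (f := expR) (g := fun r => - (lam y * r)) (is_derive_expR _) h.
move/(is_deriveZ (W y * (- lam y) ^+ k)).
by move=> {h}h; apply: is_derive_eq; rewrite /GRing.scale/= exprSr; ring.
Qed.

(** Differentiation under the integral: on a bounded interval of [r] the
    derivatives of the integrand are dominated by a multiple of [W]. *)
Lemma is_derive_laplace (k : nat) (r : R) : is_derive r 1 (laplace k) (laplace k.+1 r).
Proof.
pose c := `|r| + 1.
have rI : (`]r - 1, r + 1[%classic : set R) r by rewrite /= in_itv/= ltrBlDr !ltrDl ltr01.
have Ic x : (`]r - 1, r + 1[%classic : set R) x -> `|x| <= c.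
  rewrite /= in_itv/= => /andP[x1 x2]; rewrite /c.
  have := ler_norm r; have := ler_norm (- r); rewrite normrN => h1 h2.
  by rewrite ler_norml; lra.
have Dt k' x y : partial1of2 (laplace_term k') x y = laplace_term k'.+1 x y.
  rewrite partial1of2E; have h := is_derive_laplace_term k' x y.
  exact: derive_val.
pose G y := b ^+ k.+1 * expR (b * c) * W y.
have G0 y : 0 <= G y by rewrite !mulr_ge0 ?exprn_ge0 ?expR_ge0// (b0 y).
have intf x : (`]r - 1, r + 1[%classic : set R) x ->
    mu.-integrable [set: Y] (EFin \o laplace_term k x).
  by move=> _; exact: integrable_laplace_term.
have derf x y : (`]r - 1, r + 1[%classic : set R) x -> [set: Y] y ->
    derivable ((laplace_term k)^~ y) x 1.
  by move=> _ _; have h := is_derive_laplace_term k x y; exact: ex_derive.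
have Gub x y : (`]r - 1, r + 1[%classic : set R) x -> [set: Y] y ->
    `|partial1of2 (laplace_term k) x y| <= G y.
  by move=> /Ic xc _; rewrite Dt laplace_term_le.
have iG := integrableW (b ^+ k.+1 * expR (b * c)).
apply: DeriveDef.
  exact: (derivable_under_integral measurableT rI intf derf G0 iG Gub).
rewrite -derive1E (differentiation_under_integral measurableT rI intf derf G0 iG Gub).
by rewrite /laplace; apply: eq_Rintegral => y _; rewrite Dt.
Qed.

(** All moments of order [- N] of the rates are finite, which makes the
    transform rapidly decreasing. *)
Lemma laplace_decay k N : exists M : R, forall r, 0 <= r ->
  r ^+ N * `|laplace k r| <= M.
Proof.
pose M := fine (\int[mu]_y (b ^+ k * N`!%:R * (W y * lam y ^- N))%:E)%E.
exists M => r r0.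
have iB : mu.-integrable [set: Y] (EFin \o (fun y => b ^+ k * N`!%:R * (W y * lam y ^- N))).
  rewrite (_ : EFin \o _ = (fun y => (b ^+ k * N`!%:R)%:E * (W y * lam y ^- N)%:E)%E).
    by apply: integrableZl => //; exact: integrable_moment.
  by apply/funext => y.
have iA : mu.-integrable [set: Y] (EFin \o (fun y => r ^+ N * laplace_term k r y)).
  rewrite (_ : EFin \o _ = (fun y => (r ^+ N)%:E * (laplace_term k r y)%:E)%E).
    by apply: integrableZl => //; exact: integrable_laplace_term.
  by apply/funext => y.
have rN : 0 <= r ^+ N by rewrite exprn_ge0.
rewrite -[X in X * _](ger0_norm rN) -normrM.
rewrite /laplace -RintegralZl//; last exact: integrable_laplace_term.
apply: (le_trans (le_normr_Rintegral _ _)) => //.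
apply: le_Rintegral => //; first exact: (integrable_norm iA).
move=> y _; rewrite normrM (ger0_norm rN) /laplace_term !normrM normrX normrN.
rewrite (ger0_norm (W0 y)) (gtr0_norm (lam0 y)) (ger0_norm (expR_ge0 _)).
have l0 := lam0 y.
have ex : (lam y * r) ^+ N * expR (- (lam y * r)) <= N`!%:R.
  rewrite expRN ler_pdivrMr ?expR_gt0//.
  have lr0 : 0 <= lam y * r by rewrite mulr_ge0 ?(ltW l0).
  have [->|] := eqVneq N 0%N.
    by rewrite expr0 fact0 mul1r; have := expR_ge1Dx (lam y * r); lra.
  case: (N) => // n _.
  have := @expR_ge1Dxn R (lam y * r) n (mulr_ge0 (ltW l0) r0).
  move=> h; have {h} : (lam y * r) ^+ n.+1 / (n.+1)`!%:R <= expR (lam y * r) by lra.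
  by rewrite ler_pdivrMr ?ltr0n ?fact_gt0// => /le_trans; apply; rewrite mulrC.
rewrite (_ : r ^+ N * _ = lam y ^+ k * (lam y * r) ^+ N * expR (- (lam y * r)) * (W y * lam y ^- N)).
  apply: ler_wpM2r; first by rewrite mulr_ge0 ?W0 ?invr_ge0 ?exprn_ge0 ?(ltW l0).
  rewrite -mulrA; apply: ler_pM => //.
  - by rewrite exprn_ge0 ?(ltW l0).
  - by rewrite mulr_ge0 ?exprn_ge0 ?mulr_ge0 ?expR_ge0 ?(ltW l0).
  - by rewrite lerXn2r ?nnegrE ?(b0 y) ?(ltW l0) ?lamb.
by rewrite exprMn; field; rewrite expf_neq0 ?gt_eqF.
Qed.

End laplace.

Section laplace_schwartz.
Context {R : realType} (n : nat).
Local Notation rV := 'rV[R]_n.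

Lemma is_derive_coord (x v : rV) (j : 'I_n) :
  is_derive x v (fun y : rV => y 0 j) (v 0 j).
Proof.
apply: DeriveDef; first exact/diff_derivable/differentiable_coord.
rewrite deriveE; last exact: differentiable_coord.
have @f : {linear rV -> R}.
  by exists (fun N : rV => N 0 j); do 2![eexists]; do ?[constructor];
     rewrite ?mxE// => ? *; rewrite ?mxE//; move=> ?; rewrite !mxE.
rewrite (_ : (fun _ => _) = f) // diff_lin //.
exact: coord_continuous.
Qed.

(** Along with the derivatives of a rapidly decreasing function of the squared
    distance, products with coordinates appear: this class is stable under
    partial derivation, and consists of rapidly decreasing functions. *)
Inductive radial_class (F : nat -> R -> R) (z : rV) : (rV -> R) -> Prop :=
| radial_base k : radial_class F z (fun x => F k (enorm (x - z) ^+ 2))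
| radial_coord (i : 'I_n) f : radial_class F z f -> radial_class F z (fun x => x 0 i * f x)
| radial_scale c f : radial_class F z f -> radial_class F z (fun x => c * f x)
| radial_add f g : radial_class F z f -> radial_class F z g ->
    radial_class F z (fun x => f x + g x).

Variables (F : nat -> R -> R) (z : rV).
Hypothesis F_derive : forall (k : nat) (r : R), is_derive r 1 (F k) (F k.+1 r).
Hypothesis F_decay : forall k N, exists M : R, forall r, 0 <= r ->
  r ^+ N * `|F k r| <= M.

Let sqdist (x : rV) : R := enorm (x - z) ^+ 2.

Let sqdistE : sqdist = \sum_(j < n) (fun x : rV => (x 0 j - z 0 j)) ^+ 2.
Proof.
apply/funext => x; rewrite /sqdist sqr_enorm fct_sumE.
by apply: eq_bigr => j _; rewrite !mxE.
Qed.

Let is_derive_sqdist (x : rV) (i : 'I_n) :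
  is_derive x (delta_mx 0 i) sqdist (2 * (x 0 i - z 0 i)).
Proof.
have h (j : 'I_n) : is_derive x (delta_mx 0 i)
    ((fun x : rV => (x 0 j - z 0 j)) ^+ 2) ((2 * (x 0 j - z 0 j)) * (i == j)%:R).
  have := @is_deriveX R rV (fun x : rV => (x 0 j - z 0 j)) 2 x (delta_mx 0 i) (i == j)%:R.
  rewrite expr1; apply.
  have := is_deriveB (is_derive_coord x (delta_mx 0 i) j) (is_derive_cst (z 0 j) x (delta_mx 0 i)).
  by rewrite subr0 mxE eqxx/= eq_sym.
have := is_derive_sum h; rewrite -sqdistE (bigD1 i)//= eqxx mulr1 big1 ?addr0//.
by move=> j /negPf; rewrite eq_sym => ->; rewrite mulr0.
Qed.

Let differentiable_sqdist (x : rV) : differentiable sqdist x.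
Proof.
rewrite sqdistE; apply: differentiable_sum => j.
apply: differentiableX; apply: differentiableB => //.
exact: differentiable_coord.
Qed.

Lemma radial_class_differentiable f : radial_class F z f ->
  forall x, differentiable f x.
Proof.
elim => [k|i {}f _ df|c {}f _ df|{}f g _ df _ dg] x.
- apply: (@differentiable_comp _ _ _ _ sqdist (F k)); first exact: differentiable_sqdist.
  by apply/derivable1_diffP; have h := F_derive k (sqdist x); exact: ex_derive.
- by apply: differentiableM => //; exact: differentiable_coord.
- exact: differentiableZ.
- exact: differentiableD.
Qed.

Lemma radial_class_partial f i : radial_class F z f -> radial_class F z (partial i f).
Proof.
move=> cf; have := cf.
elim: cf => [k|j {}f cf IH|c {}f cf IH|{}f g cf IHf cg IHg] _.
- have -> : partial i (fun x => F k (enorm (x - z) ^+ 2)) =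
    (fun x => 2 * (x 0 i * F k.+1 (enorm (x - z) ^+ 2)) +
      (- (2 * z 0 i)) * F k.+1 (enorm (x - z) ^+ 2)).
    apply/funext => x; rewrite /partial.
    have dF : differentiable (F k) (sqdist x).
      by apply/derivable1_diffP; have h := F_derive k (sqdist x); exact: ex_derive.
    rewrite -[fun x => _]/(F k \o sqdist) deriveE; last first.
      exact: differentiable_comp.
    rewrite diff_comp//= [X in X _ = _]diff1E// -deriveE//.
    have -> : 'D_(delta_mx 0 i) sqdist x = 2 * (x 0 i - z 0 i).
      by have h := is_derive_sqdist x i; exact: derive_val.
    have -> : (F k)^`()%classic (sqdist x) = F k.+1 (sqdist x).
      by rewrite derive1E; have h := F_derive k (sqdist x); exact: derive_val.
    by rewrite /GRing.scale/= /sqdist; ring.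
  by apply: radial_add; apply: radial_scale; [apply: radial_coord|]; exact: radial_base.
- have -> : partial i (fun x => x 0 j * f x) =
    (fun x => (i == j)%:R * f x + x 0 j * partial i f x).
    apply/funext => x; rewrite /partial.
    rewrite (deriveM (diff_derivable (differentiable_coord x 0 j))
      (diff_derivable (radial_class_differentiable cf x))).
    have -> : 'D_(delta_mx 0 i) (fun y : rV => y 0 j) x = (i == j)%:R.
      have h := is_derive_coord x (delta_mx 0 i) j.
      by rewrite derive_val mxE eqxx eq_sym.
    by rewrite /GRing.scale/= addrC mulrC.
  by apply: radial_add; [exact: radial_scale|apply: radial_coord; exact: IH].
- have -> : partial i (fun x => c * f x) = (fun x => c * partial i f x).
    apply/funext => x; rewrite /partial.
    exact: (deriveZ c (diff_derivable (radial_class_differentiable cf x))).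
  by apply: radial_scale; exact: IH.
- have -> : partial i (fun x => f x + g x) = (fun x => partial i f x + partial i g x).
    apply/funext => x; rewrite /partial.
    exact: (deriveD (diff_derivable (radial_class_differentiable cf x))
      (diff_derivable (radial_class_differentiable cg x))).
  by apply: radial_add; [exact: IHf|exact: IHg].
Qed.

Let F_decay1 k N : exists M : R, forall r, 0 <= r -> (1 + r) ^+ N * `|F k r| <= M.
Proof.
have [M0 h0] := F_decay k 0; have [M hM] := F_decay k N.
exists (2 ^+ N * (M0 + M)) => r r0.
apply: (@le_trans _ _ (2 ^+ N * (1 + r ^+ N) * `|F k r|)).
  rewrite ler_wpM2r//; have [r1|r1] := leP r 1.
    apply: (@le_trans _ _ (2 ^+ N)); last by rewrite ler_peMr ?exprn_ge0// lerDl exprn_ge0.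
    by rewrite lerXn2r ?nnegrE ?addr_ge0//; lra.
  apply: (@le_trans _ _ (2 ^+ N * r ^+ N)); last first.
    by rewrite ler_wpM2l ?exprn_ge0// lerDr.
  rewrite -exprMn lerXn2r ?nnegrE ?addr_ge0 ?mulr_ge0//; lra.
rewrite -mulrA ler_wpM2l ?exprn_ge0// mulrDl lerD ?hM//.
by have := h0 r r0; rewrite expr0.
Qed.

Lemma radial_class_decay f : radial_class F z f ->
  forall beta : 'I_n -> nat, exists M : R, forall x : rV,
    `|(\prod_(i < n) x 0 i ^+ beta i) * f x| <= M.
Proof.
elim => [k|j {}f _ IH|c {}f _ IH|{}f g _ IHf _ IHg] beta.
- pose N := (\sum_(i < n) beta i)%N; have [M hM] := F_decay1 k N.
  exists ((1 + enorm z) ^+ N * M) => x; rewrite normrM.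
  have r0 : 0 <= enorm (x - z) ^+ 2 by rewrite exprn_ge0// enorm_ge0.
  apply: (@le_trans _ _ (((1 + enorm z) * (1 + enorm (x - z) ^+ 2)) ^+ N
      * `|F k (enorm (x - z) ^+ 2)|)); last first.
    rewrite exprMn -mulrA ler_wpM2l ?hM//.
    by rewrite exprn_ge0// addr_ge0// enorm_ge0.
  rewrite ler_wpM2r// normr_prod /N expr_sum; apply: ler_prod => i _.
  rewrite normr_ge0/= normrX lerXn2r ?nnegrE//.
    by rewrite mulr_ge0// addr_ge0// enorm_ge0.
  have := enorm_triangle (x - z) z; rewrite subrK => tri.
  apply: (le_trans (coord_le_enorm x i)); apply: (le_trans tri).
  have ez := enorm_ge0 z; have exz := enorm_ge0 (x - z).
  have : 0 <= (enorm (x - z) - 1) ^+ 2 by exact: sqr_ge0.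
  have : 0 <= enorm z * enorm (x - z) ^+ 2 by rewrite mulr_ge0// exprn_ge0.
  by rewrite !expr2; nra.
- have [M hM] := IH (fun i => beta i + (i == j))%N; exists M => x.
  apply: le_trans (hM x); rewrite mulrA le_eqVlt; apply/orP; left; apply/eqP.
  congr (`|_ * _|).
  rewrite (bigD1 j)//= [in RHS](bigD1 j)//= eqxx addn1 exprSr mulrAC.
  congr (_ * _).
  by apply: eq_bigr => i /negPf ->; rewrite addn0.
- have [M hM] := IH beta; exists (`|c| * M) => x.
  by rewrite mulrCA normrM ler_wpM2l.
- have [M hM] := IHf beta; have [M' hM'] := IHg beta; exists (M + M') => x.
  by rewrite mulrDr (le_trans (ler_normD _ _))// lerD.
Qed.

Lemma radial_class_schwartz f : radial_class F z f -> schwartz f.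
Proof.
move=> cf; have cs s : radial_class F z (partials s f).
  by elim: s => //= i s IH; exact: radial_class_partial.
split => [s x|beta s]; first exact: radial_class_differentiable.
exact: radial_class_decay.
Qed.

End laplace_schwartz.

(** * The capacity of balls *)

Section ball_capacity.
Context {R : realType}.
Local Notation leb := (@lebesgue_measure R).
Local Notation rV n := 'rV[R]_n.
Local Notation lebn n := (lebesgue_rV R n).
Implicit Types (b r rho c : R).
Variables (n : nat) (alpha p : R).
Hypotheses (n0 : (0 < n)%N) (a0 : 0 < alpha) (an : alpha < n%:R) (p0 : 1 < p).

Let nu := (n%:R - alpha) / 2.

Let nu0 : 0 < nu. Proof. by rewrite divr_gt0 ?subr_gt0. Qed.

Let n2nu : 0 < n%:R / 2 - nu.
Proof. by rewrite -mulrBl opprB addrCA subrr addr0 divr_gt0. Qed.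

Let n2nuE : n%:R - 2 * nu = alpha. Proof. by rewrite /nu; field. Qed.

(** The capacity of a ball of radius [r], up to constants. *)
Definition cap_scale (m : nat) (al q r : R) : R :=
  if r < 1 then r `^ (m%:R - al * q) else r ^+ m.

Lemma Psi_alphaE (Psi : R -> R) r :
  Psi_alpha n alpha p Psi r = Psi (cap_scale n alpha p r).
Proof. by rewrite /Psi_alpha /cap_scale; case: ifP. Qed.

Lemma cap_scaleE r : 0 < r ->
  cap_scale n alpha p r = Num.min r 1 `^ (- (alpha * p)) * r ^+ n.
Proof.
move=> r0; rewrite /cap_scale; case: (ltP r 1) => r1; last by rewrite powR1 mul1r.
rewrite -[in RHS]powR_mulrn ?ltW// -powRD; last by rewrite (gt_eqF r0) implybT.
by rewrite addrC.
Qed.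

Lemma cap_scale_gt0 r : 0 < r -> 0 < cap_scale n alpha p r.
Proof.
by move=> r0; rewrite cap_scaleE// mulr_gt0 ?exprn_gt0 ?powR_gt0// lt_min r0 ltr01.
Qed.

Lemma conv_rate_gt0 b s : 0 < b -> 0 < conv_rate b s.
Proof.
move=> b0; apply: divr_gt0; last exact/heat_rateD_gt0/ltW.
by apply: mulr_gt0 => //; exact: heat_rate_gt0.
Qed.

(** The inverse rate 1/b + 2 e^s grows exponentially in [s], which the weight
    absorbs. *)
Lemma conv_moments b (N : nat) : 0 < b ->
  (\int[leb]_s (conv_weight nu n b s * conv_rate b s ^- N)%:E < +oo)%E.
Proof.
move=> b0; have [C C0 hC] := double_expR_decay N n2nu.
have [I I0 hI] := integral_le_expR_abs n2nu.
pose K := Num.sqrt (2 * pi) ^+ n * (b^-1 + 2) ^+ N * C.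
have q0 : 0 <= Num.sqrt (2 * pi) ^+ n :> R by rewrite exprn_ge0 ?sqrtr_ge0.
have bi0 : 0 <= b^-1 by rewrite invr_ge0 ltW.
have bN0 : 0 <= (b^-1 + 2) ^+ N by rewrite exprn_ge0// addr_ge0.
apply: (@le_lt_trans _ _ (K * I)%:E); last by rewrite ltry.
apply: hI => [|s]; first by rewrite !mulr_ge0 ?(ltW C0).
have l0 := conv_rate_gt0 s b0.
rewrite mulr_ge0 ?conv_weight_ge0 ?invr_ge0 ?exprn_ge0 ?(ltW l0)//=.
have lE : (conv_rate b s)^-1 <= (b^-1 + 2) * (1 + expR s).
  rewrite (_ : _^-1 = b^-1 + 2 * expR s).
    have : 0 <= b^-1 * expR s by rewrite mulr_ge0 ?expR_ge0.
    by rewrite mulrDl !mulrDr !mulr1; lra.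
  rewrite /conv_rate /heat_rate expRN; field.
  by rewrite !gt_eqF ?expR_gt0// addr_gt0 ?mulr_gt0 ?expR_gt0.
have wle : conv_weight nu n b s <=
    Num.sqrt (2 * pi) ^+ n * expR (- (expR s / 2) + (n%:R / 2 - nu) * s).
  apply: (@le_trans _ _ (mix_weight nu s * (Num.sqrt (2 * pi) * expR (s / 2)) ^+ n)).
    rewrite ler_wpM2l ?(ltW (mix_weight_gt0 nu s))//.
    by rewrite lerXn2r ?nnegrE ?sqrtr_ge0 ?mulr_ge0 ?expR_ge0 ?(gauss_mass_le s (ltW b0)).
  rewrite exprMn expR_half_exprn mulrCA; apply: ler_wpM2l => //.
  rewrite /mix_weight mulrAC -expRD.
  rewrite ler_pdivrMr// (_ : - _ - _ + _ = - (expR s / 2) + (n%:R / 2 - nu) * s); last by ring.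
  by rewrite ler_peMr ?expR_ge0//; lra.
rewrite -exprVn.
apply: (@le_trans _ _ (Num.sqrt (2 * pi) ^+ n * expR (- (expR s / 2) + (n%:R / 2 - nu) * s) *
   ((b^-1 + 2) * (1 + expR s)) ^+ N)).
  apply: ler_pM => //; first exact: conv_weight_ge0.
    by rewrite exprn_ge0// invr_ge0 ltW.
  rewrite lerXn2r ?nnegrE ?invr_ge0 ?(ltW l0)//.
  by rewrite mulr_ge0 ?addr_ge0 ?expR_ge0.
rewrite exprMn /K.
rewrite (_ : _ * _ * _ = Num.sqrt (2 * pi) ^+ n * (b^-1 + 2) ^+ N *
  (expR (- (expR s / 2) + (n%:R / 2 - nu) * s) * (1 + expR s) ^+ N)); last by ring.
by rewrite -[leRHS]mulrA ler_wpM2l ?hC// mulr_ge0.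
Qed.

Let L b := laplace leb (conv_weight nu n b) (conv_rate b).

Let LE b r : 0 < b -> (L b 0 r)%:E =
  (\int[leb]_s (conv_weight nu n b s * expR (- (conv_rate b s * r)))%:E)%E.
Proof.
move=> b0; rewrite /L /laplace /Rintegral fineK.
  by apply: eq_integral => s _; rewrite /laplace_term expr0 mulr1.
apply: integrable_fin_num => //; apply: (@integrable_laplace_term _ _ _ _ _ _ b).
- by apply: measurable_conv_weight; exact: ltW.
- by apply: measurable_conv_rate; exact: ltW.
- by move=> s; exact: conv_weight_ge0.
- by move=> s; exact: conv_rate_gt0.
- by move=> s; apply: conv_rate_le; exact: ltW.
- by move=> N; exact: conv_moments.
Qed.

Let L_schwartz b (z : rV n) : 0 < b -> schwartz (fun x : rV n => L b 0 (enorm (x - z) ^+ 2)).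
Proof.
move=> b0.
have mw := @measurable_conv_weight R nu n b (ltW b0).
have ml := @measurable_conv_rate R b (ltW b0).
have w0 s : 0 <= conv_weight nu n b s by exact: conv_weight_ge0.
have l0 s : 0 < conv_rate b s by exact: conv_rate_gt0.
have lb s : conv_rate b s <= b by exact/conv_rate_le/ltW.
have mom N := conv_moments N b0.
apply: (@radial_class_schwartz _ _ (L b) z); last exact: radial_base.
- by move=> k r; exact: (is_derive_laplace (mu := leb) mw ml w0 l0 lb mom).
- by move=> k N; exact: (laplace_decay (mu := leb) mw ml w0 l0 lb mom).
Qed.

Lemma schwartz_scale (f : rV n -> R) c : schwartz f -> schwartz (fun x => c * f x).
Proof.
move=> [df bf].
have pE s : partials s (fun x => c * f x) = (fun x => c * partials s f x).
  elim: s => //= i s ->; apply/funext => x; rewrite /partial.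
  exact: (deriveZ c (diff_derivable (df s x))).
split=> [s x|beta s]; rewrite pE; first exact: differentiableZ.
have [M hM] := bf beta s; exists (`|c| * M) => x.
by rewrite mulrCA normrM ler_wpM2l.
Qed.

(** Test function: the potential of a Gaussian of width [r], normalised. *)
Lemma bessel_cap_ball : exists2 C, 0 < C & forall (z : rV n) r, 0 < r ->
  (bessel_cap alpha p (eball z r) <= (C * cap_scale n alpha p r)%:E)%E.
Proof.
have [c c0 hc] := conv_mass_ge n nu0.
pose C := c^-1 `^ p * Num.sqrt (pi / p) ^+ n.
have pp0 : 0 < p by rewrite (lt_trans ltr01).
exists C => [|z r r0].
  by rewrite mulr_gt0 ?powR_gt0 ?exprn_gt0 ?sqrtr_gt0 ?divr_gt0 ?pi_gt0// invr_gt0.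
pose m := Num.min r 1; have m0 : 0 < m by rewrite lt_min r0 ltr01.
pose A := (c * m `^ alpha)^-1; have A0 : 0 < A by rewrite invr_gt0 mulr_gt0 ?powR_gt0.
pose b := r ^- 2; have b0 : 0 < b by rewrite invr_gt0 exprn_gt0.
pose f (x : rV n) := A * L b 0 (enorm (x - z) ^+ 2).
pose g (y : borel (rV n)) := A * expR (- (b * enorm ((y : rV n) - z) ^+ 2)).
have mg : measurable_fun [set: borel (rV n)] g.
  apply: measurable_funM => //; apply: (measurableT_comp (@measurable_expR R)).
  apply: measurable_funN; apply: measurable_funM => //; apply: measurable_funX.
  by apply: (@measurable_enorm_sub _ _ _ _ id (cst z)).
have L0 x : 0 <= L b 0 x.
  by rewrite -lee_fin LE//; apply: integral_ge0 => s _; rewrite lee_fin mulr_ge0 ?conv_weight_ge0 ?expR_ge0.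
have gp : (\int[lebn n]_y (`|(EFin \o g) y| `^ p) = (C * cap_scale n alpha p r)%:E)%E.
  have pb0 : 0 < p * b by rewrite mulr_gt0.
  under eq_integral => y _.
    rewrite /= ger0_norm ?mulr_ge0 ?expR_ge0 ?(ltW A0)// powRM ?expR_ge0 ?(ltW A0)//.
    rewrite [expR _ `^ p]/powR gt_eqF ?expR_gt0// expRK.
    rewrite (_ : p * _ = - (p * b * enorm (z - (y : rV n)) ^+ 2 + 0 * enorm ((y : rV n) - z) ^+ 2));
      last by rewrite (enorm_sub_sym z); ring.
    rewrite EFinM; over.
  rewrite ge0_integralZl//=; last 2 first.
  - apply/measurable_EFinP; apply: (measurableT_comp (@measurable_expR R)).
    apply: measurable_funN; apply: measurable_funD; apply: measurable_funM => //;
      apply: measurable_funX.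
    + by apply: (@measurable_enorm_sub _ _ _ _ (cst z) id).
    + by apply: (@measurable_enorm_sub _ _ _ _ id (cst z)).
  - by rewrite lee_fin powR_ge0.
  rewrite integral_gauss_conv_rV// subrr enorm0 expr0n/= mulr0 oppr0 expR0 mulr1 addr0.
  rewrite -EFinM; congr EFin; rewrite cap_scaleE// -/m /C /A.
  rewrite invfM powRM ?invr_ge0 ?powR_ge0 ?(ltW c0)//.
  have -> : ((m `^ alpha)^-1) `^ p = m `^ (- (alpha * p)).
    by rewrite -powRN -powRrM mulNr.
  have -> : pi / (p * b) = pi / p * r ^+ 2.
    by rewrite /b; field; rewrite !gt_eqF.
  rewrite sqrtrM ?divr_ge0 ?pi_ge0 ?(ltW pp0)// sqrtr_sqr (gtr0_norm r0) exprMn.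
  ring.
have fE x : (f x)%:E = (\int[lebn n]_y (bessel_kernel alpha (x - (y : rV n)) * g y)%:E)%E.
  under eq_integral do rewrite /g mulrCA EFinM.
  rewrite ge0_integralZl//=; last 3 first.
  - apply/measurable_EFinP/measurable_funM.
      apply: (measurableT_comp (measurable_bessel_kernel an)).
      by apply: (@measurable_rV_sub _ _ _ _ (cst x) id).
    apply: (measurableT_comp (@measurable_expR R)).
    apply: measurable_funN; apply: measurable_funM => //; apply: measurable_funX.
    by apply: (@measurable_enorm_sub _ _ _ _ id (cst z)).
  - by move=> y _; rewrite lee_fin mulr_ge0 ?expR_ge0 ?bessel_kernel_ge0.
  - by rewrite lee_fin ltW.
  by rewrite bessel_kernel_gauss ?(ltW b0)// -/nu EFinM LE.
have normg : ('N[lebn n]_p%:E[EFin \o g] `^ p = (C * cap_scale n alpha p r)%:E)%E.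
  by rewrite poweR_Lnorm ?gt_eqF.
apply: ge_ereal_inf; exists (bessel_norm alpha p f `^ p)%E.
  exists f => //; split.
  - exact/schwartz_scale/L_schwartz.
  - by move=> x; rewrite /f mulr_ge0// ltW.
  - move=> x xz; have xr : 0 <= enorm (x - z) <= r by rewrite enorm_ge0/= ltW.
    have := hc r _ r0 xr; rewrite -/b -LE// lee_fin n2nuE -/m => h.
    by rewrite /f /A mulrC ler_pdivlMr ?mulr_gt0 ?powR_gt0// mul1r.
rewrite -normg; apply: gt0_ler_poweR; first exact: ltW.
- by rewrite in_itv/= leey andbT; apply: le_ereal_inf_tmp => _ [h _ <-]; exact: Lnorm_ge0.
- by rewrite in_itv/= leey andbT Lnorm_ge0.
apply: ereal_inf_lbound; exists g => //; split.
  rewrite inE; apply/andP; split; first by rewrite inE/=.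
  rewrite inE/= /finite_norm.
  by apply: (@lty_poweRy _ _ p); rewrite ?gt_eqF// normg ltry.
by apply: aeW => x; rewrite fE.
Qed.

End ball_capacity.

(** * Tents *)

Section tents.
Context {R : realType} (n : nat).
Local Notation rV := 'rV[R]_n.
Implicit Types (x y z : rV) (r t : R) (O : set rV).

Lemma open_eball x r : open (eball x r).
Proof.
have -> : eball x r = (fun y : rV => enorm (y - x)) @^-1` [set s | s < r] by [].
apply: open_comp; last exact: open_lt.
move=> y _; apply: (@continuous_comp _ _ _ (fun y : rV => y - x) (@enorm R n)).
  by apply: (@continuousB R rV rV id (cst x) y); [exact: cvg_id|exact: cst_continuous].
exact: continuous_enorm.
Qed.

Lemma eball_center x r : 0 < r -> eball x r x.
Proof. by rewrite /eball/= subrr enorm0. Qed.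

Lemma nbhs_eballP x (U : set rV) :
  nbhs x U -> exists2 d, 0 < d & eball x d `<=` U.
Proof.
move=> /nbhs_ballP[e /= e0 eU]; exists e => // y xy; apply: eU; split => // i j.
rewrite (ord1 i) /ball/= (le_lt_trans _ xy)// distrC.
by have := coord_le_enorm (y - x) j; rewrite !mxE.
Qed.

Lemma open_eball_sub O x : open O -> O x -> exists2 d, 0 < d & eball x d `<=` O.
Proof. by move=> oO Ox; apply: nbhs_eballP; exact: open_nbhs_nbhs. Qed.

Lemma boundary_open O z : open O -> boundary O z -> ~ O z.
Proof. by move=> /interior_id oO; rewrite /boundary oO => -[]. Qed.

(** The last point of O on a segment leaving O is a boundary point. *)
Lemma segment_boundary O x z : open O -> O x -> ~ O z ->
  exists2 w, boundary O w & enorm (x - w) <= enorm (x - z).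
Proof.
move=> oO Ox Oz; pose g (s : R) : rV := x + s *: (z - x).
have gE s s' : enorm (g s - g s') = `|s - s'| * enorm (z - x).
  rewrite /g opprD addrACA subrr add0r -scalerBl /enorm -(sqrtr_sqr (s - s')) -sqrtrM ?sqr_ge0//.
  rewrite mulr_sumr; congr Num.sqrt; apply: eq_bigr => i _.
  by rewrite !mxE exprMn.
pose D := enorm (z - x) + 1.
have D0 : 0 < D by rewrite ltr_wpDl// enorm_ge0.
have gD s s' d : `|s - s'| < d / D -> eball (g s') d (g s).
  rewrite ltr_pdivlMr// => h; rewrite /eball/= gE (le_lt_trans _ h)//.
  by rewrite ler_wpM2l// lerDl.
pose S := [set s : R | 0 <= s <= 1 /\ O (g s)].
have g0 : g 0 = x by rewrite /g scale0r addr0.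
have S0 : S 0 by split; rewrite ?lexx ?ler01// g0.
have hS : has_sup S.
  by split; [exists 0|exists 1 => s [/andP[]]].
pose sg := sup S.
have sg0 : 0 <= sg by apply: ub_le_sup S0; exact: hS.2.
have sg1 : sg <= 1 by apply: ge_sup; [exists 0|move=> s [/andP[]]].
exists (g sg); last first.
  have -> : enorm (x - g sg) = sg * enorm (z - x).
    by have := gE 0 sg; rewrite g0 sub0r normrN ger0_norm.
  by rewrite (enorm_sub_sym x) ler_piMl// enorm_ge0.
have iO := oO; move/interior_id: iO => iO; rewrite /boundary iO; split.
  move=> U /nbhs_eballP[d d0 dU].
  have dD : 0 < d / D by rewrite divr_gt0.
  have [s Ss ss] := sup_adherent dD hS.
  exists (g s); split; first by case: Ss.
  apply/dU/gD; rewrite ler0_norm; last by rewrite subr_le0 ub_le_sup//; exact: hS.2.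
  by move: ss; rewrite -/sg; lra.
move=> Ow; have [d d0 dO] := open_eball_sub oO Ow.
have sgl : sg < 1.
  rewrite lt_neqAle sg1 andbT; apply: contra_not_neq Oz => sgE.
  by move: Ow; rewrite sgE /g scale1r addrC subrK.
have dD : 0 < d / D by rewrite divr_gt0.
pose e := Num.min (1 - sg) (d / D / 2).
have e0 : 0 < e by rewrite lt_min subr_gt0 sgl divr_gt0.
have eU1 : e <= 1 - sg by rewrite ge_min lexx.
have eU2 : e <= d / D / 2 by rewrite ge_min lexx orbT.
have : S (sg + e).
  split; first by apply/andP; split; [rewrite addr_ge0// ltW|lra].
  by apply/dO/gD; rewrite addrC addKr gtr0_norm//; lra.
move=> /(ub_le_sup hS.2); rewrite -/sg; lra.
Qed.

(** Otherwise a segment leaving O inside the ball would meet the boundary too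
    close to the centre. *)
Lemma tent_eball O (q : half_space R n) : open O -> tent O q ->
  eball (set_val q).1 (set_val q).2 `<=` O.
Proof.
move=> oO [Ox tx] z xz; apply: contrapT => Oz.
have [w bw xw] := segment_boundary oO Ox Oz.
suff : ((set_val q).2 < (set_val q).2)%R by rewrite ltxx.
apply: le_lt_trans xz; rewrite enorm_sub_sym in xw *.
rewrite -lee_fin; apply: (le_trans (ltW tx)).
apply: (@le_trans _ _ (enorm ((set_val q).1 - w))%:E).
  by apply: ereal_inf_lbound; exists w.
by rewrite lee_fin enorm_sub_sym (le_trans _ xw)// enorm_sub_sym.
Qed.

(** Boundary points of an open ball lie outside it, so the triangle inequality
    bounds their distance from below. *)
Lemma sub_tent_eball y r (q : half_space R n) :
  enorm ((set_val q).1 - y) + (set_val q).2 < r -> tent (eball y r) q.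
Proof.
have q0 : 0 < (set_val q).2 by have := set_valP q.
move=> h; split; first by rewrite /eball/=; lra.
apply: (@lt_le_trans _ _ (r - enorm ((set_val q).1 - y))%:E).
  by rewrite lte_fin; lra.
apply: le_ereal_inf_tmp => _ [w /(boundary_open (@open_eball y r)) wr <-].
rewrite lee_fin; have wy : r <= enorm (w - y) by rewrite leNgt; apply/negP.
have := enorm_dist_triangle w (set_val q).1 y.
by rewrite (enorm_sub_sym w (set_val q).1); lra.
Qed.

Lemma open_tent O : open O -> open (tent O).
Proof.
move=> oO; pose W : set (rV * R) :=
  [set q | O q.1 /\ (q.2%:E < edist_to q.1 (boundary O))%E].
suff oW : open W.
  rewrite (_ : tent O = set_val @^-1` W)//; apply: open_comp => // q _.
  exact: initial_continuous.
rewrite openE => -[x t] [/= Ox tx].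
have [d d0 dO] := open_eball_sub oO Ox.
have [e e0 eh] : exists2 e : R, 0 < e & ((t + e *+ 2)%:E <= edist_to x (boundary O))%E.
  move: tx; case: (edist_to x (boundary O)) => // [k|_]; last by exists 1 => //; rewrite leey.
  rewrite lte_fin => tk; exists ((k - t) / 2); first by rewrite divr_gt0// subr_gt0.
  by rewrite lee_fin mulr2n; lra.
exists (eball x (Num.min d e), [set s | s < t + e]) => /=.
  split; first by apply: open_nbhs_nbhs; split; [exact: open_eball|apply: eball_center; rewrite lt_min d0].
  by apply: open_nbhs_nbhs; split; [exact: open_lt|rewrite /= ltrDl].
move=> [y s] [/= xy st]; move: xy; rewrite /eball/= lt_min => /andP[xd xe].
split; first exact: dO.
apply: (@lt_le_trans _ _ (t + e)%:E); first by rewrite lte_fin.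
apply: le_ereal_inf_tmp => _ [w bw <-]; rewrite lee_fin.
have : (edist_to x (boundary O) <= (enorm (x - w))%:E)%E.
  by apply: ereal_inf_lbound; exists w.
move=> /(le_trans eh); rewrite lee_fin mulr2n.
by have := enorm_dist_triangle x y w; rewrite (enorm_sub_sym x y) /=; lra.
Qed.

Lemma measurable_tent O : open O -> measurable (tent O : set (borel (half_space R n))).
Proof. by move=> oO; apply: sub_sigma_algebra; exact: open_tent. Qed.

Lemma measurable_half_fst :
  measurable_fun [set: borel (half_space R n)]
    (fun q : borel (half_space R n) => (set_val (q : half_space R n)).1 : borel rV).
Proof.
apply: measurable_fun_rV => i.
apply: (@measurable_borel_continuous R (half_space R n)) => q.
apply: (@continuous_comp _ _ _ (fun q : half_space R n => (set_val q).1)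
  (fun x : rV => x 0 i)); last exact: coord_continuous.
apply: (@continuous_comp _ _ _ (set_val : half_space R n -> _) fst).
  exact: initial_continuous.
exact: cvg_fst.
Qed.

Lemma measurable_half_snd :
  measurable_fun [set: borel (half_space R n)]
    (fun q : borel (half_space R n) => (set_val (q : half_space R n)).2).
Proof.
apply: (@measurable_borel_continuous R (half_space R n)) => q.
apply: (@continuous_comp _ _ _ (set_val : half_space R n -> _) snd).
  exact: initial_continuous.
exact: cvg_snd.
Qed.

End tents.

(** * The dual estimate at one scale *)

Section cones.
Context {R : realType} (n : nat).
Local Notation rV := 'rV[R]_n.
Local Notation half := (borel (half_space R n)).

(** The part of the tent over the ball of centre [y] and radius [s] that the
    dyadic sum over scales produces; unlike the tent it is given by a
    condition jointly measurable in the point and in [y]. *)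
Definition cone (s : R) (y : rV) : set (half_space R n) :=
  [set q | enorm ((set_val q).1 - y) + (set_val q).2 < s].

Lemma measurable_cone_indicator (r : R) :
  measurable_fun [set: half * borel rV] (fun q : half * borel rV =>
    (enorm ((set_val (q.1 : half_space R n)).1 - (q.2 : rV)) +
      (set_val (q.1 : half_space R n)).2 < r)%R%:R : R).
Proof.
apply: measurable_lt_natr => //; apply: measurable_funD.
  apply: (measurable_enorm_sub (f := fun q : half * borel rV => (set_val (q.1 : half_space R n)).1)
    (g := snd)); last exact: measurable_snd.
  exact: (measurableT_comp (@measurable_half_fst R n) measurable_fst).
exact: (measurableT_comp (@measurable_half_snd R n) measurable_fst).
Qed.

Lemma measurable_cone (r : R) y : measurable (cone r y : set half).
Proof.
have := measurable_fun_pair1 (y : borel rV) (measurable_cone_indicator r).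
move=> /(_ measurableT [set 1]); rewrite setTI => h.
rewrite (_ : cone r y = (fun q : half => (enorm ((set_val (q : half_space R n)).1 - y) +
      (set_val (q : half_space R n)).2 < r)%R%:R : R) @^-1` [set 1]).
  by apply: h; exact: measurable_set1.
apply/seteqP; split => q /=; rewrite /cone/=; first by move=> ->.
by case: (_ < r) => // /esym/eqP; rewrite oner_eq0.
Qed.

End cones.

Section one_scale.
Context {R : realType} (n : nat).
Local Notation rV := 'rV[R]_n.
Local Notation lebn := (lebesgue_rV R n).
Local Notation half := (borel (half_space R n)).
Variable lam : {finite_measure set half -> \bar R}.
Variables (p : R) (g : rV -> R) (N r B : R).
Hypotheses (p1 : 1 < p) (r0 : 0 < r) (B0 : 0 <= B).
Hypotheses (mg : measurable_fun [set: borel rV] (g : borel rV -> R))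
  (g0 : forall y, 0 <= g y)
  (gN : (\int[lebn]_y (g y `^ p)%:E = N%:E)%E).

Hypothesis lamB : forall y, (lam (cone r y : set half) <= B%:E)%E.

Let M := fine (lam [set: half]).

Let lamTE : lam [set: half] = M%:E.
Proof. by rewrite fineK// fin_num_measure. Qed.

Let M0 : 0 <= M. Proof. by rewrite fine_ge0. Qed.

Let ind (q : half * borel rV) : R :=
  (enorm ((set_val (q.1 : half_space R n)).1 - (q.2 : rV)) +
    (set_val (q.1 : half_space R n)).2 < r)%R%:R.

Let mind : measurable_fun [set: half * borel rV] ind.
Proof. exact: measurable_cone_indicator. Qed.

Let mcone y : measurable (cone r y : set half).
Proof. exact: measurable_cone. Qed.

Let l (y : borel rV) : R := fine (lam (cone r y : set half)).

Let l_ge0 y : 0 <= l y. Proof. by rewrite fine_ge0. Qed.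

Let lE (y : borel rV) : (\int[lam]_q (ind (q, y))%:E = (l y)%:E)%E.
Proof.
transitivity (\int[lam]_q (\1_(cone r y : set half) q)%:E)%E.
  apply: eq_integral => q _; rewrite indicE /ind; congr (_%:R%:E).
  by congr nat_of_bool; apply/idP/idP => h; [rewrite inE|rewrite inE in h].
by rewrite integral_indic// setIT /l fineK// fin_num_measure.
Qed.

Let ind_ge0 q : (0 <= (ind q)%:E)%E. Proof. by rewrite lee_fin. Qed.

Let ml : measurable_fun [set: borel rV] l.
Proof.
apply/measurable_EFinP; rewrite (_ : _ \o _ = fun y => (\int[lam]_q (ind (q, y))%:E)%E).
  apply: (measurable_fun_fubini_tonelli_G (fun q => (ind q)%:E)) => //.
  exact/measurable_EFinP.
by apply/funext => y; rewrite lE.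
Qed.

Let l_le y : l y <= B.
Proof. by rewrite -lee_fin fineK ?fin_num_measure. Qed.

(** A point lies in [cone r y] only when [y] is in the cube of radius [r] about
    its first component, so by Tonelli the masses of the cones add up to at
    most the volume of that cube times the total mass. *)
Let int_l : (\int[lebn]_y (l y)%:E <= (M * (2 * r) ^+ n)%:E)%E.
Proof.
under eq_integral do rewrite -lE.
rewrite -(fubini_tonelli (fun q => (ind q)%:E))//; last exact/measurable_EFinP.
apply: (@le_trans _ _ (\int[lam]_q ((2 * r) ^+ n)%:E)%E); last first.
  by rewrite integral_cst// [X in (_ * X)%E](_ : _ = M%:E)// -EFinM lee_fin mulrC.
apply: ge0_le_integral_lower => q _; first exact: integral_ge0.
pose x := (set_val (q : half_space R n)).1.
have mC := @measurable_cube R n x r.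
have <- : (\int[lebn]_y (\1_(cube x r : set (borel rV)) y)%:E = ((2 * r) ^+ n)%:E)%E.
  by rewrite integral_indic// setIT; exact: (lebesgue_cube x (ltW r0)).
apply: ge0_le_integral_lower => y _ //; rewrite lee_fin /ind/= indicE.
case: (ltP _ r) => // xr; rewrite mem_set// => i.
have q0 : 0 < (set_val (q : half_space R n)).2 by have := set_valP (q : half_space R n).
have := coord_le_enorm (x - (y : rV)) i; rewrite !mxE ler_norml.
by rewrite -/x in xr; lra.
Qed.

(** Hoelder, with the mass of cones estimated both by [B] and, on average, by
    the total mass. *)
Lemma one_scale_le :
  (\int[lam]_q \int[lebn]_y (g y * ind (q, y))%:E <=
   (N `^ p^-1 * (B `^ p^-1 * (M * (2 * r) ^+ n) `^ (1 - p^-1)))%:E)%E.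
Proof.
have p0 : 0 < p by rewrite (lt_trans ltr01).
pose p' := p / (p - 1).
have p'0 : 0 < p' by rewrite divr_gt0 ?subr_gt0.
have p'E : p'^-1 = 1 - p^-1 by rewrite /p'; field; rewrite subr_eq0 !gt_eqF.
have pp' : p^-1 + p'^-1 = 1 by rewrite p'E; ring.
rewrite (fubini_tonelli (fun q : half * borel rV => (g q.2 * ind q)%:E))//=; last 2 first.
- apply/measurable_EFinP; apply: measurable_funM => //.
  exact: (measurableT_comp mg measurable_snd).
- by move=> q; rewrite lee_fin mulr_ge0.
under eq_integral => y _.
  under eq_integral do rewrite EFinM.
  rewrite ge0_integralZl//=; last 2 first.
  - by apply/measurable_EFinP; exact: (measurable_fun_pair1 y mind).
  - by rewrite lee_fin.
  rewrite lE -EFinM.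
  over.
have -> : (\int[lebn]_y (g y * l y)%:E)%E = ('N[lebn]_1[EFin \o (g \* l)%R])%E.
  by rewrite Lnorm1; apply: eq_integral => y _; rewrite /= ger0_norm// mulr_ge0.
apply: (le_trans (hoelder _ mg ml p0 p'0 pp')).
rewrite [leRHS]EFinM; apply: lee_pmul; rewrite ?Lnorm_ge0//.
  rewrite unlock le_eqVlt; apply/orP; left; apply/eqP.
  by under eq_integral do rewrite /= ger0_norm//; rewrite gN poweR_EFin.
rewrite unlock -p'E.
have -> : B `^ p^-1 * (M * (2 * r) ^+ n) `^ p'^-1 = (B `^ (p' - 1) * (M * (2 * r) ^+ n)) `^ p'^-1.
  rewrite [RHS]powRM ?powR_ge0 ?mulr_ge0 ?exprn_ge0 ?mulr_ge0 ?(ltW r0)//.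
  rewrite -powRrM (_ : (p' - 1) / p' = p^-1)//.
  by rewrite mulrBl mul1r divff ?gt_eqF// p'E; ring.
rewrite -poweR_EFin; apply: gt0_ler_poweR.
- by rewrite invr_ge0 ltW.
- by rewrite in_itv/= leey andbT integral_ge0// => y _; rewrite poweR_ge0.
- by rewrite in_itv/= leey andbT lee_fin !mulr_ge0 ?powR_ge0 ?exprn_ge0 ?mulr_ge0 ?(ltW r0).
rewrite EFinM.
apply: (@le_trans _ _ ((B `^ (p' - 1))%:E * \int[lebn]_y (l y)%:E)%E); last first.
  by rewrite lee_wpmul2l// lee_fin powR_ge0.
rewrite -ge0_integralZl//; last 3 first.
- exact/measurable_EFinP.
- by move=> y _; rewrite lee_fin.
- by rewrite lee_fin powR_ge0.
apply: ge0_le_integral_lower => y _; first exact: poweR_ge0.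
rewrite /= ger0_norm// -EFinM lee_fin.
have p'1 : 0 <= p' - 1.
  have -> : p' - 1 = (p - 1)^-1 by rewrite /p'; field; rewrite subr_eq0 gt_eqF.
  by rewrite invr_ge0 subr_ge0 ltW.
rewrite -(mulr_powRB1 (l_ge0 y) p'0) mulrC ler_wpM2r//.
by rewrite ge0_ler_powR ?nnegrE.
Qed.

End one_scale.

(** * From the estimate on balls to the estimate on open sets *)

Section carleson.
Context {R : realType} (n : nat).
Local Notation rV := 'rV[R]_n.
Local Notation lebn := (lebesgue_rV R n).
Local Notation half := (borel (half_space R n)).
Variables (alpha p : R) (Psi : R -> R).
Hypotheses (n0 : (0 < n)%N) (a0 : 0 < alpha) (an : alpha < n%:R) (p1 : 1 < p)
  (apn : alpha * p < n%:R).
Hypotheses (Psi_gt0 : forall s, 0 < s -> 0 < Psi s) (Psi_0 : Psi 0 = 0)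
  (Psi_surj : forall v, 0 <= v -> exists2 s, 0 <= s & Psi s = v).
Hypothesis Psi_growth : forall c, 0 < c -> exists2 L, 0 < L &
  forall x y, 0 <= x -> 0 < y -> x <= c * y -> Psi x <= L * Psi y.
Hypothesis Psi_sum : forall k, 1 < k -> exists2 C, 0 < C &
  forall (u : nat -> R) s N,
  (forall j, 0 < u j) -> (forall j, k * u j <= u j.+1) -> 0 < s ->
  \sum_(j < N) (Num.min (Psi (u j)) (Psi s) / u j) `^ p^-1 <= C * (Psi s / s) `^ p^-1.

Let p0 : 0 < p. Proof. by rewrite (lt_trans ltr01). Qed.

Let Psi_ge0 s : 0 <= s -> 0 <= Psi s.
Proof. by rewrite le_eqVlt => /predU1P[<-|/Psi_gt0/ltW//]; rewrite Psi_0. Qed.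

Let u e j := cap_scale n alpha p (scale e j).

Let u_gt0 e j : 0 < e -> 0 < u e j.
Proof. by move=> e0; exact/cap_scale_gt0/scale_gt0. Qed.

Let u_step e j : 0 < e -> 2 `^ (n%:R - alpha * p) * u e j <= u e j.+1.
Proof.
move=> e0; have s0 := scale_gt0 j e0.
have sS : scale e j.+1 = 2 * scale e j by rewrite /scale exprS; ring.
rewrite /u !cap_scaleE ?scale_gt0// sS.
move: (scale e j) s0 => s s0; set k := - (alpha * p); rewrite exprMn.
have -> : 2 `^ (n%:R - alpha * p) = 2 `^ k * 2 ^+ n.
  by rewrite addrC powRD ?powR_mulrn// pnatr_eq0 implybT.
rewrite mulrACA.
apply: ler_wpM2r; first by rewrite mulr_ge0 ?exprn_ge0 ?(ltW s0).
have m0 : 0 < Num.min s 1 by rewrite lt_min s0 ltr01.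
have m20 : 0 < Num.min (2 * s) 1 by rewrite lt_min mulr_gt0 ?ltr01.
rewrite -powRM ?(ltW m0)// /k !powRN lef_pV2 ?posrE ?powR_gt0 ?mulr_gt0//.
rewrite ge0_ler_powR ?nnegrE ?mulr_ge0 ?(ltW m0) ?(ltW m20) ?(ltW a0) ?(ltW p0)//.
by rewrite minr_pMr// mulr1 le_min !ge_min lexx ler1n orbT.
Qed.

(** With m = min r 1 the kernel contributes m^alpha r^-n and Hoelder the power
    r^(n (1 - 1/p)) of a volume; their product is the power - 1/p of the
    capacity m^(- alpha p) r^n of a ball. *)
Let scale_exponents r (M B : R) : 0 < r -> 0 <= M -> 0 <= B ->
  kernel_scale n alpha r * (B `^ p^-1 * (M * (2 * r) ^+ n) `^ (1 - p^-1)) =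
  (2 ^+ n) `^ (1 - p^-1) * M `^ (1 - p^-1) * (B / cap_scale n alpha p r) `^ p^-1.
Proof.
move=> r0 M0 B0; rewrite cap_scaleE// /kernel_scale.
set m := Num.min r 1; have m0 : 0 < m by rewrite lt_min r0 ltr01.
have rn0 : 0 < r ^+ n by rewrite exprn_gt0.
have rV0 : 0 <= r ^- n by rewrite invr_ge0 ltW.
have -> : (B / (m `^ (- (alpha * p)) * r ^+ n)) `^ p^-1 =
    B `^ p^-1 * (m `^ alpha * (r ^- n) `^ p^-1).
  rewrite invfM -powRN opprK powRM ?mulr_ge0 ?powR_ge0//.
  by rewrite (powRM p^-1 (powR_ge0 _ _) rV0) -powRrM mulfK ?gt_eqF.
have -> : (M * (2 * r) ^+ n) `^ (1 - p^-1) =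
    M `^ (1 - p^-1) * ((2 ^+ n) `^ (1 - p^-1) * (r ^+ n) `^ (1 - p^-1)).
  by rewrite exprMn powRM ?mulr_ge0 ?exprn_ge0 ?(ltW r0)// powRM ?exprn_ge0 ?(ltW r0).
have -> : (r ^- n) `^ p^-1 = r ^- n * (r ^+ n) `^ (1 - p^-1).
  rewrite -(powR_inv1 (ltW rn0)) -powRrM -powRD; last by rewrite (gt_eqF rn0) implybT.
  by congr (_ `^ _); ring.
ring.
Qed.

(** Integrating the pointwise lower bound [potential_ge1_scales] against [lam]
    and applying [one_scale_le] at every scale bounds M = lam A by N^(1/p)
    M^(1 - 1/p) times a sum of (min (Psi u_j) M / u_j)^(1/p), where u_j is the
    capacity of a ball of the j-th radius. Writing M = Psi s0, the sum is
    at most a multiple of (M / s0)^(1/p); then M cancels and s0 is at most a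
    multiple of N. Finiteness of [lam] is what permits the cancellation. *)
Lemma finite_piece (cm : R) : 0 < cm -> exists2 C, 0 < C &
  forall (lam : {finite_measure set half -> \bar R}) (A : set half) e (g : rV -> R) N,
  0 < e -> measurable A -> lam [set: half] = lam A ->
  (forall y r, 0 < r -> (lam (cone r y : set half) <= (cm * Psi (cap_scale n alpha p r))%:E)%E) ->
  measurable_fun [set: borel rV] (g : borel rV -> R) -> (forall y, 0 <= g y) ->
  (\int[lebn]_y (g y `^ p)%:E = N%:E)%E ->
  (forall q : half, A q -> let x := (set_val (q : half_space R n)).1 in
    let t := (set_val (q : half_space R n)).2 in e <= t /\
    {ae lebn, forall z : borel rV, cube x (t / (2 * n%:R)) z ->
     (1 <= \int[lebn]_y (bessel_kernel alpha ((z : rV) - y) * g y)%:E)%E}) ->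
  (lam A <= (C * Psi N)%:E)%E.
Proof.
move=> cm0; have [C1 C10 hC1] := potential_ge1_scales n0 a0 an.
have k1 : 1 < 2 `^ (n%:R - alpha * p).
  by rewrite /powR pnatr_eq0/= -[ltLHS]expR0 ltr_expR mulr_gt0 ?subr_gt0 ?ln_gt0 ?ltr1n.
have [C2 C20 hC2] := Psi_sum k1.
pose K := Num.max cm 1; have K0 : 0 < K by rewrite lt_max ltr01 orbT.
pose D := (2 ^+ n) `^ (1 - p^-1).
have D0 : 0 < D by rewrite powR_gt0// exprn_gt0.
pose C3 := C1 * D * K `^ p^-1 * C2.
have C30 : 0 < C3 by rewrite !mulr_gt0 ?powR_gt0.
have C3p : 0 < C3 `^ p by rewrite powR_gt0.
have [L L0 hL] := Psi_growth C3p.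
exists L => // lam A e g N e0 mA lamT lamc mg g0 gN hA.
have N0 : 0 <= N by rewrite -lee_fin -gN integral_ge0// => y _; rewrite lee_fin powR_ge0.
pose M := fine (lam [set: half]).
have ME : lam A = M%:E by rewrite -lamT fineK// fin_num_measure.
have M0 : 0 <= M by rewrite fine_ge0.
rewrite ME lee_fin; have [->|M0'] := eqVneq M 0.
  by rewrite mulr_ge0 ?(ltW L0) ?Psi_ge0.
have {M0'}Mp : 0 < M by rewrite lt_def M0' M0.
have [s0 s00 hs0] := Psi_surj M0.
have {s00}s0p : 0 < s0.
  rewrite lt_def s00 andbT; apply: contraTneq Mp => s0E.
  by rewrite -hs0 s0E Psi_0 ltxx.
pose B j := K * Num.min (Psi (u e j)) M.
have B0 j : 0 <= B j.
  by rewrite mulr_ge0 ?(ltW K0)// le_min M0 Psi_ge0// ltW// u_gt0.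
have lamB j y : (lam (cone (scale e j) y : set half) <= (B j)%:E)%E.
  have h1 : (lam (cone (scale e j) y : set half) <= (K * Psi (u e j))%:E)%E.
    apply: (le_trans (lamc _ _ (scale_gt0 j e0))); rewrite lee_fin.
    by rewrite ler_wpM2r ?Psi_ge0 ?(ltW (u_gt0 j e0))// le_max lexx.
  have h2 : (lam (cone (scale e j) y : set half) <= (K * M)%:E)%E.
    apply: (@le_trans _ _ (lam [set: half])).
      by apply: le_measure; rewrite ?inE//; exact: measurable_cone.
    by rewrite lamT ME lee_fin ler_peMl// le_max lexx orbT.
  by rewrite /B; case: (leP (Psi (u e j)) M).
pose b j := C1 * kernel_scale n alpha (scale e j).
have b0 j : 0 <= b j.
  by apply: mulr_ge0; [exact: ltW|exact/kernel_scale_ge0/ltW/scale_gt0].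
pose T j : R := b j * (N `^ p^-1 * (B j `^ p^-1 * (M * (2 * scale e j) ^+ n) `^ (1 - p^-1))).
have T0 j : 0 <= T j by rewrite mulr_ge0// !mulr_ge0 ?powR_ge0.
pose F j (q : half) (y : borel rV) : \bar R := (b j * (g y *
   (enorm ((set_val (q : half_space R n)).1 - (y : rV)) +
      (set_val (q : half_space R n)).2 < scale e j)%R%:R))%:E.
have F0 j q y : (0 <= F j q y)%E by rewrite lee_fin mulr_ge0// mulr_ge0.
have mF j : measurable_fun setT (fun q : half * borel rV => F j q.1 q.2).
  apply/measurable_EFinP; apply: measurable_funM => //; apply: measurable_funM.
    exact: (measurableT_comp mg measurable_snd).
  exact: measurable_cone_indicator.
have intF j : (\int[lam]_q \int[lebn]_y F j q y <= (T j)%:E)%E.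
  rewrite /F; under eq_integral => q _.
    under eq_integral do rewrite EFinM.
    rewrite ge0_integralZl//=; last 3 first.
    - apply/measurable_EFinP; apply: measurable_funM => //.
      exact: (measurable_fun_pair2 q (measurable_cone_indicator _)).
    - by move=> y _; rewrite lee_fin mulr_ge0.
    - by rewrite lee_fin.
    over.
  rewrite ge0_integralZl//=; last 3 first.
  - have := @measurable_fun_fubini_tonelli_F _ _ half (borel rV) R lebn
      (fun q => (g q.2 * (enorm ((set_val (q.1 : half_space R n)).1 - (q.2 : rV)) +
      (set_val (q.1 : half_space R n)).2 < scale e j)%R%:R)%:E).
    apply => [|q]; last by rewrite lee_fin mulr_ge0.
    apply/measurable_EFinP; apply: measurable_funM.
      exact: (measurableT_comp mg measurable_snd).
    exact: measurable_cone_indicator.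
  - by move=> q _; apply: integral_ge0 => y _; rewrite lee_fin mulr_ge0.
  - by rewrite lee_fin.
  rewrite /T [leRHS]EFinM lee_wpmul2l ?lee_fin//.
  exact: (one_scale_le p1 (scale_gt0 j e0) (B0 j) mg g0 gN (lamB j)).
have sumT m : \sum_(j < m) T j <= C3 * N `^ p^-1 * (M * s0 `^ (- p^-1)).
  have TE j : T j = C1 * D * N `^ p^-1 * M `^ (1 - p^-1) * K `^ p^-1 *
      (Num.min (Psi (u e j)) (Psi s0) / u e j) `^ p^-1.
    have := scale_exponents (scale_gt0 j e0) M0 (B0 j) => h.
    rewrite /T /b -mulrA [X in C1 * X]mulrCA h -/(u e j) /B hs0 -[K * _ / _]mulrA.
    rewrite [(K * _) `^ _]powRM ?(ltW K0)//; last first.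
      by rewrite divr_ge0 ?(ltW (u_gt0 j e0))// le_min M0 Psi_ge0// ltW// u_gt0.
    by rewrite /D; ring.
  under eq_bigr do rewrite TE.
  rewrite -mulr_sumr; have h := hC2 (u e) s0 m (fun j => u_gt0 j e0) (fun j => u_step j e0) s0p.
  apply: (le_trans (ler_wpM2l _ h)); first by rewrite !mulr_ge0 ?powR_ge0 ?(ltW C10) ?(ltW D0).
  rewrite hs0 powRM ?invr_ge0 ?(ltW s0p)//.
  have -> : s0^-1 `^ p^-1 = s0 `^ (- p^-1).
    by rewrite -(powR_inv1 (ltW s0p)) -powRrM mulN1r.
  have MM : M `^ (1 - p^-1) * M `^ p^-1 = M.
    rewrite -powRD; last by rewrite (gt_eqF Mp) implybT.
    by rewrite subrK powRr1.
  rewrite -[in leRHS]MM /C3 le_eqVlt; apply/orP; left; apply/eqP; ring.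
have Mle : M <= C3 * N `^ p^-1 * (M * s0 `^ (- p^-1)).
  rewrite -lee_fin -ME.
  apply: (@le_trans _ _ (\int[lam]_(q in A) (\sum_(j <oo) \int[lebn]_y F j q y))%E).
    rewrite -[leLHS]mul1e -integral_cst//.
    apply: ge0_le_integral_lower => q Aq//.
    have [et aet] := hA q Aq.
    exact: (hC1 g e _ _ e0 et mg g0 aet).
  apply: (@le_trans _ _ (\int[lam]_q (\sum_(j <oo) \int[lebn]_y F j q y))%E).
    rewrite integral_mkcond; apply: ge0_le_integral_lower => q _; rewrite patchE;
      case: ifPn => // _; apply: nneseries_ge0 => j _ _; exact: integral_ge0.
  rewrite (integral_nneseries lam measurableT (f := fun j q => (\int[lebn]_y F j q y)%E)); last 2 first.
  - move=> j; exact: (measurable_fun_fubini_tonelli_F (fun q : half * borel rV => F j q.1 q.2)).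
  - by move=> j q _; exact: integral_ge0.
  apply: lime_le.
    apply: is_cvg_nneseries => j _ _; apply: integral_ge0 => q _; exact: integral_ge0.
  apply: nearW => m; rewrite big_mkord.
  apply: (@le_trans _ _ (\sum_(j < m) T j)%:E); last by rewrite lee_fin.
  by rewrite -sumEFin lee_sum.
have s0N : s0 <= C3 `^ p * N.
  have sp : 0 < s0 `^ p^-1 by rewrite powR_gt0.
  have : s0 `^ p^-1 <= C3 * N `^ p^-1.
    move: Mle; rewrite mulrCA -[leLHS]mulr1 ler_pM2l// powRN.
    by rewrite ler_pdivlMr// mul1r.
  move=> /(ge0_ler_powR (ltW p0)); rewrite !nnegrE (ltW sp) => /(_ isT).
  rewrite mulr_ge0 ?powR_ge0 ?(ltW C30)// => /(_ isT).
  rewrite powRM ?powR_ge0 ?(ltW C30)// -!powRrM mulVf ?gt_eqF// !powRr1//.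
  exact: ltW.
have Np : 0 < N by rewrite -(pmulr_rgt0 _ C3p) (lt_le_trans s0p).
by rewrite -hs0; apply: hL => //; exact: ltW.
Qed.

(** The constant of [finite_piece] does not depend on the piece, so the tent is
    exhausted by bounded pieces away from the boundary of the half-space. Such
    a piece lies in the tent over a ball and hence has finite measure. *)
Lemma carleson_estimate (cm : R) : 0 < cm -> exists2 C, 0 < C &
  forall (mu : @borel_measure R n) (O : set rV) (g : rV -> R) N,
  (forall x r, 0 < r ->
    (mu (tent (eball x r)) <= (cm * Psi (cap_scale n alpha p r))%:E)%E) ->
  open O -> measurable_fun [set: borel rV] (g : borel rV -> R) ->
  (forall y, 0 <= g y) -> (\int[lebn]_y (g y `^ p)%:E = N%:E)%E ->
  {ae lebn, forall z : borel rV, O z ->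
     (1 <= \int[lebn]_y (bessel_kernel alpha ((z : rV) - y) * g y)%:E)%E} ->
  (mu (tent O) <= (C * Psi N)%:E)%E.
Proof.
move=> cm0.
have [C C0 hC] := finite_piece cm0.
exists C => // mu O g N hmu oO mg g0 gN aeO.
pose A (k : nat) : set half := tent O `&` (cone k.+1%:R 0 `&`
  [set q | k.+1%:R^-1 <= (set_val (q : half_space R n)).2]).
have mA k : measurable (A k).
  apply: measurableI; first exact: measurable_tent.
  apply: measurableI; first exact: measurable_cone.
  rewrite -[X in measurable X]setTI.
  have := @measurable_half_snd R n measurableT `[k.+1%:R^-1, +oo[%classic.
  by rewrite set_itvcy; apply; rewrite -set_itvcy.
have tentE : tent O = \bigcup_k A k.
  apply/seteqP; split => [q Oq|q [k _ []]//].
  have t0 : 0 < (set_val q).2 by have := set_valP q.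
  pose a := enorm ((set_val q).1 - 0) + (set_val q).2 + (set_val q).2^-1.
  have a1 : 0 <= a by rewrite !addr_ge0 ?enorm_ge0 ?invr_ge0 ?ltW.
  exists (Num.bound a) => //; split => //.
  have ab : a < (Num.bound a).+1%:R.
    by rewrite (lt_le_trans (archi_boundP a1))// ler_nat.
  split; rewrite /cone/=.
    by apply: le_lt_trans ab; rewrite /a lerDl invr_ge0 ltW.
  rewrite -[leRHS]invrK lef_pV2 ?posrE ?invr_gt0// ltW//.
  by apply: le_lt_trans ab; rewrite /a lerDr addr_ge0 ?enorm_ge0 ?ltW.
have ndA : {homo A : k m / (k <= m)%N >-> (k <= m)%O}.
  move=> k m km; apply/subsetPset => q [Oq [kq tq]]; split => //.
  have km1 : k.+1%:R <= m.+1%:R :> R by rewrite ler_nat.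
  split; first by rewrite /cone/= (lt_le_trans kq).
  by rewrite /= (le_trans _ tq)// lef_pV2 ?posrE.
have := @nondecreasing_cvg_mu _ _ _ mu _ mA; rewrite -tentE.
move=> /(_ (measurable_tent oO) ndA) cvgA.
rewrite -(cvg_lim _ cvgA)//; apply: lime_le; first by apply/cvg_ex; eexists; exact: cvgA.
apply: nearW => k /=.
have Ay : (mu (A k) < +oo)%E.
  apply: (@le_lt_trans _ _ (mu (tent (eball 0 k.+1%:R)))).
    apply: le_measure; rewrite ?inE//; first by apply: measurable_tent; exact: open_eball.
    by move=> q [_ [qk _]]; exact: sub_tent_eball.
  by apply: le_lt_trans (hmu _ _ _) _; rewrite ?ltry.
have lamE (U : set half) : mfrestr (mA k) Ay U = mu (U `&` A k) by [].
have <- : mfrestr (mA k) Ay (A k) = mu (A k) by rewrite lamE setIid.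
apply: (hC (mfrestr (mA k) Ay : {finite_measure set half -> \bar R}) (A k) k.+1%:R^-1 g N) => //.
- by rewrite -[LHS]/(mu (setT `&` A k)) -[RHS]/(mu (A k `&` A k)) setTI setIid.
- move=> y r r0; rewrite -[X in (X <= _)%E]/(mu (cone r y `&` A k)).
  apply: le_trans (hmu y r r0).
  apply: le_measure; rewrite ?inE//.
  + by apply: measurableI => //; exact: measurable_cone.
  + by apply: measurable_tent; exact: open_eball.
  + by move=> q [qr _]; exact: sub_tent_eball.
- move=> q [Oq [_ tq]] x t; split => //.
  (* The cube of radius t / 2n lies in the ball of radius t, hence in O. *)
  have t0 : 0 < t by have := set_valP (q : half_space R n).
  apply: filterS aeO => z hz xz; apply: hz; apply: (tent_eball oO Oq).
  have t20 : 0 <= t / (2 * n%:R) by rewrite divr_ge0 ?mulr_ge0 ?(ltW t0).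
  rewrite /eball/= (le_lt_trans (cube_enorm t20 xz))// -/t.
  have -> : n%:R * (t / (2 * n%:R)) = t / 2 by field; rewrite pnatr_eq0 -lt0n.
  by lra.
Qed.

End carleson.

(** * The capacity of open sets and the theorem *)

Section capacity.
Context {R : realType} (n : nat).
Local Notation rV := 'rV[R]_n.
Local Notation lebn := (lebesgue_rV R n).
Variables (alpha p : R).
Hypotheses (n0 : (0 < n)%N) (an : alpha < n%:R) (p1 : 1 < p).

Let p0 : 0 < p. Proof. by rewrite (lt_trans ltr01). Qed.

Lemma bessel_norm_ge0 (f : rV -> R) : (0 <= bessel_norm alpha p f)%E.
Proof. by apply: le_ereal_inf_tmp => _ [h _ <-]; exact: Lnorm_ge0. Qed.

Lemma bessel_cap_ge0 (O : set rV) : (0 <= bessel_cap alpha p O)%E.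
Proof. by apply: le_ereal_inf_tmp => _ [f _ <-]; exact: poweR_ge0. Qed.

(** Taking absolute values of the density only increases the potential, so
    near-optimal densities may be assumed nonnegative. *)
Lemma bessel_cap_lt (O : set rV) (eta : R) : (bessel_cap alpha p O < eta%:E)%E ->
  exists (g : rV -> R) (N : R),
  [/\ measurable_fun [set: borel rV] (g : borel rV -> R), forall y, 0 <= g y,
    (\int[lebn]_y (g y `^ p)%:E = N%:E)%E, N <= eta &
    {ae lebn, forall z : borel rV, O z ->
     (1 <= \int[lebn]_y (bessel_kernel alpha ((z : rV) - y) * g y)%:E)%E}].
Proof.
move=> /ereal_inf_lt[_ [f [sf f0 f1] <-]] feta.
have eta0 : 0 < eta by rewrite -lte_fin (le_lt_trans _ feta)// poweR_ge0.
have etaE : eta%:E = ((eta `^ p^-1)%:E `^ p)%E.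
  by rewrite poweR_EFin -powRrM mulVf ?gt_eqF// powRr1// ltW.
have ninf : (bessel_norm alpha p f < (eta `^ p^-1)%:E)%E.
  rewrite ltNge; apply/negP => h; move: feta; rewrite ltNge => /negP; apply.
  rewrite etaE; apply: gt0_ler_poweR h; first exact: ltW.
    by rewrite in_itv/= leey andbT lee_fin powR_ge0.
  by rewrite in_itv/= leey andbT bessel_norm_ge0.
have [_ [g [gL gpot] <-] gn] := ereal_inf_lt ninf.
have mg : measurable_fun [set: borel rV] g.
  by move: gL; rewrite inE => /andP[+ _]; rewrite inE.
have gp : (\int[lebn]_y (`|g y| `^ p)%:E <= eta%:E)%E.
  have -> : (\int[lebn]_y (`|g y| `^ p)%:E = 'N[lebn]_p%:E[EFin \o g] `^ p)%E.
    by rewrite poweR_Lnorm ?gt_eqF.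
  rewrite etaE; apply: gt0_ler_poweR (ltW gn); first exact: ltW.
    by rewrite in_itv/= leey andbT Lnorm_ge0.
  by rewrite in_itv/= leey andbT lee_fin powR_ge0.
have gp0 : (0 <= \int[lebn]_y (`|g y| `^ p)%:E)%E.
  by apply: integral_ge0 => y _; rewrite lee_fin powR_ge0.
exists (fun y => `|g y|), (fine (\int[lebn]_y (`|g y| `^ p)%:E)%E); split => //.
- by apply: measurableT_comp.
- by rewrite fineK// ge0_fin_numE// (le_lt_trans gp)// ltry.
- by rewrite -lee_fin fineK// ge0_fin_numE// (le_lt_trans gp)// ltry.
have [Z [mZ Z0 hZ]] := gpot; exists Z; split => // z nz; apply: hZ => hz; apply: nz => Oz.
apply: (@le_trans _ _ `|(\int[lebn]_y (bessel_kernel alpha ((z : rV) - (y : rV)) * g y)%:E)%E|%E).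
  by rewrite hz abse_EFin lee_fin ger0_norm ?f0 ?f1.
apply: (le_trans (le_abse_integral _ measurableT _)).
  apply/measurable_EFinP; apply: measurable_funM => //.
  apply: (measurableT_comp (measurable_bessel_kernel an)).
  by apply: (@measurable_rV_sub _ _ _ _ (cst z) id).
rewrite le_eqVlt; apply/orP; left; apply/eqP; apply: eq_integral => y _.
by rewrite abse_EFin normrM ger0_norm ?bessel_kernel_ge0.
Qed.

End capacity.

Unset Implicit Arguments.

Theorem theorem3p1 (R : realType) (n : nat) (alpha p : R) (Psi : R -> R)
  (n_ge1 : (1 <= n)%N)
  (alpha_gt0 : 0 < alpha) (alpha_lt_n : alpha < n%:R)
  (p_gt1 : 1 < p) (p_lt : p < n%:R / alpha)
  (Psi_fun : set_fun `[0, +oo[ `[0, +oo[ Psi)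
  (Psi_surj : set_surj `[0, +oo[ `[0, +oo[ Psi)
  (Psi_gt0 : forall s : R, 0 < s -> 0 < Psi s)
  (Psi_incr : exists2 Phi : R -> R,
    {in `[0, +oo[ &, {homo Phi : x y / x < y}} &
    asymp_on `[0, +oo[ (EFin \o Psi) (EFin \o Phi))
  (Psi_0 : Psi 0 = 0)
  (Psi_scale : forall c : R, 0 < c ->
    asymp_on `]0, +oo[ (fun s : R => (Psi (c * s))%:E) (fun s : R => (Psi s)%:E))
  (Psi_int : lesssim_on `]0, +oo[
    (fun s : R => \int[lebesgue_measure]_(u in `]0%R, s[)
                ((Psi u / u) `^ p^-1 / u)%:E)%E
    (fun s : R => ((Psi s / s) `^ p^-1)%:E)) :
  Cap_class n alpha p Psi = C_class n (Psi_alpha n alpha p Psi).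
Proof.
have n0 : (0 < n)%N by [].
have p0 : 0 < p by rewrite (lt_trans ltr01).
have apn : alpha * p < n%:R by rewrite mulrC -ltr_pdivlMr.
have [Phi Phi_incr [[c1 c10 h1] [c2 c20 h2]]] := Psi_incr.
have inP (s : R) : 0 <= s -> (`[0, +oo[%classic : set R) s by rewrite /= in_itv/= andbT.
have inP' (s : R) : 0 < s -> (`]0, +oo[%classic : set R) s by rewrite /= in_itv/= andbT.
pose K := Num.max c1 c2; have K0 : 0 < K by rewrite lt_max c10.
(* Extended by a constant to negative arguments, Phi is monotone on the line. *)
pose Phi1 (s : R) := Phi (Num.max s 0).
have m0 (s : R) : 0 <= Num.max s 0 by rewrite le_max lexx orbT.
have Psi_ge0 (s : R) : 0 <= s -> 0 <= Psi s.
  by rewrite le_eqVlt => /predU1P[<-|/Psi_gt0/ltW//]; rewrite Psi_0.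
have Phi_ge0 (s : R) : 0 <= s -> 0 <= Phi s.
  move=> s0; have := h1 s (inP s s0); rewrite -EFinM lee_fin => /(le_trans (Psi_ge0 s s0)).
  by rewrite pmulr_rge0.
have Phi1_ge0 (s : R) : 0 <= Phi1 s by exact: Phi_ge0.
have Phi1_nd : {homo Phi1 : x y / x <= y}.
  move=> x y xy; have : Num.max x 0 <= Num.max y 0.
    by rewrite ge_max !le_max xy lexx orbT.
  rewrite le_eqVlt => /predU1P[xyE|xy']; first by rewrite /Phi1 xyE.
  by apply/ltW/Phi_incr; rewrite ?in_itv/= ?andbT.
have Psi_le (s : R) : 0 <= s -> Psi s <= K * Phi1 s.
  move=> s0; have := h1 s (inP s s0); rewrite -EFinM lee_fin => /le_trans; apply.
  by rewrite /Phi1 (max_l s0) ler_wpM2r ?Phi_ge0// le_max lexx.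
have Phi1_le (s : R) : 0 <= s -> Phi1 s <= K * Psi s.
  move=> s0; have := h2 s (inP s s0); rewrite -EFinM lee_fin /Phi1 (max_l s0) => /le_trans; apply.
  by rewrite ler_wpM2r ?Psi_ge0// le_max lexx orbT.
have Psi_dbl (c : R) : 0 < c -> exists2 L, 0 < L & forall s, 0 < s -> Psi (c * s) <= L * Psi s.
  move=> c0; have [[L L0 hL] _] := Psi_scale c c0; exists L => // s s0.
  by have := hL s (inP' s s0); rewrite -EFinM lee_fin.
have Psi_dini : exists2 c, 0 < c & forall s, 0 < s ->
    (\int[lebesgue_measure]_(u in `]0%R, s[) ((Psi u / u) `^ p^-1 / u)%:E
    <= (c * (Psi s / s) `^ p^-1)%:E)%E.
  have [c c0 hc] := Psi_int; exists c => // s s0.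
  by have := hc s (inP' s s0); rewrite -EFinM.
have pV0 : 0 < p^-1 by rewrite invr_gt0.
have grow := @Psi_growth _ _ _ _ K0 Phi1_nd Psi_le Phi1_le Psi_dbl.
have summ := @sum_min_Psi _ _ _ _ _ pV0 K0 Phi1_nd Phi1_ge0 Psi_le Phi1_le Psi_gt0 Psi_dbl Psi_dini.
have surj (v : R) : 0 <= v -> exists2 s, 0 <= s & Psi s = v.
  move=> /inP/Psi_surj[s /=]; rewrite in_itv/= andbT => s0 sv.
  by exists s.
apply/seteqP; split => mu [c c0 hmu].
  have [C C0 hC] := bessel_cap_ball n0 alpha_gt0 alpha_lt_n p_gt1.
  have [L L0 hL] := grow C C0.
  exists (c * L) => [|[x r] /= r0]; first by rewrite mulr_gt0.
  have := hmu (eball x r) (@open_eball _ _ x r); move=> /le_trans; apply.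
  have := hC x r r0; have := bessel_cap_ge0 alpha p (eball x r).
  case: (bessel_cap alpha p (eball x r)) => // k; rewrite lee_fin => k0; rewrite lee_fin => ku.
  rewrite Psi_alphaE -[X in (X <= _)%E]/((c * Psi k)%:E) -EFinM lee_fin -mulrA ler_pM2l//.
  by apply: hL => //; exact: cap_scale_gt0.
have hmu' (x : 'rV[R]_n) (r : R) : 0 < r ->
    (mu (tent (eball x r)) <= (c * Psi (cap_scale n alpha p r))%:E)%E.
  by move=> r0; have := hmu (x, r) r0; rewrite /= Psi_alphaE -EFinM.
have [C C0 hC] := carleson_estimate n0 alpha_gt0 alpha_lt_n p_gt1 apn Psi_gt0 Psi_0 surj grow summ c0.
have [L L0 hL] := grow 1 ltr01.
have [L2 L20 hL2] := Psi_dbl 2 (ltr0Sn _ _).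
have est (O : set 'rV[R]_n) (eta : R) : open O -> (bessel_cap alpha p O < eta%:E)%E ->
    (mu (tent O) <= (C * L * Psi eta)%:E)%E.
  move=> oO capO; have eta0 : 0 < eta.
    by rewrite -lte_fin (le_lt_trans _ capO)// bessel_cap_ge0.
  have [g [N [mg g0 gN Neta aeg]]] := bessel_cap_lt alpha_lt_n p_gt1 capO.
  apply: (le_trans (hC mu O g N hmu' oO mg g0 gN aeg)).
  rewrite lee_fin -mulrA ler_pM2l//; apply: hL; rewrite ?mul1r//.
  by rewrite -lee_fin -gN integral_ge0// => y _; rewrite lee_fin powR_ge0.
exists (C * L * L2) => [|O oO]; first by rewrite !mulr_gt0.
have := est O; have := bessel_cap_ge0 alpha p O.
case: (bessel_cap alpha p O) => [k|_ _|]//=; last first.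
  by rewrite gt0_muley ?lte_fin ?mulr_gt0// leey.
(* The infimum defining the capacity need not be attained: a positive value is
   doubled, and for value 0 all eta > 0 are used. *)
rewrite lee_fin le_eqVlt => /predU1P[<-{k}|k0] hO; last first.
  have k2 : (k%:E < (2 * k)%:E)%E by rewrite lte_fin ltr_pMl// ltr1n.
  apply: (le_trans (hO _ oO k2)); rewrite -EFinM lee_fin -[leRHS]mulrA.
  by rewrite ler_pM2l ?mulr_gt0// hL2.
rewrite Psi_0 mule0; apply/lee_addgt0Pr => e e0; rewrite add0e.
have [s s0 se] := surj (e / (C * L)) (divr_ge0 (ltW e0) (mulr_ge0 (ltW C0) (ltW L0))).
have sp : 0 < s.
  rewrite lt_def s0 andbT; apply/eqP => sE; move: se; rewrite sE Psi_0 => /esym/eqP.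
  by rewrite gt_eqF// divr_gt0// mulr_gt0.
apply: (le_trans (hO s oO _)); first by rewrite lte_fin.
by rewrite se lee_fin mulrC divfK// gt_eqF// mulr_gt0.
Qed.
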